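(* Let $K$ and $L$ be totally real number fields of degree $n\le 4$ with discriminants $d_K=d_L=d$, where $d$ is a fundamental discriminant, and suppose $\gcd(n,d)=1$. Then $K\cong L$ if and only if $\theta_K=\theta_L$.
   Context: For a totally real number field $F$ with ring of integers $\mathcal{O}_F$, let $\mathcal{O}_F^{0}=\{\alpha\in\mathcal{O}_F:\operatorname{Tr}_{F/\mathbb{Q}}(\alpha)=0\}$ and define $\theta_F(z):=\sum_{\alpha\in\mathcal{O}_F^{0}} e^{\pi i\operatorname{Tr}_{F/\mathbb{Q}}(\alpha^2) z}$ for $z$ in the upper half-plane; by convention $\theta_{\mathbb{Q}}$ is the constant function $1$. *)

(* Defs.v *)
From HB Require Import structures.
From mathcomp Require Import all_boot all_order all_algebra all_field.
From mathcomp Require Import finmap boolp classical_sets functions cardinality.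
From mathcomp Require Import reals topology normedtype sequences exp trigo.
From mathcomp Require Import complex.
From mathcomp.analysis.showcase Require Import summability.

Set Implicit Arguments.
Unset Strict Implicit.
Unset Printing Implicit Defensive.

Import Order.TTheory GRing.Theory Num.Theory.
Import passmx numFieldNormedType.Exports.

Local Open Scope classical_set_scope.
Local Open Scope ring_scope.

(* A number field is a [fieldExtType rat], i.e. a finite extension of Q. *)

Definition totally_real (R : realType) (F : fieldExtType rat) : Prop :=
  forall (s : {rmorphism F -> R[i]}) (x : F), complex.Im (s x) = 0.

Definition ring_of_integers (F : fieldExtType rat) : set F :=
  [set x | integralOver (intr : int -> F) x].
Arguments ring_of_integers : clear implicits.

Definition field_trace (F : fieldExtType rat) (x : F) : rat :=
  \tr (mxof (vbasis {:F}) (vbasis {:F}) (amull x)).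

Definition int_comb (V : zmodType) (n : nat) (b : n.-tuple V)
    (c : {ffun 'I_n -> int}) : V :=
  \sum_(i < n) tnth b i *~ c i.

Definition integral_basis (F : fieldExtType rat)
    (b : (\dim {:F}).-tuple F) : Prop :=
  set_bij setT (ring_of_integers F) (int_comb b).

Definition trace_gram (F : fieldExtType rat) (n : nat) (b : n.-tuple F) :
    'M[rat]_n :=
  \matrix_(i, j) field_trace (tnth b i * tnth b j).

(* The set below is a singleton: integral bases exist, and the determinant is
   the same for all of them.  The default value 0 is never a discriminant. *)
Definition discriminant (F : fieldExtType rat) : int :=
  xget 0 [set d : int | exists2 b : (\dim {:F}).-tuple F, integral_basis b &
                          \det (trace_gram b) = d%:~R :> rat].

Definition squarefree (m : int) : Prop :=
  forall k : int, (k ^+ 2 %| m)%Z -> `|k| = 1.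

(* [(m %% 4)%Z] is in {0, 1, 2, 3} also for negative [m].  The value 1, which
   is the discriminant of Q, is fundamental. *)
Definition fundamental_discriminant (d : int) : Prop :=
  ((d %% 4)%Z = 1 /\ squarefree d) \/
  (exists m : int, [/\ d = 4 * m, (m %% 4)%Z = 2 \/ (m %% 4)%Z = 3 &
                       squarefree m]).

Definition trace_zero_integers (F : fieldExtType rat) : set F :=
  [set x | ring_of_integers F x /\ field_trace x = 0].
Arguments trace_zero_integers : clear implicits.

Definition cexp (R : realType) (w : R[i]) : R[i] :=
  Complex (expR (complex.Re w) * cos (complex.Im w))
          (expR (complex.Re w) * sin (complex.Im w)).

Definition upper_half_plane (R : realType) : Type :=
  {z : R[i] | 0 < complex.Im z}.

(* [summability.sum] is the unordered sum (limit of the finite partial sums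
   along inclusion), here over the trace-zero integers and in the normed field
   R[i].  The series converges absolutely when [F] is totally real.  For F = Q
   the index set is {0}, so theta is the constant 1. *)
Definition theta (R : realType) (F : fieldExtType rat)
    (z : upper_half_plane R) : R[i] :=
  summability.sum
    (fun a : trace_zero_integers F =>
       cexp (Complex 0 (pi : R) * ratr (field_trace (\val a ^+ 2)) * \val z)
         : (R[i] : numFieldType)).

(* Main.v *)
(** The values at [z = iy] determine how often the form [q(x) = Tr(x^2)] takes each value on the
    lattice [O^0], of rank [n - 1 <= 3]. By Schiemann's theorem, positive definite integral ternary
    forms with the same theta series are equivalent; forms in fewer variables follow by adding large
    orthogonal squares. So there is an isometry [O_K^0 -> O_L^0].

    Schiemann's theorem is proved by a search through a tree of polyhedral cones.
    A pair of reduced forms is a point of a cone with 12 parameters. Once some pairs of vectors of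
    equal value have been matched, the least values outside them agree; the cone is split according to
    the vectors attaining them, and their equality is a linear equation. This stops when the cone
    is empty or when the Gram matrices agree up to a change of basis.

    As [n] is prime to [d], the trace is onto [Z], and up to sign the isometry extends to one from
    [O_K] to [O_L] fixing 1. In the conjugates it is a real orthogonal matrix [U]. If [d] is squarefree,
    the entries of [U] are algebraic integers: modulo a prime [p] dividing [d], the trace form of
    [O] has a radical of dimension one, spanned by some [beta] with [beta^2] in [p O]. The sums of the
    [2k]-th powers of the entries are then integers, nonincreasing in [k]; hence the entries are 0, 1
    or -1, and [U] permutes the conjugates.

    If [n = 3], then [d] may be even. The norm [N], the index form [I] and [h = q / 2] on [O^0] satisfy
    [27 N^2 + d I^2 = 4 h^3]. Comparing the two fields, [N_K I_L - N_L I_K] (or the sum) is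
    an integral multiple of [h^3], and it is too small unless it vanishes; so [N_K = N_L] or [N_K = - N_L]
    at each vector, so that a generator of [K] and its image have the same conjugates, up to sign. *)
From Stdlib Require ZArith List Permutation Bool Lia.

Module Ternary.
Import ZArith List Permutation Bool Lia.
Import ListNotations.
Open Scope Z_scope.

(** * Cones given by linear inequalities *)

(** A form takes infinitely many values, so the search needs a finite stock of vectors. For each
    sign pattern of a reduced form, a table lists the vectors among which the next least value is
    sought, with inequalities between them that hold for all reduced forms. A matched pair takes out
    two whole lines, and a plane is taken out on both sides as soon as the forms are known to agree
    on it.

    All tests are one-sided. Emptiness of a cone is proved by pivoting over the integers, and a
    computation that stops early can only make the search fail.

    For the fields, the integrality of the entries of [U] rests on primes that divide [d] exactly
    once, and so breaks down at 2 when 4 divides [d]. As the degree is prime to [d], this can matter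
    only for cubic fields. There the binary form [h] on the trace-zero lattice is still primitive;
    this is what turns a real multiple of [h^3] with integral values into an integral multiple. *)

Definition vec := list Z.

(* The virtual machine is strict, so boolean connectives are spelled out as conditionals *)
Notation "a 'ands' b" := (if a then b else false) (at level 40, left associativity).
Notation "a 'ors' b" := (if a then true else b) (at level 50, left associativity).

Fixpoint alls {T} (p : T -> bool) (l : list T) : bool :=
  match l with nil => true | x :: l => p x ands alls p l end.
Fixpoint exs {T} (p : T -> bool) (l : list T) : bool :=
  match l with nil => false | x :: l => p x ors exs p l end.
Fixpoint zip2 (f : Z -> Z -> Z) (a b : vec) : vec :=
  match a, b with x :: a, y :: b => f x y :: zip2 f a b | _, _ => nil end.
Fixpoint dot (a b : vec) : Z :=
  match a, b with x :: a, y :: b => x * y + dot a b | _, _ => 0 end.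
Definition vsub := zip2 Z.sub.
Fixpoint veq (a b : vec) : bool :=
  match a, b with nil, nil => true | x :: a, y :: b => (x =? y) ands veq a b | _, _ => false end.
Fixpoint vle (a b : vec) : bool :=
  match a, b with nil, nil => true | x :: a, y :: b => (x <=? y) ands vle a b | _, _ => false end.
Fixpoint nonneg (c : vec) : bool :=
  match c with nil => true | x :: c => (0 <=? x) ands nonneg c end.
Fixpoint nonpos (c : vec) : bool :=
  match c with nil => true | x :: c => (x <=? 0) ands nonpos c end.
Definition vsum (c : vec) := fold_right Z.add 0 c.
Definition zeros {T} (l : list T) : vec := map (fun _ => 0) l.

(* [Cone M s rows]: the rows of [M] are linear forms in parameters [u >= 0], where [u_i > 0] if
   [s_i] is set, subject to [c u >= 0] for the rows [(b, c)], and [c u > 0] if [b] is set *)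
Record cone := Cone { mat : list vec; strict : list bool; rows : list (bool * vec) }.

Definition pos_if (b : bool) (x : Z) : Prop := 0 <= x /\ (b = true -> 0 < x).
Definition point (S : cone) (u : vec) : Prop :=
  Forall2 pos_if (strict S) u /\ Forall (fun bc => pos_if (fst bc) (dot (snd bc) u)) (rows S).
Definition wf (S : cone) : Prop :=
  Forall (fun r => length r = length (strict S)) (mat S) /\
  Forall (fun bc => length (snd bc) = length (strict S)) (rows S).
(** The point [P] is represented only up to a positive factor: pivoting, division of the matrix by
    its content and rescaling of parameters all change the values by a common factor, and every
    comparison made is homogeneous. *)
Definition sat (S : cone) (P : list Z) : Prop :=
  exists u s t, 0 < s /\ 0 < t /\ point S u /\ Forall2 (fun r x => s * dot r u = t * x) (mat S) P.

Lemma alls_Forall {T} (p : T -> bool) l : alls p l = true <-> Forall (fun x => p x = true) l.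
Proof.
induction l as [|x l IH]; simpl; [split; auto|].
destruct (p x) eqn:E; rewrite Forall_cons_iff, ?IH; split; try easy; intros [H _]; congruence.
Qed.

Lemma exs_Exists {T} (p : T -> bool) l : exs p l = true <-> exists x, In x l /\ p x = true.
Proof.
induction l as [|x l IH]; simpl; [split; [easy|now intros [? [[] _]]]|].
destruct (p x) eqn:E; [split; eauto|].
rewrite IH; split; intros [y [H1 H2]]; exists y; intuition congruence.
Qed.

Lemma veq_eq a b : veq a b = true -> a = b.
Proof.
revert b; induction a as [|x a IH]; intros [|y b]; simpl; try easy.
destruct (Z.eqb_spec x y); try easy; intros; f_equal; auto.
Qed.

Lemma zip2_length f a b : length a = length b -> length (zip2 f a b) = length a.
Proof. revert b; induction a; intros [|y b]; simpl; try easy; intros; f_equal; auto. Qed.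

Lemma dot_zip2 p q f a b u : (forall x y, f x y = p * x + q * y) -> length a = length b ->
  dot (zip2 f a b) u = p * dot a u + q * dot b u.
Proof.
intros Hf; revert b u; induction a as [|x a IH]; intros [|y b] u; simpl; try easy; try lia.
destruct u as [|v u]; simpl; try lia; intros H; injection H as H; rewrite IH, Hf by easy; ring.
Qed.

Lemma dot_vsub a b u : length a = length b -> dot (vsub a b) u = dot a u - dot b u.
Proof. intros H; unfold vsub; rewrite (dot_zip2 1 (-1)) by (auto; intros; ring); ring. Qed.

Lemma dot_map p f a u : (forall x, f x = p * x) -> dot (map f a) u = p * dot a u.
Proof.
intros Hf; revert u; induction a as [|x a IH]; intros [|v u]; simpl; try lia; rewrite IH, Hf; ring.
Qed.

Lemma dot_zeros {T} (l : list T) u : dot (zeros l) u = 0.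
Proof. revert u; induction l; intros [|v u]; simpl; auto. Qed.

Lemma pos_dot s u c : Forall2 pos_if s u -> nonneg c = true -> 0 <= dot c u.
Proof.
intros Hu Hc; revert c Hc; induction Hu as [|b x s u [Hx _] _ IH]; intros [|y c] Hc; simpl in *; try lia.
destruct (Z.leb_spec 0 y); try easy; specialize (IH c Hc); nia.
Qed.

Lemma vle_dot s u a b : Forall2 pos_if s u -> vle a b = true -> dot a u <= dot b u.
Proof.
intros Hu; revert a b; induction Hu as [|c x s u [Hx _] _ IH]; intros [|y a] [|z b] H; simpl in *; try easy.
destruct (Z.leb_spec y z); try easy; specialize (IH a b H); nia.
Qed.

(** * Dropping parameters *)

(** When a row [c] with coefficients of one sign takes the value 0, every parameter with a nonzero
    coefficient is 0. The columns kept are those where [c] is zero. *)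
Fixpoint keepz {T} (c : vec) (v : list T) : list T :=
  match c, v with
  | x :: c, y :: v => match x with 0 => y :: keepz c v | _ => keepz c v end
  | _, _ => nil
  end.
Definition dropcols (c : vec) (S : cone) : cone :=
  Cone (map (keepz c) (mat S)) (keepz c (strict S)) (map (fun bc => (fst bc, keepz c (snd bc))) (rows S)).

Definition vanish (c u : vec) : Prop := Forall2 (fun x y => x = 0 \/ y = 0) c u.

Lemma keepz_length {T U} (c : vec) (v : list T) (w : list U) :
  length v = length w -> length (keepz c v) = length (keepz c w).
Proof.
revert v w; induction c as [|x c IH]; intros [|y v] [|z w]; simpl; try easy.
intros H; injection H as H; destruct x; simpl; auto.
Qed.

Lemma dot_keepz c r u : vanish c u -> length r = length u -> dot (keepz c r) (keepz c u) = dot r u.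
Proof.
intros H; revert r; induction H as [|x y c u Hxy _ IH]; intros [|z r] Hr; simpl in *; try easy.
injection Hr as Hr; specialize (IH r Hr).
destruct x; simpl; destruct Hxy; subst; lia.
Qed.

Lemma keepz_point c s u : Forall2 pos_if s u -> Forall2 pos_if (keepz c s) (keepz c u).
Proof.
intros H; revert c; induction H; intros [|z c]; simpl; auto; destruct z; auto.
Qed.

Lemma dropcols_wf c S : wf S -> wf (dropcols c S).
Proof.
intros [H1 H2]; split; simpl; apply Forall_map.
- revert H1; apply Forall_impl; intros; apply keepz_length; auto.
- revert H2; apply Forall_impl; intros; simpl; apply keepz_length; auto.
Qed.

Lemma Forall2_map_l {A B C} (R : B -> C -> Prop) (f : A -> B) l m :
  Forall2 (fun x y => R (f x) y) l m -> Forall2 R (map f l) m.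
Proof. induction 1; simpl; auto. Qed.

Lemma Forall2_imp {A B} (P : A -> Prop) (R R' : A -> B -> Prop) l m :
  Forall P l -> (forall x y, P x -> R x y -> R' x y) -> Forall2 R l m -> Forall2 R' l m.
Proof. intros HP H HR; induction HR; inversion HP; subst; auto. Qed.

Lemma Forall2_len {A B} (R : A -> B -> Prop) l m : Forall2 R l m -> length l = length m.
Proof. induction 1; simpl; auto. Qed.

Definition satat (S : cone) (P : list Z) (u : vec) : Prop :=
  exists s t, 0 < s /\ 0 < t /\ point S u /\ Forall2 (fun r x => s * dot r u = t * x) (mat S) P.

Lemma dropcols_sat c S P u : wf S -> vanish c u -> satat S P u -> sat (dropcols c S) P.
Proof.
intros [W1 W2] Hc (s & t & Hs & Ht & [H1 H2] & H3).
pose proof (Forall2_len _ _ _ H1) as Hl.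
exists (keepz c u), s, t; repeat split; auto; simpl.
- now apply keepz_point.
- apply Forall_map; revert W2 H2; rewrite !Forall_forall; intros W2 H2 bc Hbc; simpl.
  rewrite dot_keepz; auto; rewrite W2; auto.
- apply Forall2_map_l; revert H3; apply (Forall2_imp _ _ _ _ _ W1).
  intros r x Hr E; rewrite dot_keepz; auto; congruence.
Qed.

Fixpoint possb (c : vec) (s : list bool) : bool :=
  match c, s with x :: c, b :: s => (b ands (0 <? x)) ors possb c s | _, _ => false end.
Fixpoint negsb (c : vec) (s : list bool) : bool :=
  match c, s with x :: c, b :: s => (b ands (x <? 0)) ors negsb c s | _, _ => false end.

Lemma possb_dot s u c : Forall2 pos_if s u -> nonneg c = true -> possb c s = true -> 0 < dot c u.
Proof.
intros Hu; revert c; induction Hu as [|b x s u [Hx Hb] Hu IH]; intros [|y c] H1 H2; simpl in *; try easy.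
destruct (Z.leb_spec 0 y); try easy.
pose proof (pos_dot _ _ _ Hu H1).
destruct b; simpl in *.
- specialize (Hb eq_refl); destruct (Z.ltb_spec 0 y); [nia|]. specialize (IH _ H1 H2); nia.
- specialize (IH _ H1 H2); nia.
Qed.

Lemma nonneg_vanish s u c : length c = length s -> Forall2 pos_if s u -> nonneg c = true -> dot c u <= 0 ->
  vanish c u.
Proof.
intros Hl Hu; revert c Hl; induction Hu as [|b x s u [Hx Hb] Hu IH]; intros [|y c] Hl H1 H2; simpl in *; try easy.
- constructor.
- destruct (Z.leb_spec 0 y); try easy.
  pose proof (pos_dot _ _ _ Hu H1).
  constructor; [|apply IH; auto; nia].
  destruct (Z.eq_dec y 0), (Z.eq_dec x 0); auto; nia.
Qed.

Lemma nonpos_opp c : nonpos c = true -> nonneg (map Z.opp c) = true.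
Proof.
induction c as [|x c IH]; simpl; auto.
destruct (Z.leb_spec x 0), (Z.leb_spec 0 (-x)); try easy; lia.
Qed.

Lemma vanish_opp c u : vanish (map Z.opp c) u -> vanish c u.
Proof.
revert u; induction c as [|x c IH]; intros u H; inversion H; subst; constructor; auto.
- lia.
- now apply IH.
Qed.

Lemma negsb_possb c s : negsb c s = possb (map Z.opp c) s.
Proof.
revert s; induction c as [|x c IH]; intros [|b s]; simpl; auto.
rewrite IH; replace (0 <? - x) with (x <? 0); auto.
destruct (Z.ltb_spec x 0), (Z.ltb_spec 0 (-x)); lia.
Qed.

Lemma dot_opp c u : dot (map Z.opp c) u = - dot c u.
Proof. rewrite (dot_map (-1)); intros; ring. Qed.

Lemma nonpos_vanish s u c : length c = length s -> Forall2 pos_if s u -> nonpos c = true -> 0 <= dot c u ->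
  vanish c u.
Proof.
intros; apply vanish_opp, (nonneg_vanish s); auto; [now rewrite length_map|now apply nonpos_opp|].
rewrite dot_opp; lia.
Qed.

Lemma negsb_dot s u c : Forall2 pos_if s u -> nonpos c = true -> negsb c s = true -> dot c u < 0.
Proof.
intros H1 H2 H3; rewrite negsb_possb in H3.
pose proof (possb_dot _ _ _ H1 (nonpos_opp _ H2) H3); rewrite dot_opp in *; lia.
Qed.

Lemma nonneg_nonpos_dot c u : nonneg c = true -> nonpos c = true -> dot c u = 0.
Proof.
revert u; induction c as [|x c IH]; intros [|y u]; simpl; auto; intros H1 H2.
destruct (Z.leb_spec 0 x); try easy; destruct (Z.leb_spec x 0); try easy.
rewrite IH by easy; assert (x = 0) by lia; subst; lia.
Qed.


Local Arguments Z.mul : simpl never.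
Local Arguments Z.add : simpl never.
Local Arguments Z.sub : simpl never.
(** * Change of parameters *)

Fixpoint firstpos (c : vec) : nat :=
  match c with nil => O | x :: c => if 0 <? x then O else S (firstpos c) end.
Fixpoint decnth (b : nat) (c : vec) : vec :=
  match c with nil => nil | x :: c => match b with O => (x - 1) :: c | S b => x :: decnth b c end end.
Fixpoint setnth {T} (b : nat) (y : T) (c : list T) : list T :=
  match c with nil => nil | x :: c => match b with O => y :: c | S b => x :: setnth b y c end end.
Fixpoint unitv {T} (b : nat) (k : list T) : vec :=
  match k with nil => nil | _ :: k => match b with O => 1 :: zeros k | S b => 0 :: unitv b k end end.
(** This is [p] times the row [c] in the new parameters, where [p = r_b]. The row [rt] is [r] with
    its entry at [b] lowered by one; thus the formula [p x - c_b y] yields [c_b] at the place [b]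
    too, as it should. *)
Definition pivrow (p : Z) (rt : vec) (b : nat) (c : vec) : vec :=
  let cb := nth b c 0 in
  match cb with
  | 0 => match p with 1 => c | _ => map (Z.mul p) c end
  | _ => zip2 (fun x y => p * x - cb * y) c rt
  end.
Fixpoint gcdl (c : vec) (g : Z) : Z :=
  match c with
  | nil => g
  | x :: c => match g with 1 => 1 | _ => match x with 0 => gcdl c g | _ => gcdl c (Z.gcd x g) end end
  end.
Definition reduce (c : vec) : vec :=
  let g := gcdl c 0 in match g with 0 => c | 1 => c | _ => map (fun x => x / g) c end.
(** The rows of the matrix must stay in proportion, so they share one divisor, whereas each
    constraint may be divided by its own. *)
Definition reducem (m : list vec) : list vec :=
  let g := fold_left (fun g c => gcdl c g) m 0 in
  match g with 0 => m | 1 => m | _ => map (map (fun x => x / g)) m end.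

(* The parameter [u_b] is replaced by the value of the row [r], where [r_b > 0]; the constraint
   [u_b >= 0] becomes a row *)
Definition pivot (s : bool) (r : vec) (b : nat) (rest : list (bool * vec)) (S : cone) : cone :=
  let p := nth b r 0 in
  let T := pivrow p (decnth b r) b in
  let old := (nth b (strict S) false, T (unitv b (strict S))) in
  let M := map T (mat S) in
  let s' := setnth b s (strict S) in
  match p with
  | 1 => Cone M s' (old :: map (fun bc => (fst bc, T (snd bc))) rest)
  | _ => Cone (reducem M) s' (old :: map (fun bc => (fst bc, reduce (T (snd bc)))) rest)
  end.

Lemma setnth_length {T} b y (c : list T) : length (setnth b y c) = length c.
Proof. revert b; induction c; intros [|b]; simpl; auto. Qed.

Lemma decnth_length b c : length (decnth b c) = length c.
Proof. revert b; induction c; intros [|b]; simpl; auto. Qed.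

Lemma unitv_length {T} b (k : list T) : length (unitv b k) = length k.
Proof. revert b; induction k; intros [|b]; simpl; auto; unfold zeros; rewrite length_map; auto. Qed.

Lemma dot_setnth c b y u : length c = length u -> (b < length u)%nat ->
  dot c (setnth b y u) = dot c u + nth b c 0 * (y - nth b u 0).
Proof.
revert b u; induction c as [|x c IH]; intros b [|v u]; simpl; try easy; try lia.
intros H Hb; injection H as H; destruct b; simpl; [lia|].
rewrite IH by lia; lia.
Qed.

Lemma dot_decnth b r u : length r = length u -> (b < length u)%nat ->
  dot (decnth b r) u = dot r u - nth b u 0.
Proof.
revert b u; induction r as [|x r IH]; intros b [|v u]; simpl; try easy; try lia.
intros H Hb; injection H as H; destruct b; simpl; [lia|].
rewrite IH by lia; lia.
Qed.

Lemma dot_unitv {T} b (k : list T) u : length k = length u -> dot (unitv b k) u = nth b u 0.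
Proof.
revert b u; induction k as [|x k IH]; intros b [|v u]; simpl; try easy; [now destruct b|].
intros H; injection H as H; destruct b; simpl; [rewrite dot_zeros; lia|rewrite IH; lia].
Qed.

Lemma nth_decnth b r : (b < length r)%nat -> nth b (decnth b r) 0 = nth b r 0 - 1.
Proof. revert b; induction r; intros [|b]; simpl; try lia; intros; rewrite IHr; lia. Qed.

Lemma firstpos_nth c : nonpos c = false -> (firstpos c < length c)%nat /\ 0 < nth (firstpos c) c 0.
Proof.
induction c as [|x c IH]; simpl; try easy.
destruct (Z.leb_spec x 0), (Z.ltb_spec 0 x); simpl; try lia.
intros; destruct IH; auto; lia.
Qed.

Lemma pivrow_length p rt b c : length c = length rt -> length (pivrow p rt b c) = length rt.
Proof.
unfold pivrow; intros H; destruct (nth b c 0); [destruct p as [|[]|]| |];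
  rewrite ?length_map, ?zip2_length; auto.
Qed.

Lemma dot_pivrow p r b c u : length r = length u -> length c = length u -> (b < length u)%nat ->
  p = nth b r 0 -> dot (pivrow p (decnth b r) b c) (setnth b (dot r u) u) = p * dot c u.
Proof.
intros Hr Hc Hb Hp; set (u' := setnth b _ u).
assert (E : dot (pivrow p (decnth b r) b c) u' = p * dot c u' - nth b c 0 * dot (decnth b r) u').
{ unfold pivrow; destruct (nth b c 0) as [|q|q] eqn:E.
  - destruct p as [|[]|]; rewrite ?(dot_map _ _ _ _ (fun x => eq_refl)); lia.
  - rewrite (dot_zip2 p (- Z.pos q)); [ring|intros; ring|rewrite decnth_length; congruence].
  - rewrite (dot_zip2 p (- Z.neg q)); [ring|intros; ring|rewrite decnth_length; congruence]. }
rewrite E; unfold u'; rewrite !dot_setnth by (rewrite ?decnth_length; lia).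
rewrite nth_decnth, dot_decnth, <- Hp by lia; ring.
Qed.

Lemma gcdl_divide c g : 0 <= g -> 0 <= gcdl c g /\ (gcdl c g | g) /\ Forall (fun x => (gcdl c g | x)) c.
Proof.
revert g; induction c as [|x c IH]; intros g Hg; [split; [auto|split; [reflexivity|constructor]]|].
assert (E : gcdl (x :: c) g = 1 \/ gcdl (x :: c) g = gcdl c (Z.gcd x g)).
{ destruct x; cbn -[Z.gcd]; rewrite ?Z.gcd_0_l, ?Z.abs_eq by auto; destruct g as [|[]|]; auto. }
destruct E as [->| ->].
- split; [lia|split; [apply Z.divide_1_l|apply Forall_forall; intros; apply Z.divide_1_l]].
- destruct (IH (Z.gcd x g) (Z.gcd_nonneg _ _)) as (H1 & H2 & H3).
  split; [auto|split; [|constructor; auto]]; etransitivity; eauto; [apply Z.gcd_divide_r|apply Z.gcd_divide_l].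
Qed.

Lemma dot_div c g u : g <> 0 -> Forall (fun x => (g | x)) c -> dot c u = g * dot (map (fun x => x / g) c) u.
Proof.
intros Hg H; revert u; induction H as [|x c [y ->] _ IH]; intros [|v u]; simpl; try lia.
rewrite IH, Z.div_mul by auto; ring.
Qed.

Lemma reduce_dot c : exists g, 0 < g /\ forall u, dot c u = g * dot (reduce c) u.
Proof.
unfold reduce; destruct (gcdl_divide c 0 (Z.le_refl 0)) as (H1 & _ & H3).
destruct (gcdl c 0) as [|[]|] eqn:E; try (exists 1; split; [lia|intros; ring]); try easy;
  eexists; (split; [|intros; apply dot_div; eauto; lia]); lia.
Qed.

Lemma reduce_length c : length (reduce c) = length c.
Proof. unfold reduce; destruct (gcdl c 0) as [|[]|]; rewrite ?length_map; auto. Qed.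

Lemma reducem_dot m : exists g, 0 < g /\
  Forall2 (fun c c' => length c' = length c /\ forall u, dot c u = g * dot c' u) m (reducem m).
Proof.
assert (K : forall m g, 0 <= g -> let h := fold_left (fun g c => gcdl c g) m g in
  0 <= h /\ (h | g) /\ Forall (Forall (fun x => (h | x))) m).
{ clear; induction m as [|c m IH]; intros g Hg; simpl; [split; [auto|split; [reflexivity|constructor]]|].
  destruct (gcdl_divide c g Hg) as (H1 & H2 & H3), (IH _ H1) as (H4 & H5 & H6).
  split; [auto|split; [etransitivity; eauto|constructor; auto]].
  revert H3; apply Forall_impl; intros; etransitivity; eauto. }
destruct (K m 0 (Z.le_refl 0)) as (H1 & _ & H3); unfold reducem.
assert (K1 : Forall2 (fun c c' => length c' = length c /\ forall u, dot c u = 1 * dot c' u) m m).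
{ clear; induction m; constructor; auto; split; auto; intros; ring. }
set (g := fold_left (fun g c => gcdl c g) m 0) in *; clearbody g.
assert (K2 : 0 < g -> Forall2 (fun c c' => length c' = length c /\ forall u, dot c u = g * dot c' u)
  m (map (map (fun x => x / g)) m)).
{ clear H1 K1; intros Hg; induction H3; simpl; constructor; auto.
  split; [apply length_map|intros; apply dot_div; auto; lia]. }
destruct g as [|[]|]; try (exists 1; split; [lia|assumption]); try easy;
  (eexists; split; [|apply K2; lia]; lia).
Qed.

Lemma pos_if_mul b p x y : 0 < p -> p * x = y -> pos_if b x <-> pos_if b y.
Proof.
intros Hp <-; unfold pos_if; split; intros [H1 H2]; (split; [nia|intros Hb; specialize (H2 Hb); nia]).
Qed.

Lemma setnth_point s b x y u : Forall2 pos_if s u -> pos_if x y -> Forall2 pos_if (setnth b x s) (setnth b y u).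
Proof. intros H Hy; revert b; induction H; intros [|b]; simpl; constructor; auto. Qed.

Lemma nth_point s b u : Forall2 pos_if s u -> pos_if (nth b s false) (nth b u 0).
Proof. intros H; revert b; induction H; intros [|b]; simpl; auto; split; lia. Qed.

Lemma reducem_wf k m : Forall (fun r => length r = k) m -> Forall (fun r => length r = k) (reducem m).
Proof.
intros H; destruct (reducem_dot m) as (g & _ & F); induction F as [|? ? ? ? [E _]]; inversion H; subst; constructor; auto; congruence.
Qed.

Section Pivot.
Variables (s : bool) (r : vec) (b : nat) (rest : list (bool * vec)) (S : cone).
Hypothesis HS : wf S.
Hypothesis Hrest : incl rest (rows S).
Hypothesis Hr : length r = length (strict S).
Hypothesis Hb : (b < length r)%nat.

Let T := pivrow (nth b r 0) (decnth b r) b.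

Lemma pivot_wf : wf (pivot s r b rest S).
Proof.
destruct HS as [W1 W2].
assert (LT : forall c, length c = length (strict S) -> length (T c) = length (strict S)).
{ intros c Hc; unfold T; rewrite pivrow_length; rewrite decnth_length; congruence. }
assert (LM : Forall (fun c => length c = length (strict S)) (map T (mat S))).
{ apply Forall_map; revert W1; apply Forall_impl; auto. }
unfold pivot; fold T; destruct (nth b r 0) as [|[]|]; split; simpl; rewrite setnth_length; auto using reducem_wf;
  (constructor; [simpl; apply LT, unitv_length|]); apply Forall_map, Forall_forall; intros bc Hbc; simpl;
  rewrite ?reduce_length; apply LT; rewrite Forall_forall in W2; auto.
Qed.

Lemma pivot_point u : 0 < nth b r 0 -> point S u -> pos_if s (dot r u) ->
  point (pivot s r b rest S) (setnth b (dot r u) u).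
Proof.
intros Hp [H1 H2] Hs.
pose proof (Forall2_len _ _ _ H1) as Hl; destruct HS as [W1 W2].
assert (DT : forall c, length c = length u -> dot (T c) (setnth b (dot r u) u) = nth b r 0 * dot c u).
{ intros c Hc; apply dot_pivrow; auto; lia. }
assert (K1 : pos_if (nth b (strict S) false) (dot (T (unitv b (strict S))) (setnth b (dot r u) u))).
{ rewrite DT by (rewrite unitv_length; auto); rewrite dot_unitv by auto.
  apply (pos_if_mul _ (nth b r 0) (nth b u 0)); auto; now apply nth_point. }
assert (K2 : Forall (fun bc => pos_if (fst bc) (dot (T (snd bc)) (setnth b (dot r u) u))) rest).
{ apply Forall_forall; intros bc Hbc; apply Hrest in Hbc; rewrite Forall_forall in H2, W2.
  rewrite DT by (rewrite W2; auto); apply (pos_if_mul _ (nth b r 0) (dot (snd bc) u)); auto. }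
unfold pivot; fold T; destruct (nth b r 0) as [|[]|] eqn:E; try easy; split; simpl; auto using setnth_point;
  (constructor; [assumption|]); apply Forall_map; revert K2; apply Forall_impl; intros bc; simpl; auto;
  destruct (reduce_dot (T (snd bc))) as (g & Hg & ->); intros H; eapply pos_if_mul; eauto.
Qed.

Lemma pivot_mat P u s0 t0 : 0 < nth b r 0 -> point S u -> 0 < s0 -> 0 < t0 ->
  Forall2 (fun r x => s0 * dot r u = t0 * x) (mat S) P ->
  exists s1 t1, 0 < s1 /\ 0 < t1 /\
  Forall2 (fun c x => s1 * dot c (setnth b (dot r u) u) = t1 * x) (mat (pivot s r b rest S)) P.
Proof.
intros Hp [H1 _] Hs Ht H.
pose proof (Forall2_len _ _ _ H1) as Hl; destruct HS as [W1 W2].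
assert (F : Forall2 (fun c x => s0 * dot c (setnth b (dot r u) u) = (nth b r 0 * t0) * x) (map T (mat S)) P).
{ apply Forall2_map_l; revert H; apply (Forall2_imp _ _ _ _ _ W1); intros c x Hc E.
  unfold T; rewrite dot_pivrow by (auto; lia); rewrite <- Z.mul_assoc, <- E; ring. }
destruct (reducem_dot (map T (mat S))) as (g & Hg & G).
assert (F' : Forall2 (fun c x => (s0 * g) * dot c (setnth b (dot r u) u) = (nth b r 0 * t0) * x) (reducem (map T (mat S))) P).
{ revert F; generalize P; induction G as [|c c' m m' [_ Hc] _ IH]; intros Q F; inversion F; subst; constructor; auto.
  rewrite <- Z.mul_assoc, <- Hc; auto. }
assert (0 < nth b r 0 * t0) by nia.
unfold pivot; fold T; destruct (nth b r 0) as [|[]|] eqn:E; try easy; simpl;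
  first [ eexists _, _; split; [|split; [|exact F]]; assumption
        | eexists _, _; split; [|split; [|exact F']]; [nia|assumption] ].
Qed.
End Pivot.

(** * Feasibility of cones *)

(** A row without positive entries can hold only with equality; [Flat] reports it, unless strictness
    makes it contradictory. The rows that are returned have a positive entry, on which one can
    pivot. *)
Inductive verdict := Empty | Flat (c : vec) | Rows (l : list (bool * vec)).
Fixpoint scan (s : list bool) (l acc : list (bool * vec)) : verdict :=
  match l with
  | nil => Rows acc
  | (b, c) :: l =>
    if nonneg c then
      if b then
        if possb c s then scan s l acc
        else if nonpos c then Empty else scan s l ((b, c) :: acc)
      else scan s l acc
    else if nonpos c then if b then Empty else if negsb c s then Empty else Flat c
    else scan s l ((b, c) :: acc)
  end.
Fixpoint findneg (l acc : list (bool * vec)) : option (bool * vec * list (bool * vec)) :=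
  match l with
  | nil => None
  | (b, c) :: l => if vsum c <=? 0 then Some (b, c, rev_append acc l) else findneg l ((b, c) :: acc)
  end.
(* Pivots until all rows are positive at [u = (1, ..., 1)] *)
Fixpoint tighten (fuel : nat) (S : cone) : option cone :=
  match fuel with
  | O => Some S
  | S n =>
    match scan (strict S) (rows S) nil with
    | Empty => None
    | Flat c => tighten n (dropcols c S)
    | Rows l =>
      match findneg l nil with
      | None => Some (Cone (mat S) (strict S) l)
      | Some (b, c, rest) => tighten n (pivot b c (firstpos c) rest S)
      end
    end
  end.
(* Imposes [e u = 0] *)
Definition addeq (e : vec) (S : cone) : option cone :=
  if nonneg e then
    if nonpos e then Some S else if possb e (strict S) then None else Some (dropcols e S)
  else if nonpos e then if negsb e (strict S) then None else Some (dropcols e S)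
  else
    let b := firstpos e in
    let S1 := pivot false e b (rows S) S in
    Some (dropcols (unitv b (strict S1)) S1).
Definition addrows (l : list (bool * vec)) (S : cone) := Cone (mat S) (strict S) (l ++ rows S).
(** Emptiness does not involve the matrix, and the test is cheaper without it. *)
Definition bare (S : cone) := Cone nil (strict S) (rows S).
(** A cone returned for lack of fuel still represents all the points of the given one. Only [None]
    is ever used as evidence, so this bound does not affect soundness. *)
Definition fuelT := 60%nat.
Definition infeasible (S : cone) : bool := match tighten fuelT S with None => true | _ => false end.

Fixpoint colgcd (M : list vec) (g : vec) : vec :=
  match M with
  | nil => g
  | r :: M => colgcd M (zip2 (fun x g => match g with 1 => 1 | _ => match x with 0 => g | _ => Z.gcd x g end end) r g)
  end.
(** As the parameters are nonnegative, a constraint implies any other with larger coefficients,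
    provided that it is strict if the other is. *)
Definition rowle (a b : bool * vec) : bool := vle (snd a) (snd b) ands (fst a ors negb (fst b)).
Fixpoint prune (acc l : list (bool * vec)) : list (bool * vec) :=
  match l with
  | nil => acc
  | v :: l => if exs (fun p => rowle p v) acc then prune acc l
              else prune (v :: filter (fun p => negb (rowle v p)) acc) l
  end.
(* Divides each parameter by the greatest common divisor of its column, to keep the numbers small *)
Definition normalize (S : cone) : cone :=
  let l := map (fun x => match x with 0 => 1 | _ => x end) (colgcd (mat S) (zeros (strict S))) in
  if alls (fun x => x =? 1) l then Cone (mat S) (strict S) (prune nil (rows S)) else
  let L := fold_left Z.lcm l 1 in
  let w := map (fun x => L / x) l in
  let M := map (fun r => zip2 Z.div r l) (mat S) in
  if alls (fun x => 0 <? x) l ands veq (zip2 Z.mul w l) (map (fun _ => L) l) ands (0 <? L)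
     ands alls (fun rr => veq (zip2 Z.mul (snd rr) l) (fst rr)) (combine (mat S) M)
  then Cone M (strict S) (prune nil (map (fun bc => (fst bc, reduce (zip2 Z.mul (snd bc) w))) (rows S)))
  else S.

Lemma scan_spec s u l acc : Forall2 pos_if s u ->
  Forall (fun bc => length (snd bc) = length s /\ pos_if (fst bc) (dot (snd bc) u)) l ->
  match scan s l acc with
  | Empty => False
  | Flat c => vanish c u
  | Rows l' => incl l' (l ++ acc) /\ (Forall (fun bc => nonpos (snd bc) = false) acc ->
      Forall (fun bc => nonpos (snd bc) = false) l')
  end.
Proof.
intros Hu; revert acc; induction l as [|[b c] l IH]; intros acc H; simpl; [split; [apply incl_refl|auto]|].
inversion H as [|? ? [Hl [H1 H2]] H3]; subst; simpl in *.
assert (IH' : match scan s l acc with Empty => False | Flat c => vanish c u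
  | Rows l' => incl l' ((b, c) :: l ++ acc) /\ (Forall (fun bc => nonpos (snd bc) = false) acc ->
      Forall (fun bc => nonpos (snd bc) = false) l') end).
{ specialize (IH acc H3); destruct (scan s l acc); auto; destruct IH; split; auto using incl_tl. }
assert (IH2 : nonpos c = false -> match scan s l ((b, c) :: acc) with Empty => False | Flat c => vanish c u
  | Rows l' => incl l' ((b, c) :: l ++ acc) /\ (Forall (fun bc => nonpos (snd bc) = false) acc ->
      Forall (fun bc => nonpos (snd bc) = false) l') end).
{ intros Hc; specialize (IH ((b, c) :: acc) H3); destruct (scan s l ((b, c) :: acc)); auto.
  destruct IH as [K1 K2]; split.
  - intros x Hx; apply K1 in Hx; simpl; rewrite in_app_iff in *; simpl in Hx; tauto.
  - intros; apply K2; constructor; auto. }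
destruct (nonneg c) eqn:En.
- destruct b; [|exact IH']; destruct (possb c s); [exact IH'|].
  destruct (nonpos c) eqn:Ep; [|exact (IH2 eq_refl)].
  specialize (H2 eq_refl); rewrite nonneg_nonpos_dot in H2; auto; lia.
- destruct (nonpos c) eqn:Ep; [|exact (IH2 eq_refl)]; destruct b.
  + specialize (H2 eq_refl); pose proof (pos_dot _ _ _ Hu (nonpos_opp _ Ep)) as K.
    rewrite dot_opp in K; lia.
  + destruct (negsb c s) eqn:Es; [|eapply nonpos_vanish; eauto].
    pose proof (negsb_dot _ _ _ Hu Ep Es); lia.
Qed.

Lemma findneg_spec l acc b c rest : findneg l acc = Some (b, c, rest) ->
  In (b, c) (l ++ acc) /\ incl rest (l ++ acc).
Proof.
revert acc; induction l as [|[b' c'] l IH]; intros acc; simpl; try easy.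
destruct (vsum c' <=? 0).
- intros H; injection H as -> -> <-; split; auto.
  intros x; rewrite rev_append_rev, in_app_iff, <- in_rev; simpl; rewrite in_app_iff; tauto.
- intros H; destruct (IH _ H) as [H1 H2]; split.
  + rewrite in_app_iff in *; simpl in *; tauto.
  + intros x Hx; apply H2 in Hx; simpl; rewrite in_app_iff in *; simpl in *; tauto.
Qed.

Lemma wf_incl S l : wf S -> incl l (rows S) -> wf (Cone (mat S) (strict S) l).
Proof. intros [W1 W2] Hl; split; auto; simpl; rewrite Forall_forall in *; auto. Qed.

Lemma sat_incl S P l : sat S P -> incl l (rows S) -> sat (Cone (mat S) (strict S) l) P.
Proof.
intros (u & s & t & Hs & Ht & [H1 H2] & H3) Hl; exists u, s, t; repeat split; auto; simpl.
rewrite Forall_forall in *; auto.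
Qed.

Lemma pivot_satat s r b rest S P u : wf S -> incl rest (rows S) -> length r = length (strict S) ->
  (b < length r)%nat -> 0 < nth b r 0 -> pos_if s (dot r u) -> satat S P u ->
  satat (pivot s r b rest S) P (setnth b (dot r u) u).
Proof.
intros HS Hi Hr Hb Hp Hu (s0 & t0 & Hs & Ht & H1 & H2).
destruct (pivot_mat s r b rest S HS Hr Hb P u s0 t0) as (s1 & t1 & K1 & K2 & K3); auto.
exists s1, t1; repeat split; auto; apply pivot_point; auto.
Qed.

Lemma sat_satat S P : sat S P <-> exists u, satat S P u.
Proof. split; intros (u & s & t & H); exists u, s, t; exact H. Qed.

Lemma tighten_sat n S P : wf S -> sat S P -> exists S', tighten n S = Some S' /\ wf S' /\ sat S' P.
Proof.
revert S; induction n as [|n IH]; intros S HS H; [exists S; auto|simpl].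
pose proof H as H'; apply sat_satat in H as [u Hu].
pose proof Hu as (s & t & Hs & Ht & [H1 H2] & H3).
pose proof (scan_spec (strict S) u (rows S) nil H1) as K.
destruct (scan (strict S) (rows S) nil) as [|c|l].
- exfalso; apply K; destruct HS as [_ W]; rewrite Forall_forall in *; auto.
- apply IH; [now apply dropcols_wf|]; apply (dropcols_sat _ _ _ u); auto; apply K.
  destruct HS as [_ W]; rewrite Forall_forall in *; auto.
- rewrite app_nil_r in K; destruct K as [K1 K2]; [destruct HS as [_ W]; rewrite Forall_forall in *; auto|].
  destruct (findneg l nil) as [[[b c] rest]|] eqn:E.
  + destruct (findneg_spec _ _ _ _ _ E) as [E1 E2]; rewrite app_nil_r in *.
    specialize (K2 (Forall_nil _)); rewrite Forall_forall in K2; apply K2 in E1 as E3; simpl in E3.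
    destruct (firstpos_nth _ E3) as [F1 F2].
    assert (Hc : length c = length (strict S)).
    { destruct HS as [_ W]; rewrite Forall_forall in W; apply (W (b, c)); auto. }
    apply IH.
    * apply pivot_wf; auto; now apply incl_tran with l.
    * apply sat_satat; exists (setnth (firstpos c) (dot c u) u); apply pivot_satat; auto; [now apply incl_tran with l|].
      rewrite Forall_forall in H2; apply (H2 (b, c)); auto.
  + eexists; split; [reflexivity|]; split; [now apply wf_incl|now apply sat_incl].
Qed.

Lemma bare_sat S P : wf S -> sat S P -> wf (bare S) /\ sat (bare S) nil.
Proof.
intros [W1 W2] (u & s & t & Hs & Ht & [H1 H2] & H3); split; [split; simpl; auto|].
exists u, s, t; repeat split; auto; simpl; auto.
Qed.

Lemma infeasible_sat S P : wf S -> sat S P -> infeasible S = false.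
Proof.
intros HS H; unfold infeasible; destruct (tighten_sat fuelT S P HS H) as (S' & -> & _); auto.
Qed.

Lemma vanish_unitv {T} b (l : list T) u : length l = length u -> vanish (unitv b l) (setnth b 0 u).
Proof.
revert b u; induction l as [|x l IH]; intros b [|y u]; simpl; try easy; [intros; destruct b; constructor|].
intros H; injection H as H; destruct b; constructor; auto; [|now apply IH].
revert u H; clear; induction l; intros [|y u]; simpl; try easy; constructor; auto.
Qed.

Lemma addeq_sat e S P u : wf S -> length e = length (strict S) -> satat S P u -> dot e u = 0 ->
  exists S', addeq e S = Some S' /\ wf S' /\ sat S' P.
Proof.
intros HS Hl Hu He; unfold addeq.
pose proof Hu as (s & t & Hs & Ht & [H1 H2] & H3).
destruct (nonneg e) eqn:En, (nonpos e) eqn:Ep.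
- exists S; repeat split; try apply HS; apply sat_satat; eauto.
- destruct (possb e (strict S)) eqn:Es; [pose proof (possb_dot _ _ _ H1 En Es); lia|].
  eexists; split; [reflexivity|]; split; [now apply dropcols_wf|].
  apply dropcols_sat with u; auto; apply (nonneg_vanish (strict S)); auto; lia.
- destruct (negsb e (strict S)) eqn:Es; [pose proof (negsb_dot _ _ _ H1 Ep Es); lia|].
  eexists; split; [reflexivity|]; split; [now apply dropcols_wf|].
  apply dropcols_sat with u; auto; apply (nonpos_vanish (strict S)); auto; lia.
- destruct (firstpos_nth _ Ep) as [F1 F2].
  assert (W : wf (pivot false e (firstpos e) (rows S) S)) by (apply pivot_wf; auto; apply incl_refl).
  assert (K : satat (pivot false e (firstpos e) (rows S) S) P (setnth (firstpos e) (dot e u) u)).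
  { apply pivot_satat; auto; [apply incl_refl|split; [lia|easy]]. }
  eexists; split; [reflexivity|]; split; [now apply dropcols_wf|].
  eapply dropcols_sat; eauto; rewrite He.
  assert (L : length (strict (pivot false e (firstpos e) (rows S) S)) = length u).
  { destruct K as (_ & _ & _ & _ & [K _] & _); apply Forall2_len in K; rewrite K, setnth_length; auto. }
  now apply vanish_unitv.
Qed.

Lemma addrows_sat l S P u : wf S -> satat S P u -> 
  Forall (fun bc => length (snd bc) = length (strict S) /\ pos_if (fst bc) (dot (snd bc) u)) l ->
  wf (addrows l S) /\ satat (addrows l S) P u.
Proof.
intros [W1 W2] (s & t & Hs & Ht & [H1 H2] & H3) H; split.
- split; auto; simpl; apply Forall_app; split; auto; revert H; apply Forall_impl; tauto.
- exists s, t; repeat split; auto; simpl; apply Forall_app; split; auto; revert H; apply Forall_impl; tauto.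
Qed.

Lemma prune_incl acc l : incl (prune acc l) (l ++ acc).
Proof.
revert acc; induction l as [|v l IH]; intros acc; simpl; [apply incl_refl|].
destruct (exs _ acc); [apply incl_tl; auto|].
intros x Hx; apply IH in Hx; rewrite in_app_iff in *; simpl in *; rewrite in_app_iff, filter_In in *; tauto.
Qed.

Lemma zip2_mul_dot a b u : length a = length b -> dot (zip2 Z.mul a b) u = dot a (zip2 Z.mul b u).
Proof.
revert b u; induction a as [|x a IH]; intros [|y b] [|z u]; simpl; try easy.
intros H; injection H as H; rewrite IH by auto; ring.
Qed.

Lemma normalize_sat S P : wf S -> sat S P -> wf (normalize S) /\ sat (normalize S) P.
Proof.
intros HS H; unfold normalize.
assert (I : forall l, incl (prune nil l) l).
{ intros l; pose proof (prune_incl nil l); now rewrite app_nil_r in *. }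
set (l := map _ (colgcd _ _)).
destruct (alls _ l); [split; [now apply wf_incl|now apply sat_incl]|].
set (L := fold_left _ _ _); set (w := map (fun x => L / x) l); set (M := map (fun r => zip2 Z.div r l) (mat S)).
(* The divisibilities are checked by the function itself, which returns the cone unchanged when they
   fail; so no property of the greatest common divisors has to be proved. *)
destruct (alls (fun x => 0 <? x) l) eqn:E1; [|auto].
destruct (veq (zip2 Z.mul w l) (map (fun _ => L) l)) eqn:E2; [|auto].
destruct (Z.ltb_spec 0 L) as [HL|]; [|auto].
destruct (alls (fun rr => veq (zip2 Z.mul (snd rr) l) (fst rr)) (combine (mat S) M)) eqn:E3; [|auto].
apply veq_eq in E2; apply alls_Forall in E1, E3.
assert (Hw : length w = length l) by apply length_map.
assert (Hlen : length l = length (strict S)).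
{ unfold l; rewrite length_map; destruct HS as [W _]; revert W; generalize (mat S).
  assert (E : length (zeros (strict S)) = length (strict S)) by apply length_map.
  revert E; generalize (zeros (strict S)); intros z Hz m; revert z Hz; induction m as [|r m IH]; intros z Hz Hm; simpl; auto.
  inversion Hm; subst; apply IH; auto; rewrite zip2_length; congruence. }
set (R := map (fun bc => (fst bc, reduce (zip2 Z.mul (snd bc) w))) (rows S)).
enough (wf (Cone M (strict S) R) /\ sat (Cone M (strict S) R) P) as [K1 K2].
{ split; [exact (wf_incl _ _ K1 (I R))|exact (sat_incl _ _ _ K2 (I R))]. }
destruct HS as [W1 W2]; split.
{ split; simpl; apply Forall_map.
  - revert W1; apply Forall_impl; intros r Hr; rewrite zip2_length; congruence.
  - revert W2; apply Forall_impl; intros r Hr; simpl; rewrite reduce_length, zip2_length; [exact Hr|rewrite Hw, Hlen; exact Hr]. }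
(* The new parameters are [l_i u_i]. The coefficients of a constraint become [c_i L / l_i], the
   factor [L] keeping them integral. *)
destruct H as (u & s & t & Hs & Ht & [H1 H2] & H3); exists (zip2 Z.mul l u), s, t.
pose proof (Forall2_len _ _ _ H1) as Hu.
repeat split; auto; simpl.
- clear - E1 Hlen H1; clearbody l; revert l E1 Hlen; induction H1 as [|b x s u Hb _ IH];
  intros [|y l] E1 Hlen; simpl in *; try easy; auto; inversion E1; subst; constructor; auto.
  apply (pos_if_mul _ y x (y * x)); auto; lia.
- apply Forall_map; rewrite Forall_forall in *; intros bc Hbc; simpl.
  destruct (reduce_dot (zip2 Z.mul (snd bc) w)) as (g & Hg & Eg).
  specialize (Eg (zip2 Z.mul l u)); rewrite zip2_mul_dot in Eg by (rewrite W2; auto; congruence).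
  assert (E : zip2 Z.mul w (zip2 Z.mul l u) = map (Z.mul L) u).
  { clear - E2 Hlen Hw Hu; clearbody L w; clearbody l; revert Hlen Hu; generalize (strict S).
    revert w u E2 Hw; induction l as [|y l IH]; intros [|z w] [|x u] E2 Hw [|b k] Hk Hu; simpl in *; try easy.
    injection E2 as E E'; f_equal; [rewrite <- E; ring|apply (IH w u E' ltac:(congruence) k); congruence]. }
  rewrite E in Eg; assert (D : dot (snd bc) (map (Z.mul L) u) = L * dot (snd bc) u).
  { generalize (snd bc) u; clear; induction v as [|x v IH]; intros [|y u]; simpl; try ring; rewrite IH; ring. }
  rewrite D in Eg; apply (pos_if_mul _ g _ _ Hg (eq_sym Eg)).
  apply (pos_if_mul _ L (dot (snd bc) u) _ HL (eq_refl _)); auto.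
- unfold M in *; clear - E3 H3 W1 Hlen; clearbody l; revert E3 W1; induction H3 as [|r x m P E F IH];
  simpl; intros E3 W; inversion E3; inversion W; subst; constructor; auto.
  simpl in *; match goal with H : veq _ _ = true |- _ => apply veq_eq in H as K end.
  rewrite <- zip2_mul_dot, K; auto; rewrite zip2_length; congruence.
Qed.

(** * The search tree *)

Definition v3 := (Z * Z * Z)%type.
Definition coefs (v : v3) : vec := let '(x, y, z) := v in [x * x; y * y; z * z; 2 * y * z; 2 * x * z; 2 * x * y].
(* [l = [a; b; c; r; s; t]] stands for [a x^2 + b y^2 + c z^2 + 2 r y z + 2 s x z + 2 t x y] *)
Definition qf (l : vec) (v : v3) : Z := dot (coefs v) l.
Definition add3 (v w : v3) : v3 := let '(x, y, z) := v in let '(x', y', z') := w in (x + x', y + y', z + z').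

Definition axpy (a : Z) (r acc : vec) : vec :=
  match a with 0 => acc | 1 => zip2 Z.add r acc | _ => zip2 (fun x y => a * x + y) r acc end.
Fixpoint lincomb (l : vec) (m : list vec) (z : vec) : vec :=
  match l, m with a :: l, r :: m => axpy a r (lincomb l m z) | _, _ => z end.
(** The value at [v] as a linear form in the parameters, with [z] the zero row. As [coefs v] has six
    entries, only six rows of [m] enter; the second form is reached by [skipn 6]. *)
Definition form (m : list vec) (z : vec) (v : v3) : vec := lincomb (coefs v) m z.

Definition sgn (e : bool) : Z := if e then 1 else -1.
(* Rows of a reduced form in the parameters [a, b, c, e r, e s, e t], with [e = sgn b] *)
Definition domrows (b : bool) : list vec :=
  [[-1; 1; 0; 0; 0; 0]; [0; -1; 1; 0; 0; 0]; [1; 0; 0; 0; 0; -2]; [1; 0; 0; 0; -2; 0]; [0; 1; 0; -2; 0; 0]] ++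
  (if b then [] else [[1; 1; 0; -2; -2; -2]]).
Definition twist (b : bool) (l : vec) : vec :=
  match l with [x; y; z; u; v; w] => [x; y; z; sgn b * u; sgn b * v; sgn b * w] | _ => l end.
Definition domcone (b : bool) : cone := Cone nil [true; false; false; b; b; b] (map (pair false) (domrows b)).
(* Not a constant, since the kernel might unfold [infeasible] before it *)
Notation dominated b v w :=
  (infeasible (addrows [(true, vsub (twist b (coefs v)) (twist b (coefs w)))] (domcone b))).

(* An entry [(i, 2 ^ i, v, d)]: [v] is not smaller than the vectors whose indices are the bits of [d] *)
Definition entry := (N * N * v3 * N)%type.
Fixpoint index (i : N) (l : list (v3 * N)) : list entry :=
  match l with nil => nil | (v, d) :: l => (i, N.shiftl 1 i, v, d) :: index (N.succ i) l end.
Definition univ (b : bool) : list entry := Eval vm_compute in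
  if b then index 0 
  [((1,0,0)%Z,0); ((0,1,0)%Z,1); ((0,0,1)%Z,3); ((1,-1,0)%Z,3); ((1,0,-1)%Z,7); ((0,1,-1)%Z,7); ((1,1,0)%Z,11); ((1,0,1)%Z,31); ((1,-1,1)%Z,47);
   ((1,1,-1)%Z,55); ((0,1,1)%Z,63); ((1,-1,-1)%Z,31); ((2,-1,0)%Z,75); ((2,0,-1)%Z,223); ((1,1,1)%Z,4095); ((1,-2,0)%Z,4171); ((0,2,-1)%Z,2047);
   ((2,-1,-1)%Z,3135); ((1,0,-2)%Z,12031); ((0,1,-2)%Z,67583); ((1,-2,1)%Z,447); ((1,1,-2)%Z,639); ((2,-1,1)%Z,5119); ((2,1,-1)%Z,9215);
   ((2,1,0)%Z,4171); ((2,0,1)%Z,12511); ((1,2,-1)%Z,69631); ((3,-1,0)%Z,16781387); ((0,2,1)%Z,131071); ((1,-2,-1)%Z,172031);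
   ((1,-1,-2)%Z,405503); ((1,-1,2)%Z,1642495); ((1,0,2)%Z,33882111); ((1,2,-2)%Z,78458879); ((1,2,0)%Z,16814155); ((2,-2,1)%Z,5316607);
   ((2,1,-2)%Z,78196735); ((2,1,1)%Z,63078399); ((2,2,-1)%Z,93552639); ((3,-1,-1)%Z,163839); ((3,-1,1)%Z,197145599);
   ((3,0,-1)%Z,50344159); ((3,1,-1)%Z,2199086183423); ((3,1,0)%Z,150999115)]%N
  else index 0 
  [((1,0,0)%Z,0); ((0,1,0)%Z,1); ((0,0,1)%Z,3); ((1,1,0)%Z,3); ((1,0,1)%Z,7); ((0,1,1)%Z,7); ((1,1,1)%Z,7); ((1,-1,0)%Z,11); ((1,0,-1)%Z,31);
   ((0,1,-1)%Z,63); ((1,-1,-1)%Z,511); ((1,-1,1)%Z,767); ((1,1,-1)%Z,895); ((2,1,0)%Z,139); ((2,0,1)%Z,415); ((2,1,1)%Z,127); ((1,2,1)%Z,383);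
   ((1,2,0)%Z,8331); ((0,2,1)%Z,2047); ((1,1,2)%Z,255); ((1,0,2)%Z,19455); ((0,1,2)%Z,264191); ((2,-1,0)%Z,8331); ((2,0,-1)%Z,24991);
   ((1,-2,0)%Z,4333707); ((2,2,1)%Z,111615); ((3,1,1)%Z,58879); ((3,1,0)%Z,4202635); ((0,2,-1)%Z,425983); ((1,-2,-1)%Z,335871);
   ((1,-1,-2)%Z,2957311); ((1,-1,2)%Z,1630207); ((1,0,-2)%Z,9601023); ((1,2,-1)%Z,245759); ((1,2,2)%Z,2983935); ((1,3,0)%Z,155328651);
   ((1,3,1)%Z,42467327); ((2,-1,-1)%Z,12641791); ((2,-1,1)%Z,57343); ((2,1,-1)%Z,49151); ((2,1,2)%Z,642047); ((3,-1,0)%Z,138420363);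
   ((3,0,1)%Z,12607903); ((3,2,0)%Z,155328651); ((3,2,1)%Z,33947647)]%N.
(* The first 28 vectors are those that the search may use up *)
Definition gates : N := Eval vm_compute in N.shiftl 1 28.

(* The removed planes: [z = 0] and [y = 0] *)
Definition inpl (pl : bool * bool) (v : v3) : bool :=
  let '(_, y, z) := v in (fst pl ands (z =? 0)) ors (snd pl ands (y =? 0)).
Fixpoint blocked (pl : bool * bool) (U : list entry) (used : N) : N :=
  match U with
  | nil => used
  | (_, b, v, _) :: U => let m := blocked pl U used in if inpl pl v then N.lor b m else m
  end.
Fixpoint frontier (U : list entry) (m : N) : list (N * v3) :=
  match U with
  | nil => nil
  | (i, b, v, d) :: U =>
    if N.testbit m i then frontier U m
    else match N.ldiff d m with N0 => (b, v) :: frontier U m | _ => frontier U m end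
  end.

Definition cand := (N * v3 * vec)%type.
(* Drops the candidates which some other one never exceeds *)
Fixpoint minimals (acc F : list cand) : list cand :=
  match F with
  | nil => rev acc
  | p :: F => if exs (fun p' => vle (snd p') (snd p)) acc then minimals acc F
              else minimals (p :: filter (fun p' => negb (vle (snd p) (snd p'))) acc) F
  end.
(* Says that [fx] is smaller than the earlier candidates and not larger than the later ones *)
Definition branch (fx : vec) (before : list vec) (after : list cand) : list (bool * vec) :=
  map (fun y => (true, vsub y fx)) before ++ map (fun p => (false, vsub (snd p) fx)) after.

Fixpoint each (k : list vec -> cand -> list cand -> bool) (before : list vec) (F : list cand) : bool :=
  match F with nil => true | c :: F => k before c F ands each k (snd c :: before) F end.

Definition mtx := (v3 * v3 * v3)%type.
(** The changes of basis that a leaf may use. Soundness depends only on their determinants and on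
    the comparison of Gram matrices made at the leaf. *)
Definition isometries : list mtx := [((1,0,0),(0,1,0),(0,0,1)); ((1,0,0),(0,-1,0),(0,-1,-1)); ((1,0,0),(0,-1,0),(1,0,1));
  ((1,0,0),(0,1,0),(-1,-1,-1)); ((1,0,0),(1,1,0),(0,0,-1)); ((1,0,0),(0,0,1),(-1,-1,-1)); ((1,0,0),(1,1,0),(1,1,1));
  ((1,0,0),(0,1,0),(0,1,-1)); ((1,1,0),(1,0,0),(0,0,-1)); ((1,0,0),(-1,-1,-1),(0,0,1)); ((1,0,0),(0,-1,-1),(0,-1,0));
  ((1,0,0),(0,-1,-1),(0,0,-1)); ((1,0,0),(0,1,0),(1,0,-1)); ((1,0,0),(1,-1,0),(0,0,1)); ((1,1,0),(0,1,0),(0,0,-1));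
  ((1,1,0),(1,0,0),(1,1,1)); ((1,0,0),(-1,-1,-1),(0,1,0))].
(* [f(e_i) = g(y_i)] and [f(e_i + e_j) = g(y_i + y_j)], for [f] and [g] linear in parameters or with numerical coefficients *)
Definition same_gram {T} (eqt : T -> T -> bool) (f g : v3 -> T) (u : mtx) : bool :=
  let '(y1, y2, y3) := u in
  eqt (f (0,0,1)) (g y3) ands eqt (f (0,1,0)) (g y2) ands eqt (f (1,0,0)) (g y1) ands
  eqt (f (1,1,0)) (g (add3 y1 y2)) ands eqt (f (1,0,1)) (g (add3 y1 y3)) ands eqt (f (0,1,1)) (g (add3 y2 y3)).
Definition probe : vec := [1; 3; 7; 17; 41; 5; 29; 11; 67; 23; 2; 13].
(* The numerical test at [probe] is there only to save time *)
Definition leaf (S : cone) (z : vec) : bool :=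
  let P := map (dot probe) (mat S) in
  exs (fun u => same_gram Z.eqb (qf P) (qf (skipn 6 P)) u ands
                same_gram veq (form (mat S) z) (form (skipn 6 (mat S)) z) u) isometries.

Definition row (S : cone) (i : nat) : vec := nth i (mat S) nil.
Definition eqpm (a b : vec) : bool := veq a b ors veq a (map Z.opp b).
(** If [a], [b] and [|t|] agree, the forms restricted to [z = 0] differ at most by the sign of [y],
    so the whole plane can be taken out on both sides instead of line by line. The plane [y = 0] is
    treated in the same way with [a], [c] and [|s|]. *)
Definition planes (S : cone) (pl : bool * bool) : bool * bool :=
  if veq (row S 0) (row S 6) then
    (fst pl ors (veq (row S 1) (row S 7) ands eqpm (row S 5) (row S 11)),
     snd pl ors (veq (row S 2) (row S 8) ands eqpm (row S 4) (row S 10)))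
  else pl.
(* For a basis that is reduced up to permutations, [|r| <= |s|] if [a = b] and [|s| <= |t|] if [b = c] *)
Definition ties (b : bool) (m : list vec) : list (bool * vec) :=
  match m with
  | r0 :: r1 :: r2 :: r3 :: r4 :: r5 :: _ =>
    (if veq r0 r1 then [(false, if b then vsub r4 r3 else vsub r3 r4)] else []) ++
    (if veq r1 r2 then [(false, if b then vsub r5 r4 else vsub r4 r5)] else [])
  | _ => []
  end.

Definition used := (N * v3 * (N * v3))%type.
Fixpoint maskl (l : list used) : N := match l with nil => 0%N | p :: l => N.lor (fst (fst p)) (maskl l) end.
Fixpoint maskr (l : list used) : N := match l with nil => 0%N | p :: l => N.lor (fst (snd p)) (maskr l) end.
Fixpoint findeq (fv : vec) (l : list cand) : option (N * v3) :=
  match l with nil => None | (p, gv) :: l => if veq fv gv then Some p else findeq fv l end.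
Fixpoint findpair (F G : list cand) : option used :=
  match F with
  | nil => None
  | (p, fv) :: F => match findeq fv G with Some p' => Some (p, p') | None => findpair F G end
  end.

Section Explore.
Variables bf bg : bool.

Definition candl (S : cone) (z : vec) (pl : bool * bool) (ps : list used) : list cand :=
  map (fun p => (p, form (mat S) z (snd p))) (frontier (univ bf) (blocked pl (univ bf) (maskl ps))).
Definition candr (S : cone) (z : vec) (pl : bool * bool) (ps : list used) : list cand :=
  map (fun p => (p, form (skipn 6 (mat S)) z (snd p))) (frontier (univ bg) (blocked pl (univ bg) (maskr ps))).
(* Uses up candidates of equal value *)
Fixpoint automatch (fuel : nat) (S : cone) (z : vec) (pl : bool * bool) (ps : list used) : list used :=
  match fuel with
  | O => ps
  | S n => match findpair (candl S z pl ps) (candr S z pl ps) with None => ps | Some p => automatch n S z pl (p :: ps) end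
  end.

(** On each side the candidates contain a minimum over the vectors that remain, and [branch] gives
    ties to the earliest candidate, so the branches cover the cone. Lack of fuel, lack of candidates
    for the first form and the use of a gate all give [false]. *)
Fixpoint explore (fuel : nat) (S0 : cone) (ps : list used) (pl : bool * bool) : bool :=
  match fuel with
  | O => false
  | S n =>
    match tighten fuelT S0 with
    | None => true
    | Some S1 =>
      match tighten fuelT (addrows (ties bf (mat S1) ++ ties bg (skipn 6 (mat S1))) S1) with
      | None => true
      | Some S2 =>
        let S := normalize S2 in
        let z := zeros (strict S) in
        if leaf S z then true else
        let pl := planes S pl in
        let ps := filter (fun p => if inpl pl (snd (fst p)) then false else negb (inpl pl (snd (snd p)))) ps in
        let ps := automatch 40 S z pl ps in
        let F := minimals nil (candl S z pl ps) in
        match F with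
        | nil => false
        | _ =>
        (maskl ps <? gates)%N ands (maskr ps <? gates)%N ands
        each (fun before c after =>
          let S' := addrows (branch (snd c) before after) S in
          if infeasible (bare S') then true else
          match tighten fuelT S' with
          | None => true
          | Some S' =>
            let S' := normalize S' in
            let z := zeros (strict S') in
            let fv := form (mat S') z (snd (fst c)) in
            each (fun before c' after =>
              let S'' := addrows (branch (snd c') before after) S' in
              let e := vsub fv (snd c') in
              match addeq e (bare S'') with
              | None => true
              | Some T =>
                if infeasible T then true else
                match addeq e S'' with
                | None => true
                | Some T => explore n T ((fst c, fst c') :: ps) pl
                end
              end) nil (minimals nil (candr S' z pl ps))
          end) nil F
        end
      end
    end
  end.
End Explore.

Definition unitrow (i : nat) : vec := unitv i (repeat tt 12).
Definition shift (k : nat) (l : vec) : vec := repeat 0 k ++ l ++ repeat 0 (6 - k).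
(* With equal signs, we may assume that the third minimum of the first form is not larger *)
Definition root (bf bg : bool) : cone :=
  Cone [unitrow 0; unitrow 1; unitrow 2; map (Z.mul (sgn bf)) (unitrow 3); map (Z.mul (sgn bf)) (unitrow 4); map (Z.mul (sgn bf)) (unitrow 5);
        unitrow 6; unitrow 7; unitrow 8; map (Z.mul (sgn bg)) (unitrow 9); map (Z.mul (sgn bg)) (unitrow 10); map (Z.mul (sgn bg)) (unitrow 11)]
    [true; false; false; bf; bf; bf; true; false; false; bg; bg; bg]
    (map (fun c => (false, shift 0 c)) (domrows bf) ++ map (fun c => (false, shift 6 c)) (domrows bg) ++
     (if eqb bf bg then [(false, vsub (unitrow 8) (unitrow 2))] else [])).

Local Arguments infeasible : simpl never.
Local Arguments addrows : simpl never.
Local Arguments domcone : simpl never.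
(** * Minimal vectors of reduced forms *)

(** The inequalities of Eisenstein's reduction, where [e] tells whether the mixed coefficients are
    all positive or all nonpositive. The boundary conditions are those for [a = b] and [b = c] only,
    so equivalent reduced forms may differ; this is why a leaf tries several changes of basis. *)
Definition reduced (e : bool) (l : vec) : Prop :=
  match l with
  | [a; b; c; r; s; t] =>
    0 < a /\ a <= b /\ b <= c /\
    pos_if e (sgn e * r) /\ pos_if e (sgn e * s) /\ pos_if e (sgn e * t) /\
    2 * (sgn e * t) <= a /\ 2 * (sgn e * s) <= a /\ 2 * (sgn e * r) <= b /\
    (e = false -> 0 <= a + b + 2 * r + 2 * s + 2 * t) /\
    (a = b -> sgn e * r <= sgn e * s) /\ (b = c -> sgn e * s <= sgn e * t)
  | _ => False
  end.

Definition nonzero (v : v3) : bool := let '(x, y, z) := v in negb ((x =? 0) ands (y =? 0) ands (z =? 0)).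
Definition parallel (v w : v3) : bool :=
  let '(x, y, z) := v in let '(x', y', z') := w in
  (x * y' =? y * x') ands (x * z' =? z * x') ands (y * z' =? z * y').
(** A stand-in for primitivity that is easy to test: the integral vectors on the line of [v] are
    then its integral multiples. *)
Definition unitc (v : v3) : bool :=
  let '(x, y, z) := v in (Z.abs x =? 1) ors (Z.abs y =? 1) ors (Z.abs z =? 1).
Definition scale3 (k : Z) (v : v3) : v3 := let '(x, y, z) := v in (k * x, k * y, k * z).
(** The vectors that remain to be matched. A used vector takes its whole line with it, since its
    multiples are matched as well. *)
Definition avail (xs : list v3) (pl : bool * bool) (v : v3) : bool :=
  nonzero v ands negb (inpl pl v) ands alls (fun x => negb (parallel x v)) xs.

Lemma qf_scale l k v : qf l (scale3 k v) = k * k * qf l v.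
Proof.
destruct v as [[x y] z]; unfold qf; simpl.
destruct l as [|a [|b [|c [|r [|s [|t l]]]]]]; simpl; ring.
Qed.

Lemma unitc_multiple x v : unitc x = true -> parallel x v = true -> exists k, v = scale3 k x.
Proof.
destruct x as [[x y] z], v as [[x' y'] z']; simpl.
destruct (Z.eqb_spec (x * y') (y * x')), (Z.eqb_spec (x * z') (z * x')), (Z.eqb_spec (y * z') (z * y')); try easy.
destruct (Z.eqb_spec (Z.abs x) 1); [intros _ _|destruct (Z.eqb_spec (Z.abs y) 1);
  [intros _ _|destruct (Z.eqb_spec (Z.abs z) 1); [intros _ _|easy]]].
- exists (x * x'); assert (x = 1 \/ x = -1) as [-> | ->] by lia; repeat f_equal; lia.
- exists (y * y'); assert (y = 1 \/ y = -1) as [-> | ->] by lia; repeat f_equal; lia.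
- exists (z * z'); assert (z = 1 \/ z = -1) as [-> | ->] by lia; repeat f_equal; lia.
Qed.

Lemma parallel_scale x k v : k <> 0 -> parallel x (scale3 k v) = parallel x v.
Proof.
intros Hk; destruct x as [[x y] z], v as [[x' y'] z']; simpl.
assert (E : forall p q r s, (p * (k * q) =? r * (k * s)) = (p * q =? r * s)).
{ intros p q r s; destruct (Z.eqb_spec (p * q) (r * s)), (Z.eqb_spec (p * (k * q)) (r * (k * s))); auto; nia. }
now rewrite !E.
Qed.

Lemma avail_scale xs pl k v : k <> 0 -> avail xs pl (scale3 k v) = avail xs pl v.
Proof.
intros Hk; unfold avail.
assert (E1 : nonzero (scale3 k v) = nonzero v).
{ destruct v as [[x y] z]; simpl; assert (E : forall p, (k * p =? 0) = (p =? 0)) by (intros; lia); now rewrite !E. }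
assert (E2 : inpl pl (scale3 k v) = inpl pl v).
{ destruct v as [[x y] z]; simpl; assert (E : forall p, (k * p =? 0) = (p =? 0)) by (intros; lia); now rewrite !E. }
rewrite E1, E2; do 2 f_equal.
assert (E3 : alls (fun x => negb (parallel x (scale3 k v))) xs = alls (fun x => negb (parallel x v)) xs).
{ induction xs; simpl; auto; now rewrite parallel_scale, IHxs. }
now rewrite E3.
Qed.

Lemma infeasible_unsat S P : infeasible S = true -> wf S /\ sat S P -> False.
Proof. intros H [H1 H2]; rewrite (infeasible_sat S P) in H; easy. Qed.

Lemma dominated_le e l v w : reduced e l -> dominated e v w = true -> qf l v <= qf l w.
Proof.
destruct l as [|a [|b [|c [|r [|s [|t [|]]]]]]]; try easy; intros H D.
destruct (Z_lt_le_dec (qf [a; b; c; r; s; t] w) (qf [a; b; c; r; s; t] v)) as [K|]; [exfalso|auto].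
set (u := [a; b; c; sgn e * r; sgn e * s; sgn e * t]).
assert (E : forall v, dot (twist e (coefs v)) u = qf [a; b; c; r; s; t] v).
{ intros [[x y] z]; unfold u, qf; destruct e; simpl; ring. }
apply (infeasible_unsat _ nil D); clear D; split.
- split; simpl; auto; repeat constructor; destruct v as [[? ?] ?], w as [[? ?] ?]; auto; destruct e; repeat constructor.
- apply sat_satat; exists u.
  apply addrows_sat.
  + destruct e; split; simpl; repeat constructor.
  + destruct H as (H1 & H2 & H3 & H4 & H5 & H6 & H7 & H8 & H9 & H10 & _).
    exists 1, 1; repeat split; auto; try lia; simpl.
    * repeat (constructor; auto); try easy; lia.
    * destruct e; simpl; repeat (apply Forall_cons || apply Forall_nil); (split; [|easy]);
      unfold u; simpl in *; try specialize (H10 eq_refl); lia.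
  + constructor; [|constructor]; split.
    * destruct v as [[? ?] ?], w as [[? ?] ?]; reflexivity.
    * cbn [fst snd]; rewrite dot_vsub by (destruct v as [[? ?] ?], w as [[? ?] ?]; reflexivity); rewrite !E; split; lia.
Qed.

Definition all_bits (e : bool) : N := fold_right (fun y m => let '(_, b, _, _) := y in N.lor b m) 0%N (univ e).
(* Everything that the search presupposes about the tables [univ] *)
Definition entry_ok (e : bool) (x : entry) : bool :=
  let '(i, b, v, d) := x in
  N.eqb b (2 ^ i)%N ands (unitc v ors (28 <=? i)%N) ands nonzero v ands N.eqb (N.ldiff d (all_bits e)) 0%N ands
  alls (fun y => let '(j, _, w, _) := y in
    (if N.testbit d j then (j <? i)%N ands dominated e w v else true) ands
    (if N.eqb i j then veq (let '(x, y, z) := v in [x; y; z]) (let '(x, y, z) := w in [x; y; z])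
     else negb (parallel w v))) (univ e).

Lemma univ_ok e : alls (entry_ok e) (univ e) = true.
Proof. destruct e; vm_cast_no_check (eq_refl true). Qed.

Lemma univ_entry e i b v d : In (i, b, v, d) (univ e) ->
  b = (2 ^ i)%N /\ ((i < 28)%N -> unitc v = true) /\ nonzero v = true /\ N.ldiff d (all_bits e) = 0%N /\
  forall j b' w d', In (j, b', w, d') (univ e) ->
    (N.testbit d j = true -> (j < i)%N /\ dominated e w v = true) /\
    (i = j -> v = w) /\ (i <> j -> parallel w v = false).
Proof.
intros Hi; pose proof (univ_ok e) as H; apply alls_Forall in H; rewrite Forall_forall in H.
specialize (H _ Hi); unfold entry_ok in H.
destruct (N.eqb_spec b (2 ^ i)) as [->|]; [|easy].
destruct (unitc v ors (28 <=? i)%N) eqn:Eu; [|easy]; destruct (nonzero v); [|easy].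
destruct (N.eqb_spec (N.ldiff d (all_bits e)) 0) as [->|]; [|easy].
split; [auto|]; split; [intros Hi28; destruct (unitc v), (N.leb_spec 28 i); auto; lia|].
split; [auto|]; split; [auto|]; intros j b' w d' Hw.
apply alls_Forall in H; rewrite Forall_forall in H; specialize (H _ Hw); simpl in H; split; [|split].
- intros Hd; rewrite Hd in H; destruct (N.ltb_spec j i); [|easy]; destruct (dominated e w v); easy.
- intros <-; destruct (if N.testbit d i then _ else _); [|easy]; rewrite N.eqb_refl in H.
  destruct v as [[? ?] ?], w as [[? ?] ?]; apply veq_eq in H; congruence.
- intros Hij; destruct (if N.testbit d j then _ else _); [|easy].
  destruct (N.eqb_spec i j); [easy|]; now destruct (parallel w v).
Qed.

Lemma all_bits_entry e j : N.testbit (all_bits e) j = true -> exists b v d, In (j, b, v, d) (univ e).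
Proof.
intros H.
assert (K : exists i b v d, In (i, b, v, d) (univ e) /\ N.testbit b j = true).

{ unfold all_bits in H; induction (univ e) as [|[[[i b] v] d] U IH]; cbn [fold_right] in H; [now rewrite N.bits_0 in H|].
  rewrite N.lor_spec in H; destruct (N.testbit b j) eqn:E; [exists i, b, v, d; simpl; auto|].
  destruct (IH H) as (i' & b' & v' & d' & H1 & H2); exists i', b', v', d'; simpl; auto. }
destruct K as (i & b & v & d & H1 & H2); destruct (univ_entry _ _ _ _ _ H1) as [-> _].
rewrite N.pow2_bits_eqb in H2; apply N.eqb_eq in H2; subst; eauto.
Qed.

Section Minimal.
Variables (e : bool) (l : vec).
Hypothesis Hl : reduced e l.

Lemma frontier_spec U m p : In p (frontier U m) <->
  exists i d, In (i, fst p, snd p, d) U /\ N.testbit m i = false /\ N.ldiff d m = 0%N.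
Proof.
induction U as [|[[[i b] v] d] U IH]; simpl; [split; [easy|now intros (? & ? & [] & _)]|].
assert (K : (exists i d, In (i, fst p, snd p, d) U /\ N.testbit m i = false /\ N.ldiff d m = 0%N) ->
  exists i' d', ((i, b, v, d) = (i', fst p, snd p, d') \/ In (i', fst p, snd p, d') U) /\ N.testbit m i' = false /\ N.ldiff d' m = 0%N)
  by (intros (i' & d' & H1 & H2); exists i', d'; auto).
destruct (N.testbit m i) eqn:E; [|destruct (N.ldiff d m) eqn:E'].
- rewrite IH; split; [exact K|]; intros (i' & d' & [H1|H1] & H2 & H3); [congruence|exists i', d'; auto].
- simpl; rewrite IH; split; [intros [<-|H]; [exists i, d; auto|exact (K H)]|].
  intros (i' & d' & [H1|H1] & H2 & H3); [left; destruct p; simpl in *; congruence|right; exists i', d'; auto].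
- rewrite IH; split; [exact K|]; intros (i' & d' & [H1|H1] & H2 & H3); [congruence|exists i', d'; auto].
Qed.

Lemma frontier_min m i b v d : In (i, b, v, d) (univ e) -> N.testbit m i = false ->
  exists p, In p (frontier (univ e) m) /\ qf l (snd p) <= qf l v.
Proof.
revert b v d; induction i as [i IH] using (well_founded_induction N.lt_wf_0); intros b v d Hi Hm.
destruct (univ_entry _ _ _ _ _ Hi) as (_ & _ & _ & Hd & H).
destruct (N.eq_dec (N.ldiff d m) 0) as [E|E].
- exists (b, v); split; [|apply Z.le_refl]; apply frontier_spec; exists i, d; auto.
- apply N.bit_log2 in E; rewrite N.ldiff_spec in E; set (j := N.log2 (N.ldiff d m)) in *; clearbody j.
  apply andb_prop in E as [E1 E2]; apply negb_true_iff in E2.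
  assert (Hj : N.testbit (all_bits e) j = true).
  { assert (K : N.testbit (N.ldiff d (all_bits e)) j = false) by (rewrite Hd; apply N.bits_0).
    rewrite N.ldiff_spec, E1 in K; now destruct (N.testbit (all_bits e) j). }
  destruct (all_bits_entry _ _ Hj) as (b' & w & d' & Hw); destruct (H _ _ _ _ Hw) as [K _].
  destruct (K E1) as [K1 K2]; destruct (IH _ K1 _ _ _ Hw E2) as (p & P1 & P2); exists p; split; auto.
  pose proof (dominated_le _ _ _ _ Hl K2); lia.
Qed.
End Minimal.

(** * Vectors outside the tables *)

Definition range (n : nat) : list Z := map (fun i => Z.of_nat i - Z.of_nat n) (seq 0 (2 * n + 1)).
Definition size3 (v : v3) : Z := let '(x, y, z) := v in Z.max (Z.abs x) (Z.max (Z.abs y) (Z.abs z)).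
Definition multi (v : v3) : bool :=
  let '(x, y, z) := v in
  if x =? 0 then negb (y =? 0) ands negb (z =? 0) else negb (y =? 0) ors negb (z =? 0).
Definition gated (e : bool) (w : v3) : bool :=
  let '(_, y, z) := w in
  exs (fun c => let '(i, _, v, _) := c in let '(_, y', z') := v in
     (28 <=? i)%N ands ((z =? 0) ors negb (z' =? 0)) ands ((y =? 0) ors negb (y' =? 0)) ands dominated e v w) (univ e).
(** At size 4 a gate is required, because vectors of size 4 also represent all the longer ones, by
    [shell]. A smaller vector stands only for itself and may be a multiple of a table vector
    instead. *)
Definition covered (e : bool) (w : v3) : bool :=
  if multi w then
    (if size3 w <? 4 then exs (fun c => let '(i, _, v, _) := c in (i <? 28)%N ands parallel v w) (univ e) else false)
    ors gated e w
  else true.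

Lemma box_covered e :
  alls (fun x => alls (fun y => alls (fun z => covered e (x, y, z)) (range 4)) (range 4)) [0; 1; 2; 3; 4] = true.
Proof. destruct e; vm_cast_no_check (eq_refl true). Qed.

(** The expression is the decrease of the form when a coordinate of absolute value [k] moves one
    step towards zero, with [u] and [w] the other coordinates up to sign. *)
Lemma step_pos A p q k u w : 0 < A -> 2 * Z.abs p <= A -> 2 * Z.abs q <= A -> Z.abs u + Z.abs w <= 2 * k - 1 ->
  0 <= A * (2 * k - 1) + 2 * p * u + 2 * q * w.
Proof.
intros HA Hp Hq Hk.
assert (K : forall p u, 2 * Z.abs p <= A -> - (A * Z.abs u) <= 2 * p * u).
{ clear - HA; intros p u Hp; assert (Z.abs (2 * p * u) <= A * Z.abs u); [|lia].
  rewrite Z.abs_mul; apply Z.mul_le_mono_nonneg_r; lia. }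
pose proof (K p u Hp); pose proof (K q w Hq); nia.
Qed.

Section Cover.
Variables (e : bool) (l : vec).
Hypothesis Hl : reduced e l.

Definition size1 (v : v3) : Z := let '(x, y, z) := v in Z.abs x + Z.abs y + Z.abs z.

(* A largest entry [x] may be moved by one towards zero, without increasing the form, unless all entries agree *)
Lemma shrink v : multi v = true -> 4 < size3 v ->
  exists w, multi w = true /\ (forall pl, inpl pl w = inpl pl v) /\ qf l w <= qf l v /\ 4 <= size3 w /\
    size1 w < size1 v.
Proof.
destruct l as [|a [|b [|c [|r [|s [|t [|]]]]]]]; try easy; destruct v as [[x y] z]; unfold qf; simpl.
intros Hm Hs.
assert (R : 0 < a /\ a <= b /\ b <= c /\ 2 * Z.abs t <= a /\ 2 * Z.abs s <= a /\ 2 * Z.abs r <= b).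
{ clear - Hl; destruct Hl as (H1 & H2 & H3 & H4 & H5 & H6 & H7 & H8 & H9 & _);
  unfold pos_if in *; destruct e; simpl in *; lia. }
destruct R as (R1 & R2 & R3 & R4 & R5 & R6).
assert (Z0 : forall p q, (p = 0 <-> q = 0) -> (p =? 0) = (q =? 0)) by (intros; lia).
destruct (Z_le_gt_dec (Z.abs y + Z.abs z) (2 * Z.abs x - 1)) as [Cx|Cx];
  [|destruct (Z_le_gt_dec (Z.abs x + Z.abs z) (2 * Z.abs y - 1)) as [Cy|Cy];
  [|destruct (Z_le_gt_dec (Z.abs x + Z.abs y) (2 * Z.abs z - 1)) as [Cz|Cz]]].
- exists (x - Z.sgn x, y, z); simpl.
  assert (N0 : x <> 0) by lia; assert (N1 : x - Z.sgn x <> 0) by lia.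
  rewrite <- (Z0 (x - Z.sgn x) x) in Hm by lia; split; [exact Hm|]; split.
  { intros pl; rewrite ?(Z0 (x - Z.sgn x) x) by lia; reflexivity. }
  split; [|lia].
  assert (G : forall u, Z.abs (Z.sgn x * u) = Z.abs u) by (intros; rewrite Z.abs_mul; lia).
  assert (E : x = Z.abs x * Z.sgn x /\ Z.sgn x * Z.sgn x = 1) by (split; [symmetry; apply Z.abs_sgn|lia]).
  pose proof (step_pos a t s (Z.abs x) (Z.sgn x * y) (Z.sgn x * z) ltac:(lia) ltac:(lia) ltac:(lia) ltac:(rewrite !G; lia)) as K.
  revert E K; generalize (Z.abs x) (Z.sgn x); clear; intros m g [-> E] K.
  match goal with |- ?X <= ?Y => assert (D : Y - X = g * g * (a * (2 * m - 1)) + 2 * t * (g * y) + 2 * s * (g * z)) by ring end.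
  rewrite E in D; lia.
- exists (x, y - Z.sgn y, z); simpl.
  assert (N0 : y <> 0) by lia; assert (N1 : y - Z.sgn y <> 0) by lia.
  rewrite <- (Z0 (y - Z.sgn y) y) in Hm by lia; split; [exact Hm|]; split.
  { intros pl; rewrite ?(Z0 (y - Z.sgn y) y) by lia; reflexivity. }
  split; [|lia].
  assert (G : forall u, Z.abs (Z.sgn y * u) = Z.abs u) by (intros; rewrite Z.abs_mul; lia).
  assert (E : y = Z.abs y * Z.sgn y /\ Z.sgn y * Z.sgn y = 1) by (split; [symmetry; apply Z.abs_sgn|lia]).
  pose proof (step_pos b r t (Z.abs y) (Z.sgn y * z) (Z.sgn y * x) ltac:(lia) ltac:(lia) ltac:(lia) ltac:(rewrite !G; lia)) as K.
  revert E K; generalize (Z.abs y) (Z.sgn y); clear; intros m g [-> E] K.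
  match goal with |- ?X <= ?Y => assert (D : Y - X = g * g * (b * (2 * m - 1)) + 2 * r * (g * z) + 2 * t * (g * x)) by ring end.
  rewrite E in D; lia.
- exists (x, y, z - Z.sgn z); simpl.
  assert (N0 : z <> 0) by lia; assert (N1 : z - Z.sgn z <> 0) by lia.
  rewrite <- (Z0 (z - Z.sgn z) z) in Hm by lia; split; [exact Hm|]; split.
  { intros pl; rewrite ?(Z0 (z - Z.sgn z) z) by lia; reflexivity. }
  split; [|lia].
  assert (G : forall u, Z.abs (Z.sgn z * u) = Z.abs u) by (intros; rewrite Z.abs_mul; lia).
  assert (E : z = Z.abs z * Z.sgn z /\ Z.sgn z * Z.sgn z = 1) by (split; [symmetry; apply Z.abs_sgn|lia]).
  pose proof (step_pos c r s (Z.abs z) (Z.sgn z * y) (Z.sgn z * x) ltac:(lia) ltac:(lia) ltac:(lia) ltac:(rewrite !G; lia)) as K.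
  revert E K; generalize (Z.abs z) (Z.sgn z); clear; intros m g [-> E] K.
  match goal with |- ?X <= ?Y => assert (D : Y - X = g * g * (c * (2 * m - 1)) + 2 * r * (g * y) + 2 * s * (g * x)) by ring end.
  rewrite E in D; lia.
(* The three failed inequalities add up to an equality, so the entries agree in size. The vector is
   a multiple of one with entries 1 and -1, and its multiplier is lowered to 4. *)
- assert (M : Z.abs x = Z.abs y /\ Z.abs y = Z.abs z) by lia; destruct M as [Mx My].
  exists (4 * Z.sgn x, 4 * Z.sgn y, 4 * Z.sgn z); simpl.
  assert (Nx : x <> 0) by lia; assert (Ny : y <> 0) by lia; assert (Nz : z <> 0) by lia.
  split; [|split; [|split; [|lia]]].
  + destruct (Z.eqb_spec (4 * Z.sgn x) 0), (Z.eqb_spec (4 * Z.sgn y) 0); try lia; reflexivity.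
  + intros pl; rewrite (Z0 (4 * Z.sgn y) y), (Z0 (4 * Z.sgn z) z) by lia; reflexivity.
  + assert (E : x = Z.abs x * Z.sgn x /\ y = Z.abs x * Z.sgn y /\ z = Z.abs x * Z.sgn z).
    { repeat split; [|rewrite Mx|rewrite Mx, My]; symmetry; apply Z.abs_sgn. }
    assert (H5 : 4 < Z.abs x) by lia; assert (Gx : Z.sgn x = 1 \/ Z.sgn x = -1) by lia.
    assert (Gy : Z.sgn y = 1 \/ Z.sgn y = -1) by lia; assert (Gz : Z.sgn z = 1 \/ Z.sgn z = -1) by lia.
    revert E H5 Gx Gy Gz; generalize (Z.abs x) (Z.sgn x) (Z.sgn y) (Z.sgn z); clear - R1 R2 R3 R4 R5 R6.
    intros m gx gy gz (-> & -> & ->) Hm Gx Gy Gz.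
    assert (0 <= gx * gx * a + (gy * gy * b + (gz * gz * c + (2 * gy * gz * r + (2 * gx * gz * s + 2 * gx * gy * t))))).
    { destruct Gx as [-> | ->], Gy as [-> | ->], Gz as [-> | ->]; lia. }
    assert (16 <= m * m) by nia.
    match goal with H : 0 <= ?q |- _ => assert (16 * q <= m * m * q) by nia; lia end.
Qed.

Lemma shell v : multi v = true -> exists w, multi w = true /\ (forall pl, inpl pl w = inpl pl v) /\
  qf l w <= qf l v /\ size3 w <= 4 /\ (w = v \/ size3 w = 4).
Proof.
remember (Z.to_nat (size1 v)) as n eqn:En; revert v En.
induction n as [n IH] using (well_founded_induction lt_wf); intros v -> Hm.
destruct (Z_le_gt_dec (size3 v) 4) as [Hs|Hs].
- exists v; repeat split; auto; lia.
- destruct (shrink v Hm ltac:(lia)) as (w & W1 & W2 & W3 & W4 & W5).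
  assert (0 <= size1 w) by (destruct w as [[? ?] ?]; simpl; lia).
  destruct (IH (Z.to_nat (size1 w)) ltac:(lia) w eq_refl W1) as (w' & K1 & K2 & K3 & K4 & K5).
  exists w'; repeat split; auto; [intros; rewrite K2; auto|lia|].
  right; destruct K5 as [->|]; lia.
Qed.

Lemma gated_spec w : gated e w = true -> exists i b v d, In (i, b, v, d) (univ e) /\ (28 <= i)%N /\
  (forall pl, inpl pl w = false -> inpl pl v = false) /\ qf l v <= qf l w.
Proof.
destruct w as [[x y] z]; unfold gated; intros H; apply exs_Exists in H as [[[[i b] [[x' y'] z']] d] [Hi H]].
exists i, b, (x', y', z'), d; split; [auto|].
destruct (N.leb_spec 28 i); [|easy]; split; [auto|].
destruct ((z =? 0) ors negb (z' =? 0)) eqn:E1; [|easy].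
destruct ((y =? 0) ors negb (y' =? 0)) eqn:E2; [|easy]; split.
- intros [p1 p2]; simpl; destruct p1, p2; simpl; destruct (z =? 0), (z' =? 0), (y =? 0), (y' =? 0); easy.
- apply (dominated_le e); auto.
Qed.

Lemma in_range n x : Z.abs x <= Z.of_nat n -> In x (range n).
Proof.
intros H; unfold range; apply in_map_iff; exists (Z.to_nat (x + Z.of_nat n)); split; [lia|].
apply in_seq; lia.
Qed.

Lemma box_covered_half x y z : size3 (x, y, z) <= 4 -> 0 <= x -> covered e (x, y, z) = true.
Proof.
simpl; intros H Hx; pose proof (box_covered e) as K.
apply alls_Forall in K; rewrite Forall_forall in K; specialize (K x).
assert (Ix : In x [0; 1; 2; 3; 4]) by (simpl; lia); specialize (K Ix); cbv beta in K.
apply alls_Forall in K; rewrite Forall_forall in K; specialize (K y (in_range 4 y ltac:(lia))).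
apply alls_Forall in K; rewrite Forall_forall in K; exact (K z (in_range 4 z ltac:(lia))).
Qed.

Hypothesis Hpos : forall v, nonzero v = true -> 0 < qf l v.

Lemma multiple_le k v : k <> 0 -> nonzero v = true -> qf l v <= qf l (scale3 k v).
Proof. intros Hk Hv; rewrite qf_scale; specialize (Hpos v Hv); assert (1 <= k * k) by nia; nia. Qed.

Lemma nonzero_scale k v : nonzero (scale3 k v) = true -> k <> 0.
Proof. destruct v as [[x y] z]; intros H ->; easy. Qed.

(** A vector with a single nonzero coordinate is a multiple of a basis vector, which is in the
    table. Any other is shortened by [shell] without leaving or entering a plane; the outcome is
    gated, or else it is the vector itself and a multiple of a table vector. *)
Lemma cover xs pl m v :
  (forall i b x d, In (i, b, x, d) (univ e) -> N.testbit m i = true ->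
     inpl pl x = true \/ ((i < 28)%N /\ In x xs)) ->
  avail xs pl v = true -> exists p, In p (frontier (univ e) m) /\ qf l (snd p) <= qf l v.
Proof.
intros Hm Hv.
assert (Hv0 : nonzero v = true /\ inpl pl v = false).
{ unfold avail in Hv; destruct (nonzero v); [|easy]; destruct (inpl pl v); easy. }
destruct Hv0 as [Hv0 Hvp].
assert (Hu : forall i b x d k, In (i, b, x, d) (univ e) -> v = scale3 k x ->
   exists p, In p (frontier (univ e) m) /\ qf l (snd p) <= qf l v).
{ intros i b x d k Hi ->; assert (Hk := nonzero_scale _ _ Hv0).
  destruct (univ_entry _ _ _ _ _ Hi) as (_ & _ & Hx & _).
  rewrite avail_scale in Hv by auto; unfold avail in Hv.
  rewrite Hx in Hv; destruct (inpl pl x) eqn:Ex; [easy|].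
  simpl in Hv; apply alls_Forall in Hv; rewrite Forall_forall in Hv.
  destruct (frontier_min e l Hl m i b x d Hi) as (p & P1 & P2).
  - destruct (N.testbit m i) eqn:Em; [|auto]; destruct (Hm _ _ _ _ Hi Em) as [|[_ Hx']]; [congruence|].
    specialize (Hv x Hx'); destruct x as [[x y] z]; simpl in Hv.
    rewrite (Z.mul_comm y x), (Z.mul_comm z x), (Z.mul_comm z y), !Z.eqb_refl in Hv; easy.
  - exists p; split; auto; pose proof (multiple_le k x Hk Hx); lia. }
assert (Hg : forall w, gated e w = true -> (forall pl, inpl pl w = inpl pl v) -> qf l w <= qf l v ->
  exists p, In p (frontier (univ e) m) /\ qf l (snd p) <= qf l v).
{ intros w H1 H2 H3; destruct (gated_spec w H1) as (i & b & x & d & K1 & K2 & K3 & K4).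
  destruct (frontier_min e l Hl m i b x d K1) as (p & P1 & P2).
  - destruct (N.testbit m i) eqn:Em; [|auto]; destruct (Hm _ _ _ _ K1 Em) as [E|[E _]]; [|lia].
    rewrite K3 in E; [easy|]; now rewrite H2.
  - exists p; split; auto; lia. }
destruct (multi v) eqn:Mv.
- destruct (shell v Mv) as (w & W1 & W2 & W3 & W4 & W5).
  (* The form is even, so the check over [x >= 0] suffices. *)
  assert (C : exists g, (g = 1 \/ g = -1) /\ covered e (scale3 g w) = true).
  { destruct w as [[x y] z]; simpl in W4; destruct (Z_le_gt_dec 0 x).
    - exists 1; split; auto; apply box_covered_half; simpl; lia.
    - exists (-1); split; auto; apply box_covered_half; simpl; lia. }
  destruct C as (g & Hg1 & C).
  assert (Mg : multi (scale3 g w) = true).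
  { destruct w as [[x y] z]; simpl in *; assert (E : forall p, (g * p =? 0) = (p =? 0)) by (intros; lia).
    now rewrite !E. }
  assert (Ig : forall pl, inpl pl (scale3 g w) = inpl pl v).
  { intros pl0; rewrite <- W2; destruct w as [[x y] z]; simpl in *.
    assert (E : forall p, (g * p =? 0) = (p =? 0)) by (intros; lia); now rewrite !E. }
  assert (Qg : qf l (scale3 g w) <= qf l v) by (rewrite qf_scale; destruct Hg1; subst g; lia).
  unfold covered in C; rewrite Mg in C.
  destruct (if size3 (scale3 g w) <? 4 then _ else false) eqn:E; [|eauto].
  destruct (Z.ltb_spec (size3 (scale3 g w)) 4) as [Hs|]; [|easy].
  apply exs_Exists in E as [[[[i b] x] d] [Hi E]].
  destruct (N.ltb_spec i 28) as [Hi'|]; [|easy].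
  destruct (univ_entry _ _ _ _ _ Hi) as (_ & Hx & _).
  destruct (unitc_multiple _ _ (Hx Hi') E) as [k Hk].
  assert (w = v).
  { destruct W5 as [|W5]; [auto|]; exfalso; destruct w as [[? ?] ?]; simpl in *; lia. }
  subst w; apply (Hu i b x d (g * k)); auto.
  transitivity (scale3 g (scale3 g v)); [|rewrite Hk];
    [destruct v as [[? ?] ?]; simpl; destruct Hg1; subst g; repeat f_equal; lia|].
  destruct x as [[? ?] ?]; unfold scale3; f_equal; [f_equal|]; ring.
- destruct v as [[x y] z]; simpl in Mv, Hv0.
  assert (U : exists b1 b2 b3 d1 d2 d3, In (0%N, b1, (1,0,0), d1) (univ e) /\ In (1%N, b2, (0,1,0), d2) (univ e) /\
    In (2%N, b3, (0,0,1), d3) (univ e)).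
  { destruct e; do 6 eexists; (split; [left; reflexivity|split; [right; left; reflexivity|right; right; left; reflexivity]]). }
  destruct U as (b1 & b2 & b3 & d1 & d2 & d3 & U1 & U2 & U3).
  destruct (Z.eqb_spec x 0) as [->|], (Z.eqb_spec y 0) as [->|], (Z.eqb_spec z 0) as [->|]; try easy.
  + apply (Hu _ _ _ _ z U3); simpl; repeat f_equal; ring.
  + apply (Hu _ _ _ _ y U2); simpl; repeat f_equal; ring.
  + apply (Hu _ _ _ _ x U1); simpl; repeat f_equal; ring.
Qed.
End Cover.

(** * Functions with equally large fibres *)

Definition fibre {V} (f : V -> Z) (A : V -> bool) (m : Z) (l : list V) : Prop :=
  NoDup l /\ forall v, In v l <-> A v = true /\ f v = m.
Lemma fibre_sub {V} (f : V -> Z) A C m l : (forall v, C v = true -> A v = true) -> fibre f A m l ->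
  fibre f C m (filter C l).
Proof.
intros HC [H1 H2]; split; [now apply NoDup_filter|].
intros v; rewrite filter_In, H2; split; intros; intuition.
Qed.

Lemma fibre_unique {V} (f : V -> Z) A m l l' : fibre f A m l -> fibre f A m l' -> length l = length l'.
Proof.
intros [H1 H2] [H3 H4]; apply Permutation_length, NoDup_Permutation; auto.
intros v; now rewrite H2, H4.
Qed.

Section Equi.
Context {V W : Type}.

Definition equi (f : V -> Z) (A : V -> bool) (g : W -> Z) (B : W -> bool) : Prop :=
  forall m, exists l l', fibre f A m l /\ fibre g B m l' /\ length l = length l'.

Lemma equi_minus f A g B C D : equi f A g B -> equi f C g D ->
  (forall v, C v = true -> A v = true) -> (forall v, D v = true -> B v = true) ->
  equi f (fun v => if C v then false else A v) g (fun v => if D v then false else B v).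
Proof.
intros H1 H2 HC HD m; destruct (H1 m) as (l & l' & L1 & L2 & L3), (H2 m) as (k & k' & K1 & K2 & K3).
exists (filter (fun v => negb (C v)) l), (filter (fun v => negb (D v)) l').
assert (K : forall V (f : V -> Z) A C l, fibre f A m l -> (forall v, C v = true -> A v = true) ->
  fibre f (fun v => if C v then false else A v) m (filter (fun v => negb (C v)) l)).
{ clear; intros V f A C l [H1 H2] H; split; [now apply NoDup_filter|].
  intros v; rewrite filter_In, H2; destruct (C v); simpl; intuition congruence. }
split; [auto|split; [auto|]].
pose proof (filter_length C l) as E1; pose proof (filter_length D l') as E2.
rewrite (fibre_unique _ _ _ _ _ (fibre_sub _ _ _ _ _ HC L1) K1) in E1.
rewrite (fibre_unique _ _ _ _ _ (fibre_sub _ _ _ _ _ HD L2) K2) in E2; lia.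
Qed.

Lemma equi_map f A g B (phi : V -> W) (psi : W -> V) :
  (forall m, exists l, fibre f A m l) ->
  (forall v, A v = true -> B (phi v) = true /\ psi (phi v) = v /\ g (phi v) = f v) ->
  (forall w, B w = true -> A (psi w) = true /\ phi (psi w) = w) -> equi f A g B.
Proof.
intros HF H1 H2 m; destruct (HF m) as [l [L1 L2]]; exists l, (map phi l).
split; [split; auto|split; [split|now rewrite length_map]].
- assert (K : forall v, In v l -> A v = true) by (intros v Hv; now apply L2).
  clear - L1 H1 K; induction L1 as [|v l Hv L IH]; simpl; constructor.
  + rewrite in_map_iff; intros (w & E & Hw).
    assert (w = v); [|congruence].
    destruct (H1 v (K v (or_introl eq_refl))) as (_ & <- & _), (H1 w (K w (or_intror Hw))) as (_ & <- & _); congruence.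
  + apply IH; intros; apply K; now right.
- intros w; rewrite in_map_iff; split.
  + intros (v & <- & Hv); apply L2 in Hv as [Hv <-]; now destruct (H1 v Hv) as (? & ? & ?).
  + intros [Hw <-]; destruct (H2 w Hw) as [K1 K2]; exists (psi w); split; auto.
    apply L2; split; auto; destruct (H1 _ K1) as (_ & _ & <-); congruence.
Qed.

Lemma equi_ext f A A' g B B' : (forall v, A v = A' v) -> (forall w, B w = B' w) -> equi f A g B -> equi f A' g B'.
Proof.
intros HA HB H m; destruct (H m) as (l & l' & [L1 L2] & [K1 K2] & E); exists l, l'.
repeat split; auto; try apply L1; try apply K1; try (apply L2 + apply K2; now rewrite ?HA, ?HB);
  try (apply L2 in H0; destruct H0; now rewrite <- ?HA); try (apply K2 in H0; destruct H0; now rewrite <- ?HB).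
- intros [? ?]; apply L2; now rewrite HA.
- intros [? ?]; apply K2; now rewrite HB.
Qed.

Lemma equi_witness f A g B x : equi f A g B -> A x = true -> exists y, B y = true /\ g y = f x.
Proof.
intros H Hx; destruct (H (f x)) as (l & l' & [L1 L2] & [K1 K2] & E).
assert (Hl : In x l) by now apply L2.
destruct l' as [|w l']; [destruct l; easy|exists w; apply K2; now left].
Qed.

Lemma equi_min f A g B x y : equi f A g B -> A x = true -> B y = true ->
  (forall v, A v = true -> f x <= f v) -> (forall w, B w = true -> g y <= g w) -> f x = g y.
Proof.
intros H Hx Hy Mx My.
assert (K1 : g y <= f x).
{ destruct (H (f x)) as (l & l' & [L1 L2] & [K1 K2] & E).
  assert (Hl : In x l) by now apply L2.
  destruct l' as [|w l']; [destruct l; easy|].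
  destruct (proj1 (K2 w) (or_introl eq_refl)) as [Bw <-]; auto. }
assert (K2 : f x <= g y).
{ destruct (H (g y)) as (l & l' & [L1 L2] & [K2 K3] & E).
  assert (Hl : In y l') by now apply K3.
  destruct l as [|v l]; [destruct l'; easy|].
  destruct (proj1 (L2 v) (or_introl eq_refl)) as [Av <-]; auto. }
lia.
Qed.
End Equi.

Lemma equi_sym {V W} (f : V -> Z) A (g : W -> Z) B : equi f A g B -> equi g B f A.
Proof. intros H m; destruct (H m) as (l & l' & L1 & L2 & E); exists l', l; auto. Qed.

Lemma parallel_nonzero_scale x v k : unitc x = true -> v = scale3 k x -> parallel x v = true.
Proof.
destruct x as [[x y] z]; intros _ ->; simpl.
assert (E : forall p q, (p * (k * q) =? q * (k * p)) = true) by (intros; apply Z.eqb_eq; ring).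
now rewrite !E.
Qed.

(** Recovers the multiplier [k] from [v = k x], by means of a coordinate of [x] that is 1 or -1. *)
Definition coord (x v : v3) : Z :=
  let '(x, y, z) := x in let '(x', y', z') := v in
  if Z.abs x =? 1 then x * x' else if Z.abs y =? 1 then y * y' else z * z'.

Lemma coord_scale x k : unitc x = true -> coord x (scale3 k x) = k.
Proof.
destruct x as [[x y] z]; simpl.
destruct (Z.eqb_spec (Z.abs x) 1); [assert (x = 1 \/ x = -1) as [-> | ->] by lia; lia|].
destruct (Z.eqb_spec (Z.abs y) 1); [assert (y = 1 \/ y = -1) as [-> | ->] by lia; lia|].
destruct (Z.eqb_spec (Z.abs z) 1); [assert (z = 1 \/ z = -1) as [-> | ->] by lia; lia|easy].
Qed.

Definition line (x v : v3) : bool := nonzero v ands parallel x v.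

Lemma line_scale x v : unitc x = true -> line x v = true <-> exists k, k <> 0 /\ v = scale3 k x.
Proof.
intros Hx; unfold line; split.
- intros H; destruct (nonzero v) eqn:E; [|easy]; destruct (unitc_multiple _ _ Hx H) as [k ->].
  exists k; split; auto; now apply nonzero_scale in E.
- intros (k & Hk & ->); rewrite (parallel_nonzero_scale x _ k); auto.
  replace (nonzero (scale3 k x)) with true; auto.
  destruct x as [[x y] z]; simpl in *.
  destruct (Z.eqb_spec (Z.abs x) 1); [destruct (Z.eqb_spec (k * x) 0); nia|].
  destruct (Z.eqb_spec (Z.abs y) 1); [destruct (Z.eqb_spec (k * y) 0), (k * x =? 0); auto; nia|].
  destruct (Z.eqb_spec (Z.abs z) 1); [destruct (Z.eqb_spec (k * z) 0), (k * x =? 0), (k * y =? 0); auto; nia|easy].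
Qed.

(** The values at [k x] and [k y] are both [k^2] times the common value, so the lines correspond by
    [k x -> k y]. *)
Lemma equi_line p q x y : (forall m, exists l, fibre (qf p) nonzero m l) -> unitc x = true -> unitc y = true ->
  qf p x = qf q y -> equi (qf p) (line x) (qf q) (line y).
Proof.
intros HF Hx Hy E.
apply (equi_map _ _ _ _ (fun v => scale3 (coord x v) y) (fun w => scale3 (coord y w) x)).
- intros m; destruct (HF m) as [l Hl]; exists (filter (line x) l); apply fibre_sub with nonzero; auto.
  unfold line; intros v; destruct (nonzero v); auto.
- intros v Hv; apply line_scale in Hv as (k & Hk & ->); auto; rewrite !coord_scale by auto.
  rewrite !qf_scale, E; repeat split; apply line_scale; eauto.
- intros w Hw; apply line_scale in Hw as (k & Hk & ->); auto; rewrite !coord_scale by auto.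
  split; auto; apply line_scale; eauto.
Qed.

Local Arguments tighten : simpl never.
Local Arguments normalize : simpl never.
(** * Soundness of the search *)

Lemma lincomb_length l m z : Forall (fun r => length r = length z) m -> length (lincomb l m z) = length z.
Proof.
intros H; revert l; induction H as [|r m Hr _ IH]; intros [|a l]; simpl; auto.
unfold axpy; destruct a as [|[]|]; rewrite ?zip2_length; auto; rewrite Hr; symmetry; auto.
Qed.

Lemma lincomb_dot l m z P u s t : Forall (fun r => length r = length z) m -> (forall v, dot z v = 0) ->
  Forall2 (fun r x => s * dot r u = t * x) m P -> s * dot (lincomb l m z) u = t * dot l P.
Proof.
intros Hm Hz H; revert l Hm; induction H as [|r x m P Hr _ IH]; intros [|a l] Hm; simpl; rewrite ?Hz; try ring.
inversion Hm as [|? ? H1 H2]; subst; specialize (IH l H2).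
assert (E : dot (axpy a r (lincomb l m z)) u = a * dot r u + dot (lincomb l m z) u).
{ assert (L : length r = length (lincomb l m z)) by (rewrite lincomb_length; auto).
  assert (K : forall p, dot (zip2 (fun x y => p * x + y) r (lincomb l m z)) u = p * dot r u + dot (lincomb l m z) u).
  { intros p; rewrite (dot_zip2 p 1); [ring|intros; ring|auto]. }
  assert (K' : dot (zip2 Z.add r (lincomb l m z)) u = dot r u + dot (lincomb l m z) u).
  { rewrite (dot_zip2 1 1); [ring|intros; ring|auto]. }
  unfold axpy; destruct a as [|[]|]; rewrite ?K, ?K'; ring. }
rewrite E; transitivity (a * (s * dot r u) + s * dot (lincomb l m z) u); [ring|rewrite Hr, IH; ring].
Qed.

(** This is the case distinction made by [branch], with strict inequalities before the chosen
    candidate and weak ones after it. *)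
Lemma first_min {A} (val : A -> Z) (L : list A) : L <> nil -> exists L1 x L2, L = L1 ++ x :: L2 /\
  (forall y, In y L1 -> val x < val y) /\ (forall y, In y L2 -> val x <= val y).
Proof.
induction L as [|a L IH]; [easy|intros _].
destruct L as [|b L]; [exists nil, a, nil; repeat split; easy|].
destruct IH as (L1 & x & L2 & E & H1 & H2); [easy|].
destruct (Z_le_gt_dec (val a) (val x)) as [K|K].
- exists nil, a, (b :: L); split; [auto|split; [easy|]]; intros y; rewrite E, in_app_iff; intros [Hy|[<-|Hy]]; auto.
  + specialize (H1 y Hy); lia.
  + specialize (H2 y Hy); lia.
- exists (a :: L1), x, L2; rewrite E; split; [auto|split; [|auto]]; intros y [<-|Hy]; auto; lia.
Qed.

Lemma each_app k before L1 x L2 : each k before (L1 ++ x :: L2) = true ->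
  k (rev_append (map snd L1) before) x L2 = true.
Proof.
revert before; induction L1 as [|a L1 IH]; intros before; simpl.
- destruct (k before x L2); easy.
- destruct (k before a (L1 ++ x :: L2)); [apply IH|easy].
Qed.

Lemma minimals_spec s u acc F : Forall2 pos_if s u -> (forall c, In c (minimals acc F) -> In c acc \/ In c F) /\
  forall c, In c acc \/ In c F -> exists c', In c' (minimals acc F) /\ dot (snd c') u <= dot (snd c) u.
Proof.
intros Hu; revert acc; induction F as [|p F IH]; intros acc; simpl.
- split; [intros c Hc; apply in_rev in Hc; auto|].
  intros c [Hc|[]]; exists c; split; [now apply -> in_rev|lia].
- destruct (exs (fun p' => vle (snd p') (snd p)) acc) eqn:E.
  + destruct (IH acc) as [H1 H2]; split; [intros c Hc; destruct (H1 c Hc); auto|].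
    intros c [Hc|[<-|Hc]]; auto.
    apply exs_Exists in E as (a & Ha & E); destruct (H2 a (or_introl Ha)) as (c' & K1 & K2).
    exists c'; split; auto; pose proof (vle_dot _ _ _ _ Hu E); lia.
  + destruct (IH (p :: filter (fun p' => negb (vle (snd p) (snd p'))) acc)) as [H1 H2]; split.
    * intros c Hc; destruct (H1 c Hc) as [[<-|K]|K]; auto; apply filter_In in K; tauto.
    * intros c Hc; destruct (vle (snd p) (snd c)) eqn:Ec.
      -- destruct (H2 p) as (c' & K1 & K2); [left; now left|].
         exists c'; split; auto; pose proof (vle_dot _ _ _ _ Hu Ec); lia.
      -- apply H2; destruct Hc as [Hc|[<-|Hc]]; auto; [|left; now left].
         left; right; apply filter_In; rewrite Ec; auto.
Qed.

Lemma blocked_le pl U m i : N.testbit m i = true -> N.testbit (blocked pl U m) i = true.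
Proof.
intros H; induction U as [|[[[j b] v] d] U IH]; simpl; auto; destruct (inpl pl v); auto.
now rewrite N.lor_spec, IH, orb_true_r.
Qed.

Lemma blocked_inpl pl U m j b v d i : In (j, b, v, d) U -> inpl pl v = true -> N.testbit b i = true ->
  N.testbit (blocked pl U m) i = true.
Proof.
intros H Hv Hb; induction U as [|[[[j' b'] v'] d'] U IH]; simpl in *; [easy|].
destruct H as [H|H]; [injection H as -> -> -> ->|]; [rewrite Hv, N.lor_spec, Hb; auto|].
destruct (inpl pl v'); auto; now rewrite N.lor_spec, IH, orb_true_r.
Qed.

Lemma blocked_spec pl U m i : N.testbit (blocked pl U m) i = true ->
  N.testbit m i = true \/ exists j b v d, In (j, b, v, d) U /\ inpl pl v = true /\ N.testbit b i = true.
Proof.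
induction U as [|[[[j b] v] d] U IH]; simpl; auto; intros H.
assert (K : N.testbit (blocked pl U m) i = true ->
  N.testbit m i = true \/ (exists j' b' v' d', ((j, b, v, d) = (j', b', v', d') \/ In (j', b', v', d') U) /\
    inpl pl v' = true /\ N.testbit b' i = true)).
{ intros K; destruct (IH K) as [|(j' & b' & v' & d' & K1 & K2)]; auto; right; exists j', b', v', d'; auto. }
destruct (inpl pl v) eqn:E; [|auto].
rewrite N.lor_spec in H; destruct (N.testbit b i) eqn:Eb; auto.
right; exists j, b, v, d; auto.
Qed.

Fixpoint mask (l : list (N * v3)) : N := match l with nil => 0%N | p :: l => N.lor (fst p) (mask l) end.

Lemma mask_spec l i : N.testbit (mask l) i = true <-> exists p, In p l /\ N.testbit (fst p) i = true.
Proof.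
induction l as [|p l IH]; simpl.
- split; [easy|now intros (? & [] & _)].
- rewrite N.lor_spec, orb_true_iff, IH; split.
  + intros [H|(q & H1 & H2)]; eauto.
  + intros (q & [<-|H1] & H2); eauto.
Qed.

Lemma maskl_mask ps : maskl ps = mask (map fst ps).
Proof. induction ps; simpl; congruence. Qed.
Lemma maskr_mask ps : maskr ps = mask (map snd ps).
Proof. induction ps; simpl; congruence. Qed.

Section Side.
Variables (e : bool) (l : vec) (pl : bool * bool).
Hypothesis Hl : reduced e l.
Hypothesis Hpos : forall v, nonzero v = true -> 0 < qf l v.

Definition listed (p : N * v3) : Prop := exists i d, In (i, fst p, snd p, d) (univ e).
Fixpoint indep (qs : list (N * v3)) : Prop :=
  match qs with
  | nil => True
  | p :: qs => Forall (fun p' => parallel (snd p') (snd p) = false) qs /\ indep qs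
  end.

Lemma frontier_avail qs p : Forall listed qs -> In p (frontier (univ e) (blocked pl (univ e) (mask qs))) ->
  listed p /\ avail (map snd qs) pl (snd p) = true.
Proof.
intros Hq Hp; apply frontier_spec in Hp as (i & d & Hi & Hb & _); split; [exists i, d; auto|].
destruct (univ_entry _ _ _ _ _ Hi) as (Eb & _ & Hn & _ & Hu).
unfold avail; rewrite Hn; destruct (inpl pl (snd p)) eqn:Ep.
{ rewrite (blocked_inpl pl _ (mask qs) _ _ _ _ i Hi Ep) in Hb; [easy|]; rewrite Eb; apply N.pow2_bits_true. }
simpl; apply alls_Forall, Forall_forall; intros x Hx; apply in_map_iff in Hx as (q & <- & Hq').
rewrite Forall_forall in Hq; destruct (Hq q Hq') as (j & d' & Hj).
destruct (univ_entry _ _ _ _ _ Hj) as (Ej & _).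
destruct (Hu _ _ _ _ Hj) as (_ & _ & K); rewrite K; auto; intros <-.
rewrite blocked_le in Hb; [easy|]; apply mask_spec; exists q; split; auto; rewrite Ej; apply N.pow2_bits_true.
Qed.

Lemma frontier_cover qs v : Forall listed qs -> (mask qs < gates)%N -> avail (map snd qs) pl v = true ->
  exists p, In p (frontier (univ e) (blocked pl (univ e) (mask qs))) /\ qf l (snd p) <= qf l v.
Proof.
intros Hq Hg; apply cover; auto; intros i b x d Hi Hm.
assert (Uq : forall j b' x' d', In (j, b', x', d') (univ e) -> N.testbit b' i = true -> x' = x).
{ intros j b' x' d' Hj Hb; destruct (univ_entry _ _ _ _ _ Hj) as (-> & _ & _ & _ & Hu).
  rewrite N.pow2_bits_eqb in Hb; apply N.eqb_eq in Hb; destruct (Hu _ _ _ _ Hi) as (_ & K & _); auto. }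
apply blocked_spec in Hm as [Hm|(j & b' & x' & d' & H1 & H2 & H3)].
- right; split.
  + destruct (N.lt_ge_cases i 28) as [|Hi']; auto; exfalso.
    rewrite N.bits_above_log2 in Hm; [easy|].
    apply N.lt_le_trans with 28%N; auto; destruct (N.eq_dec (mask qs) 0) as [->|H0]; [easy|].
    apply N.log2_lt_pow2; [lia|exact Hg].
  + apply mask_spec in Hm as (q & H1 & H2); rewrite Forall_forall in Hq; destruct (Hq q H1) as (j & d' & Hj).
    rewrite <- (Uq _ _ _ _ Hj H2); now apply in_map.
- left; now rewrite <- (Uq _ _ _ _ H1 H3).
Qed.

Lemma used_unitc qs p : Forall listed qs -> (mask qs < gates)%N -> In p qs -> unitc (snd p) = true.
Proof.
intros Hq Hg Hp; rewrite Forall_forall in Hq; destruct (Hq p Hp) as (i & d & Hi).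
destruct (univ_entry _ _ _ _ _ Hi) as (Eb & K & _); apply K.
assert (Hm : N.testbit (mask qs) i = true).
{ apply mask_spec; exists p; split; auto; rewrite Eb; apply N.pow2_bits_true. }
destruct (N.lt_ge_cases i 28) as [|Hi']; auto; exfalso.
rewrite N.bits_above_log2 in Hm; [easy|].
apply N.lt_le_trans with 28%N; auto; destruct (N.eq_dec (mask qs) 0) as [->|H0]; [easy|].
apply N.log2_lt_pow2; [lia|exact Hg].
Qed.
End Side.

Definition lin3 (u : mtx) (v : v3) : v3 :=
  let '(y1, y2, y3) := u in let '(x, y, z) := v in add3 (scale3 x y1) (add3 (scale3 y y2) (scale3 z y3)).
Definition det3 (u : mtx) : Z :=
  let '(y1, y2, y3) := u in let '(a, b, c) := y1 in let '(d, e, f) := y2 in let '(g, h, i) := y3 in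
  a * (e * i - f * h) - b * (d * i - f * g) + c * (d * h - e * g).
Definition isom (p q : vec) : Prop := exists u, (det3 u = 1 \/ det3 u = -1) /\ forall v, qf p v = qf q (lin3 u v).

Lemma qf_lin3 q y1 y2 y3 x y z : length q = 6%nat -> qf q (lin3 (y1, y2, y3) (x, y, z)) =
  x * x * qf q y1 + y * y * qf q y2 + z * z * qf q y3 + x * y * (qf q (add3 y1 y2) - qf q y1 - qf q y2) +
  x * z * (qf q (add3 y1 y3) - qf q y1 - qf q y3) + y * z * (qf q (add3 y2 y3) - qf q y2 - qf q y3).
Proof.
destruct q as [|a [|b [|c [|r [|s [|t [|]]]]]]]; try easy; intros _.
destruct y1 as [[? ?] ?], y2 as [[? ?] ?], y3 as [[? ?] ?]; unfold qf; simpl; ring.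
Qed.

Lemma lin3_id v : lin3 ((1,0,0), (0,1,0), (0,0,1)) v = v.
Proof. destruct v as [[x y] z]; simpl; f_equal; [f_equal|]; ring. Qed.

Lemma same_gram_qf p q u : length p = 6%nat -> length q = 6%nat ->
  same_gram Z.eqb (qf p) (qf q) u = true -> forall v, qf p v = qf q (lin3 u v).
Proof.
intros Hp Hq; destruct u as [[y1 y2] y3]; unfold same_gram.
repeat match goal with |- context [if Z.eqb ?a ?b then _ else _] => destruct (Z.eqb_spec a b) as [?E|]; [|easy] end.
intros H; apply Z.eqb_eq in H; intros v; rewrite <- (lin3_id v) at 1; destruct v as [[x y] z].
rewrite !qf_lin3 by auto; simpl add3 in *; change (0 + 1) with 1; change (0 + 0) with 0; change (1 + 0) with 1.
now rewrite E, E0, E1, E2, E3, H.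
Qed.

Lemma isometries_det : Forall (fun u => det3 u = 1 \/ det3 u = -1) isometries.
Proof. repeat (constructor; [(left; reflexivity) || (right; reflexivity)|]); constructor. Qed.

Section Pair.
Variables (bf bg : bool) (p q : vec).
Hypothesis Hp : reduced bf p.
Hypothesis Hq : reduced bg q.
Hypothesis Ppos : forall v, nonzero v = true -> 0 < qf p v.
Hypothesis Qpos : forall v, nonzero v = true -> 0 < qf q v.
Hypothesis Hequi : equi (qf p) nonzero (qf q) nonzero.

Lemma reduced_length e l : reduced e l -> length l = 6%nat.
Proof. destruct l as [|? [|? [|? [|? [|? [|? [|]]]]]]]; easy. Qed.

Let Lp := reduced_length _ _ Hp.
Let Lq := reduced_length _ _ Hq.

Lemma dot_app a b c : length a = length b -> dot a (b ++ c) = dot a b.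
Proof.
revert b; induction a as [|x a IH]; intros [|y b]; simpl; try easy; intros H; injection H as H; now rewrite IH.
Qed.

Lemma coefs_length v : length (coefs v) = 6%nat.
Proof. now destruct v as [[? ?] ?]. Qed.

Lemma qf_app v : qf (p ++ q) v = qf p v.
Proof. apply dot_app; now rewrite coefs_length. Qed.

Lemma skipn_app6 : skipn 6 (p ++ q) = q.
Proof. rewrite skipn_app, Lp, skipn_all2 by lia; reflexivity. Qed.

(* [val] of a form of a cone is, up to a common positive factor, the value of [p] or [q] *)
Section Point.
Variables (S : cone) (u : vec) (s t : Z).
Hypothesis HS : wf S.
Hypothesis Hs : 0 < s.
Hypothesis Ht : 0 < t.
Hypothesis Hu : point S u.
Hypothesis HM : Forall2 (fun r x => s * dot r u = t * x) (mat S) (p ++ q).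

Let z := zeros (strict S).

Lemma zeros_length {T} (l : list T) : length (zeros l) = length l.
Proof. apply length_map. Qed.

Lemma mat_length : Forall (fun r => length r = length z) (mat S).
Proof. unfold z; rewrite zeros_length; apply HS. Qed.

Lemma Forall_skipn {A} (P : A -> Prop) n l : Forall P l -> Forall P (skipn n l).
Proof. intros H; revert n; induction H; intros [|n]; simpl; auto. Qed.

Lemma Forall_firstn {A} (P : A -> Prop) n l : Forall P l -> Forall P (firstn n l).
Proof. intros H; revert n; induction H; intros [|n]; simpl; auto. Qed.

Lemma Forall2_skipn {A B} (R : A -> B -> Prop) n l m : Forall2 R l m -> Forall2 R (skipn n l) (skipn n m).
Proof. intros H; revert n; induction H; intros [|n]; simpl; auto. Qed.

Lemma form_length m v : Forall (fun r => length r = length z) m -> length (form m z v) = length (strict S).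
Proof. intros H; unfold form; rewrite lincomb_length by auto; apply zeros_length. Qed.

Lemma forml_length v : length (form (mat S) z v) = length (strict S).
Proof. apply form_length, mat_length. Qed.
Lemma formr_length v : length (form (skipn 6 (mat S)) z v) = length (strict S).
Proof. apply form_length, Forall_skipn, mat_length. Qed.

Lemma forml_val v : s * dot (form (mat S) z v) u = t * qf p v.
Proof.
rewrite <- qf_app; apply lincomb_dot; auto; [apply mat_length|intros; apply dot_zeros].
Qed.

Lemma formr_val v : s * dot (form (skipn 6 (mat S)) z v) u = t * qf q v.
Proof.
replace (qf q v) with (qf (skipn 6 (p ++ q)) v) by now rewrite skipn_app6.
apply lincomb_dot; [apply Forall_skipn, mat_length|intros; apply dot_zeros|now apply Forall2_skipn].
Qed.

Lemma val_le a b x y : s * a = t * x -> s * b = t * y -> a <= b <-> x <= y.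
Proof. clear - Hs Ht; intros; split; intros; nia. Qed.
Lemma val_eq a x y : s * a = t * x -> s * a = t * y -> x = y.
Proof. clear - Hs Ht; intros; nia. Qed.

Lemma row_val i : (i < 12)%nat -> s * dot (row S i) u = t * nth i (p ++ q) 0.
Proof.
intros Hi; unfold row; assert (L : length (mat S) = 12%nat) by (rewrite (Forall2_len _ _ _ HM), length_app; lia).
rewrite <- L in Hi; revert i Hi; clear L; induction HM as [|r x m P Hr HF IH]; intros [|i]; simpl; try lia; auto.
intros Hi; apply IH; auto; lia.
Qed.

Lemma leaf_isom : leaf S z = true -> isom p q.
Proof.
unfold leaf; intros H; apply exs_Exists in H as (w & Hw & H).
destruct (same_gram Z.eqb _ _ w); [|easy].
exists w; split; [pose proof isometries_det as K; rewrite Forall_forall in K; auto|].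
apply same_gram_qf; auto.
destruct w as [[y1 y2] y3]; unfold same_gram in *.
assert (K : forall v v', veq (form (mat S) z v) (form (skipn 6 (mat S)) z v') = true -> (qf p v =? qf q v') = true).
{ intros v v' E; apply veq_eq in E; apply Z.eqb_eq, (val_eq (dot (form (mat S) z v) u)); [apply forml_val|rewrite E; apply formr_val]. }
repeat match type of H with context [veq ?a ?b] => let E := fresh in
  destruct (veq a b) eqn:E; [apply K in E; rewrite E|easy] end.
reflexivity.
Qed.

Lemma ties_rows : Forall (fun bc => length (snd bc) = length (strict S) /\ pos_if (fst bc) (dot (snd bc) u))
  (ties bf (mat S) ++ ties bg (skipn 6 (mat S))).
Proof.
assert (K : forall e l m, reduced e l -> Forall (fun r => length r = length (strict S)) m ->
  Forall2 (fun r x => s * dot r u = t * x) m l ->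
  Forall (fun bc => length (snd bc) = length (strict S) /\ pos_if (fst bc) (dot (snd bc) u)) (ties e m)).
{ clear - Hs Ht Hp Hq; intros e l m Hl Hm H.
  destruct l as [|a [|b [|c [|r [|s' [|t' [|]]]]]]]; try easy.
  destruct m as [|r0 [|r1 [|r2 [|r3 [|r4 [|r5 [|]]]]]]]; try (apply Forall2_len in H; easy).
  repeat match goal with H : Forall _ (_ :: _) |- _ => inversion H; clear H; subst
    | H : Forall2 _ (_ :: _) _ |- _ => inversion H; clear H; subst end.
  destruct Hl as (_ & _ & _ & _ & _ & _ & _ & _ & _ & _ & T1 & T2).
  simpl; apply Forall_app; split.
  - destruct (veq r0 r1) eqn:E; [|constructor]; apply veq_eq in E; subst r1.
    assert (a = b) by (eapply val_eq; eauto); constructor; [|constructor].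
    destruct e; simpl; unfold vsub; rewrite zip2_length by congruence; (split; [auto|]);
      fold (vsub r4 r3) (vsub r3 r4); rewrite dot_vsub by congruence; (split; [|easy]); specialize (T1 H); simpl in T1; nia.
  - destruct (veq r1 r2) eqn:E; [|constructor]; apply veq_eq in E; subst r2.
    assert (b = c) by (eapply val_eq; eauto); constructor; [|constructor].
    destruct e; simpl; unfold vsub; rewrite zip2_length by congruence; (split; [auto|]);
      fold (vsub r5 r4) (vsub r4 r5); rewrite dot_vsub by congruence; (split; [|easy]); specialize (T2 H); simpl in T2; nia. }
assert (K2 : ties bf (mat S) = ties bf (firstn 6 (mat S))).
{ unfold ties; destruct (mat S) as [|r0 [|r1 [|r2 [|r3 [|r4 [|r5 ?]]]]]]; reflexivity. }
apply Forall_app; split.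
- rewrite K2; apply (K bf p); auto; [apply Forall_firstn; apply HS|].
  rewrite <- (firstn_all2 (n := 6) p) by lia.
  replace (firstn 6 p) with (firstn 6 (p ++ q)) by (rewrite firstn_app, Lp; simpl; now rewrite app_nil_r).
  revert HM; generalize 6%nat; clear; generalize (mat S) (p ++ q); intros m l n H; revert n; induction H; intros [|n]; simpl; auto.
- apply (K bg q); auto; [apply Forall_skipn; apply HS|].
  rewrite <- skipn_app6; now apply Forall2_skipn.
Qed.
End Point.

(** While no plane has been removed, the first coefficients may differ; hence the last
    alternative. *)
Definition planes_ok (pl : bool * bool) : Prop :=
  nth 0 p 0 = nth 0 q 0 /\
  (fst pl = true -> nth 1 p 0 = nth 1 q 0 /\ (nth 5 p 0 = nth 5 q 0 \/ nth 5 p 0 = - nth 5 q 0)) /\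
  (snd pl = true -> nth 2 p 0 = nth 2 q 0 /\ (nth 4 p 0 = nth 4 q 0 \/ nth 4 p 0 = - nth 4 q 0)) \/
  pl = (false, false).

(** On the removed planes [y z = 0], so the coefficient [r] does not enter. Changing the sign of [y]
    affects only [t] and changing that of [z] affects only [s], so both planes can be matched by one
    map. *)
Lemma plane_equi pl : planes_ok pl ->
  equi (qf p) (fun v => nonzero v ands inpl pl v) (qf q) (fun v => nonzero v ands inpl pl v).
Proof.
intros H.
assert (E : exists e1 e2, (e1 = 1 \/ e1 = -1) /\ (e2 = 1 \/ e2 = -1) /\
  forall x y z, inpl pl (x, y, z) = true -> qf q (x, e1 * y, e2 * z) = qf p (x, y, z)).
{ destruct H as [(H0 & H1 & H2)| ->]; [|exists 1, 1; repeat split; auto; easy].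
  assert (E1 : exists e1, (e1 = 1 \/ e1 = -1) /\ (fst pl = true -> nth 1 p 0 = nth 1 q 0 /\ nth 5 p 0 = e1 * nth 5 q 0)).
  { destruct (fst pl) eqn:Ef; [|exists 1; split; auto; easy].
    destruct (H1 eq_refl) as [K1 [K2|K2]]; [exists 1|exists (-1)]; repeat split; auto; lia. }
  assert (E2 : exists e2, (e2 = 1 \/ e2 = -1) /\ (snd pl = true -> nth 2 p 0 = nth 2 q 0 /\ nth 4 p 0 = e2 * nth 4 q 0)).
  { destruct (snd pl) eqn:Ef; [|exists 1; split; auto; easy].
    destruct (H2 eq_refl) as [K1 [K2|K2]]; [exists 1|exists (-1)]; repeat split; auto; lia. }
  destruct E1 as (e1 & S1 & E1), E2 as (e2 & S2 & E2); exists e1, e2; repeat split; auto.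
  intros x y z; clear - Lp Lq H0 S1 S2 E1 E2; unfold qf.
  destruct p as [|a [|b [|c [|r [|s [|t [|]]]]]]]; try easy.
  destruct q as [|a' [|b' [|c' [|r' [|s' [|t' [|]]]]]]]; try easy; simpl in *.
  assert (Q1 : e1 * e1 = 1) by (destruct S1; subst; reflexivity); assert (Q2 : e2 * e2 = 1) by (destruct S2; subst; reflexivity).
  destruct pl as [p1 p2]; simpl in *; intros K.
  assert (C : (p1 = true /\ z = 0) \/ (p2 = true /\ y = 0)).
  { destruct p1, p2, (Z.eqb_spec z 0), (Z.eqb_spec y 0); auto; easy. }
  destruct C as [[-> ->]|[-> ->]].
  - destruct (E1 eq_refl) as [F1 F2]; transitivity (x * x * a' + (e1 * e1) * y * y * b' + 2 * x * y * (e1 * t')); [ring|].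
    rewrite Q1, <- F2, <- F1, <- H0; ring.
  - destruct (E2 eq_refl) as [F1 F2]; transitivity (x * x * a' + (e2 * e2) * z * z * c' + 2 * x * z * (e2 * s')); [ring|].
    rewrite Q2, <- F2, <- F1, <- H0; ring. }
destruct E as (e1 & e2 & S1 & S2 & E).
pose (phi := fun v : v3 => let '(x, y, z) := v in (x, e1 * y, e2 * z)).
assert (Z1 : forall y, (e1 * y =? 0) = (y =? 0)) by (intros; lia).
assert (Z2 : forall y, (e2 * y =? 0) = (y =? 0)) by (intros; lia).
assert (K1 : forall v, (nonzero (phi v) ands inpl pl (phi v)) = (nonzero v ands inpl pl v)).
{ intros [[x y] z]; simpl; now rewrite Z1, Z2. }
assert (K2 : forall v, phi (phi v) = v).
{ intros [[x y] z]; simpl; destruct S1, S2; subst; repeat f_equal; lia. }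
apply (equi_map _ _ _ _ phi phi).
- intros m; destruct (Hequi m) as (l & _ & Hl & _); eexists; eapply fibre_sub; [|exact Hl].
  intros v; simpl; destruct (nonzero v); auto.
- intros v Hv; rewrite K1, K2; repeat split; auto.
  destruct v as [[x y] z]; apply E; destruct (nonzero (x, y, z)); easy.
- intros v Hv; rewrite K1, K2; auto.
Qed.

Notation xs ps := (map snd (map fst ps)).
Notation ys ps := (map snd (map snd ps)).

Lemma avail_cons x l pl v : avail (x :: l) pl v = (if line x v then false else avail l pl v).
Proof.
unfold avail, line; simpl; destruct (nonzero v), (inpl pl v), (parallel x v); simpl; auto.
Qed.

Lemma line_avail x l pl v : unitc x = true -> avail l pl x = true -> line x v = true -> avail l pl v = true.
Proof. intros Hx Ha Hv; apply line_scale in Hv as (k & Hk & ->); auto; now rewrite avail_scale. Qed.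

(** The planes are taken off, and then the lines one at a time. Each line is still wholly available
    when its turn comes, so nothing is subtracted twice. *)
Lemma rest_equi pl l l' : planes_ok pl -> length l = length l' ->
  Forall (fun xy => qf p (fst xy) = qf q (snd xy)) (combine l l') ->
  Forall (fun x => unitc x = true) l -> Forall (fun x => unitc x = true) l' ->
  (forall l1 x l2, l = l1 ++ x :: l2 -> avail l2 pl x = true) ->
  (forall l1 x l2, l' = l1 ++ x :: l2 -> avail l2 pl x = true) ->
  equi (qf p) (avail l pl) (qf q) (avail l' pl).
Proof.
intros Hpl; revert l'; induction l as [|x l IH]; intros [|y l'] Hlen HE HU HU' HA HA'; try easy.
- eapply equi_ext; [| |apply (equi_minus _ _ _ _ _ _ Hequi (plane_equi pl Hpl))]; unfold avail; simpl;
    intros v; destruct (nonzero v), (inpl pl v); auto.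
- simpl in HE; inversion HE; inversion HU; inversion HU'; subst; simpl in *.
  assert (K : equi (qf p) (avail l pl) (qf q) (avail l' pl)).
  { injection Hlen as Hlen; apply IH; auto; [intros l1 x' l2 ->; apply (HA (x :: l1)); auto|intros l1 x' l2 ->; apply (HA' (y :: l1)); auto]. }
  assert (Ax := HA nil x l eq_refl); assert (Ay := HA' nil y l' eq_refl).
  eapply equi_ext; [intros; symmetry; apply avail_cons|intros; symmetry; apply avail_cons|].
  apply equi_minus; auto.
  + apply equi_line; auto; intros m; destruct (Hequi m) as (k & _ & Hk & _); eauto.
  + intros v; now apply line_avail.
  + intros v; now apply line_avail.
Qed.

Definition good (ps : list used) : Prop :=
  Forall (listed bf) (map fst ps) /\ Forall (listed bg) (map snd ps) /\
  indep (map fst ps) /\ indep (map snd ps) /\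
  Forall (fun u => qf p (snd (fst u)) = qf q (snd (snd u))) ps.
Definition out (pl : bool * bool) (ps : list used) : Prop :=
  Forall (fun u => inpl pl (snd (fst u)) = false /\ inpl pl (snd (snd u)) = false) ps.

Lemma indep_avail e pl qs : Forall (listed e) qs -> indep qs -> Forall (fun x => inpl pl (snd x) = false) qs ->
  forall l1 x l2, map snd qs = l1 ++ x :: l2 -> avail l2 pl x = true.
Proof.
intros HL Hi Ho l1; revert qs HL Hi Ho; induction l1 as [|a l1 IH]; intros [|k qs] HL Hi Ho x l2 E; try easy;
  simpl in *; inversion HL; inversion Ho; subst; destruct Hi as [Hi1 Hi2].
- injection E as <- <-; unfold avail.
  destruct H1 as (i & d & Hk); destruct (univ_entry _ _ _ _ _ Hk) as (_ & _ & Hn & _).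
  rewrite Hn, H5; simpl; apply alls_Forall, Forall_map; revert Hi1; apply Forall_impl; intros c ->; auto.
- injection E as _ E; eapply IH; eauto.
Qed.

Lemma good_equi pl ps : planes_ok pl -> good ps -> out pl ps -> (maskl ps < gates)%N -> (maskr ps < gates)%N ->
  equi (qf p) (avail (xs ps) pl) (qf q) (avail (ys ps) pl).
Proof.
intros Hpl (G1 & G2 & G3 & G4 & G5) Ho Ml Mr; rewrite maskl_mask in Ml; rewrite maskr_mask in Mr.
apply rest_equi; auto.
- now rewrite !length_map.
- clear - G5; induction G5 as [|w ps H _ IH]; simpl; constructor; [exact H|exact IH].
- apply Forall_forall; intros x Hx; apply in_map_iff in Hx as (k & <- & Hk); now apply (used_unitc bf (map fst ps)).
- apply Forall_forall; intros x Hx; apply in_map_iff in Hx as (k & <- & Hk); now apply (used_unitc bg (map snd ps)).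
- apply (indep_avail bf); auto; apply Forall_map; revert Ho; apply Forall_impl; tauto.
- apply (indep_avail bg); auto; apply Forall_map; revert Ho; apply Forall_impl; tauto.
Qed.

Lemma avail_indep pl (qs : list (N * v3)) (k : N * v3) : avail (map snd qs) pl (snd k) = true ->
  Forall (fun p' => parallel (snd p') (snd k) = false) qs /\ inpl pl (snd k) = false.
Proof.
unfold avail; destruct (nonzero (snd k)); [|easy]; destruct (inpl pl (snd k)); [easy|].
simpl; intros H; apply alls_Forall in H; split; auto.
rewrite Forall_map in H; revert H; apply Forall_impl; intros a; destruct (parallel _ _); easy.
Qed.

Lemma good_cons pl ps a b : good ps -> out pl ps -> listed bf a -> listed bg b ->
  avail (xs ps) pl (snd a) = true -> avail (ys ps) pl (snd b) = true -> qf p (snd a) = qf q (snd b) ->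
  good ((a, b) :: ps) /\ out pl ((a, b) :: ps).
Proof.
intros (G1 & G2 & G3 & G4 & G5) Ho La Lb Aa Ab E.
apply avail_indep in Aa as [Aa1 Aa2], Ab as [Ab1 Ab2].
split; [|constructor; auto]; repeat split; simpl; auto.
Qed.

Lemma good_filter (f : used -> bool) ps : good ps -> good (filter f ps).
Proof.
intros (G1 & G2 & G3 & G4 & G5); rewrite Forall_map in G1, G2.
assert (FF : forall P : used -> Prop, Forall P ps -> Forall P (filter f ps)).
{ intros P H; rewrite Forall_forall in *; intros x Hx; apply filter_In in Hx; apply H; tauto. }
assert (K : forall (T : Type) (h : used -> N * v3), indep (map h ps) -> indep (map h (filter f ps))).
{ clear; intros _ h; induction ps as [|w l IH]; simpl; auto; intros [H1 H2]; destruct (f w); simpl; auto.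
  split; auto; rewrite Forall_map in *; rewrite Forall_forall in *; intros x Hx; apply filter_In in Hx; apply H1; tauto. }
repeat split; rewrite ?Forall_map; auto; apply (K unit); auto.
Qed.

Lemma findeq_spec fv l b : findeq fv l = Some b -> In (b, fv) l.
Proof.
induction l as [|[c gv] l IH]; simpl; [easy|].
destruct (veq fv gv) eqn:E; [apply veq_eq in E; subst; intros H; injection H as ->; auto|auto].
Qed.

Lemma findpair_spec F G a b : findpair F G = Some (a, b) -> exists v, In (a, v) F /\ In (b, v) G.
Proof.
induction F as [|[c fv] F IH]; simpl; [easy|].
destruct (findeq fv G) eqn:E; [|intros H; destruct (IH H) as (v & H1 & H2); eauto].
intros H; injection H as -> ->; apply findeq_spec in E; eauto.
Qed.

Lemma candl_spec S z pl ps c : Forall (listed bf) (map fst ps) -> In c (candl bf S z pl ps) ->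
  snd c = form (mat S) z (snd (fst c)) /\ listed bf (fst c) /\ avail (xs ps) pl (snd (fst c)) = true.
Proof.
unfold candl; intros H Hc; apply in_map_iff in Hc as (a & <- & Ha); rewrite maskl_mask in Ha.
split; auto; now apply (frontier_avail bf pl (map fst ps)).
Qed.

Lemma candr_spec S z pl ps c : Forall (listed bg) (map snd ps) -> In c (candr bg S z pl ps) ->
  snd c = form (skipn 6 (mat S)) z (snd (fst c)) /\ listed bg (fst c) /\ avail (ys ps) pl (snd (fst c)) = true.
Proof.
unfold candr; intros H Hc; apply in_map_iff in Hc as (a & <- & Ha); rewrite maskr_mask in Ha.
split; auto; now apply (frontier_avail bg pl (map snd ps)).
Qed.

Lemma automatch_good n S u s t pl ps : wf S -> 0 < s -> 0 < t -> point S u ->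
  Forall2 (fun r x => s * dot r u = t * x) (mat S) (p ++ q) -> good ps -> out pl ps ->
  good (automatch bf bg n S (zeros (strict S)) pl ps) /\ out pl (automatch bf bg n S (zeros (strict S)) pl ps).
Proof.
intros HS Hs Ht Hu HM; revert ps; induction n as [|n IH]; intros ps Hg Ho; simpl; auto.
destruct (findpair _ _) as [[a b]|] eqn:E; auto.
apply findpair_spec in E as (v & Ea & Eb); pose proof Hg as (G1 & G2 & _).
destruct (candl_spec _ _ _ _ _ G1 Ea) as (A1 & A2 & A3), (candr_spec _ _ _ _ _ G2 Eb) as (B1 & B2 & B3).
cbn [fst snd] in *; destruct (good_cons pl ps a b) as [K1 K2]; auto.
eapply val_eq; [exact Ht| |]; [eapply forml_val; eauto|].
  rewrite <- A1, B1; eapply formr_val; eauto.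
Qed.

Lemma candl_nonempty S z pl ps v : good ps -> (maskl ps < gates)%N -> avail (xs ps) pl v = true ->
  exists c, In c (candl bf S z pl ps) /\ qf p (snd (fst c)) <= qf p v.
Proof.
intros (G & _) Hm Hv; rewrite maskl_mask in Hm.
destruct (frontier_cover bf p pl Hp Ppos (map fst ps) v G Hm Hv) as (a & A1 & A2).
exists (a, form (mat S) z (snd a)); split; auto; unfold candl; rewrite maskl_mask.
now apply (in_map (fun p => (p, form (mat S) z (snd p)))).
Qed.

Lemma candr_nonempty S z pl ps v : good ps -> (maskr ps < gates)%N -> avail (ys ps) pl v = true ->
  exists c, In c (candr bg S z pl ps) /\ qf q (snd (fst c)) <= qf q v.
Proof.
intros (_ & G & _) Hm Hv; rewrite maskr_mask in Hm.
destruct (frontier_cover bg q pl Hq Qpos (map snd ps) v G Hm Hv) as (a & A1 & A2).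
exists (a, form (skipn 6 (mat S)) z (snd a)); split; auto; unfold candr; rewrite maskr_mask.
now apply (in_map (fun p => (p, form (skipn 6 (mat S)) z (snd p)))).
Qed.

Lemma branch_rows k u x before after : length x = k ->
  (forall y, In y before -> length y = k /\ dot x u < dot y u) ->
  (forall c, In c after -> length (snd c) = k /\ dot x u <= dot (snd c) u) ->
  Forall (fun bc => length (snd bc) = k /\ pos_if (fst bc) (dot (snd bc) u)) (branch x before after).
Proof.
intros Hx Hb Ha; unfold branch; apply Forall_app; split; apply Forall_map, Forall_forall; simpl.
- intros y Hy; destruct (Hb y Hy) as [H1 H2]; unfold vsub; rewrite zip2_length by (transitivity k; auto); split; auto.
  fold (vsub y x); rewrite dot_vsub by (transitivity k; auto); unfold pos_if; simpl; lia.
- intros c Hc; destruct (Ha c Hc) as [H1 H2]; unfold vsub; rewrite zip2_length by (transitivity k; auto); split; auto.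
  fold (vsub (snd c) x); rewrite dot_vsub by (transitivity k; auto); split; [apply Z.le_0_sub; exact H2|easy].
Qed.

Lemma planes_planes_ok S u s t pl : wf S -> 0 < s -> 0 < t -> point S u ->
  Forall2 (fun r x => s * dot r u = t * x) (mat S) (p ++ q) -> planes_ok pl -> planes_ok (planes S pl).
Proof.
intros HS Hs Ht Hu HM H.
assert (Rp : forall i, (i < 6)%nat -> s * dot (row S i) u = t * nth i p 0).
{ intros i Hi; rewrite (row_val S u s t HM) by lia; rewrite app_nth1 by lia; auto. }
assert (Rq : forall i, (i < 6)%nat -> s * dot (row S (6 + i)) u = t * nth i q 0).
{ intros i Hi; rewrite (row_val S u s t HM) by lia; rewrite app_nth2, Lp by lia; do 2 f_equal; lia. }
assert (V : forall i, (i < 6)%nat -> veq (row S i) (row S (6 + i)) = true -> nth i p 0 = nth i q 0).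
{ intros i Hi E; apply veq_eq in E; eapply val_eq; [exact Ht|apply Rp; auto|rewrite E; apply Rq; auto]. }
assert (W : forall i, (i < 6)%nat -> eqpm (row S i) (row S (6 + i)) = true -> nth i p 0 = nth i q 0 \/ nth i p 0 = - nth i q 0).
{ intros i Hi E; unfold eqpm in E; destruct (veq _ (row S (6 + i))) eqn:E1; [left; auto|right].
  apply veq_eq in E; eapply val_eq; [exact Ht|apply Rp; auto|].
  rewrite E, dot_opp; specialize (Rq i Hi); lia. }
unfold planes; destruct (veq (row S 0) (row S 6)) eqn:E0; auto; left.
split; [apply V; auto; lia|].
assert (H' : (fst pl = true -> nth 1 p 0 = nth 1 q 0 /\ (nth 5 p 0 = nth 5 q 0 \/ nth 5 p 0 = - nth 5 q 0)) /\
  (snd pl = true -> nth 2 p 0 = nth 2 q 0 /\ (nth 4 p 0 = nth 4 q 0 \/ nth 4 p 0 = - nth 4 q 0))).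
{ destruct H as [[_ H]| ->]; [auto|easy]. }
destruct H' as [H1 H2]; split; simpl.
- destruct (fst pl); auto; destruct (veq (row S 1) (row S 7)) eqn:E1; [|easy].
  intros E2; split; [apply V; auto; lia|apply W; auto; lia].
- destruct (snd pl); auto; destruct (veq (row S 2) (row S 8)) eqn:E1; [|easy].
  intros E2; split; [apply V; auto; lia|apply W; auto; lia].
Qed.

Strategy opaque [infeasible tighten addrows normalize automatch minimals candl candr planes addeq bare leaf ties maskl maskr gates fuelT branch form].
(** The given pair of forms is followed down the tree. At each node it lies in the branch of the
    earliest minimal candidates, whose values agree because what remains on the two sides has
    equally large fibres. A cone containing the pair is never found empty, so its path can end only
    in a leaf. *)
Theorem explore_sound n S0 ps pl : explore bf bg n S0 ps pl = true -> wf S0 -> sat S0 (p ++ q) -> good ps ->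
  planes_ok pl -> isom p q.
Proof.
revert S0 ps pl; induction n as [|n IH]; intros S0 ps pl; [easy|].
intros HE W0 Sat0 Hg Hpl; cbn beta iota zeta delta [explore] in HE; fold explore in HE.
destruct (tighten_sat fuelT S0 _ W0 Sat0) as (S1 & E1 & W1 & Sat1); rewrite E1 in HE; clear E1.
apply sat_satat in Sat1 as [u1 Su1]; pose proof Su1 as (s1 & t1 & Hs1 & Ht1 & Hu1 & HM1).
destruct (addrows_sat (ties bf (mat S1) ++ ties bg (skipn 6 (mat S1))) S1 _ u1 W1 Su1) as [W2 Su2].
{ exact (ties_rows S1 u1 s1 t1 W1 Hs1 Ht1 HM1). }
destruct (tighten_sat fuelT _ (p ++ q) W2) as (S2 & E2 & W3 & Sat2); [apply sat_satat; eauto|].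
rewrite E2 in HE; clear E2.
destruct (normalize_sat _ _ W3 Sat2) as [W4 Sat3]; set (S := normalize S2) in *; clearbody S.
apply sat_satat in Sat3 as [u Su]; pose proof Su as (s & t & Hs & Ht & Hu & HM).
destruct (leaf S (zeros (strict S))) eqn:El; [exact (leaf_isom S u s t W4 Ht HM El)|clear El].
set (pl' := planes S pl) in *.
assert (Hpl' : planes_ok pl') by exact (planes_planes_ok S u s t pl W4 Hs Ht Hu HM Hpl).
clearbody pl'; clear Hpl pl.
(* A pair with a member in a removed plane is given up. The plane now accounts for that member, and
   the other one, if it lies in no removed plane, becomes available again. *)
match type of HE with context [filter ?f ps] => set (ps1 := filter f ps) in HE end.
assert (Hg1 : good ps1) by now apply good_filter.
assert (Ho1 : out pl' ps1).
{ apply Forall_forall; intros x Hx; apply filter_In in Hx as [_ Hx].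
  destruct (inpl pl' (snd (fst x))), (inpl pl' (snd (snd x))); easy. }
clearbody ps1; clear Hg ps.
destruct (automatch_good 40 S u s t pl' ps1) as [Hg2 Ho2]; auto.
set (ps := automatch bf bg 40 S _ pl' ps1) in *; clearbody ps; clear Hg1 Ho1 ps1.
remember (minimals nil (candl bf S (zeros (strict S)) pl' ps)) as F eqn:EF.
assert (HF : F <> nil) by (intros K; rewrite K in HE; easy).
assert (HE' : (if if (maskl ps <? gates)%N then (maskr ps <? gates)%N else false then
  match F with nil => false | _ => true end else false) = true).
{ destruct F; [easy|]; destruct (if (maskl ps <? gates)%N then (maskr ps <? gates)%N else false); easy. }
destruct (N.ltb_spec (maskl ps) gates) as [Ml|]; [|easy].
destruct (N.ltb_spec (maskr ps) gates) as [Mr|]; [|easy]; clear HE'.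
cbv iota in HE. match type of HE with context [each ?k nil F] => assert (HE1 : each k nil F = true) by (destruct F; [easy|exact HE]) end; clear HE.
pose proof Hg2 as (G1 & G2 & _).
pose proof (good_equi pl' ps Hpl' Hg2 Ho2 Ml Mr) as Heq.
destruct Hu as [Hu0 Hu2].
destruct (minimals_spec (strict S) u nil (candl bf S (zeros (strict S)) pl' ps) Hu0) as [MF1 MF2].
rewrite <- EF in MF1, MF2.
assert (CF : forall c, In c F -> snd c = form (mat S) (zeros (strict S)) (snd (fst c)) /\ listed bf (fst c) /\
  avail (xs ps) pl' (snd (fst c)) = true).
{ intros c Hc; destruct (MF1 c Hc) as [[]|Hc']; apply (candl_spec S _ _ _ _ G1 Hc'). }
assert (VF : forall c, In c F -> length (snd c) = length (strict S) /\ s * dot (snd c) u = t * qf p (snd (fst c))).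
{ intros c Hc; destruct (CF c Hc) as (-> & _); split; [eapply forml_length; eauto|eapply forml_val; eauto]. }
destruct (first_min (fun c : cand => dot (snd c) u) F HF) as (L1 & x & L2 & EL & Lt & Le).
rewrite EL in HE1; apply each_app in HE1; cbv beta in HE1.
assert (IF : In x F) by (rewrite EL; apply in_app_iff; right; now left).
destruct (CF x IF) as (X1 & X2 & X3), (VF x IF) as (X4 & X5).
assert (Xmin : forall v, avail (xs ps) pl' v = true -> qf p (snd (fst x)) <= qf p v).
{ intros v Hv; destruct (candl_nonempty S (zeros (strict S)) pl' ps v Hg2 Ml Hv) as (c & C1 & C2).
  destruct (MF2 c (or_intror C1)) as (c' & C3 & C4); destruct (VF c' C3) as [_ C5].
  assert (C6 : dot (snd x) u <= dot (snd c') u).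
  { rewrite EL in C3; apply in_app_iff in C3 as [C3|[<-|C3]]; [specialize (Lt c' C3); lia|lia|auto]. }
  destruct (candl_spec S _ _ _ _ G1 C1) as (C7 & _).
  assert (C8 : s * dot (snd c) u = t * qf p (snd (fst c))) by (rewrite C7; eapply forml_val; eauto).
  apply Z.le_trans with (qf p (snd (fst c))); [|exact C2].
  apply (val_le s t Hs Ht (dot (snd x) u) (dot (snd c) u)); auto; lia. }
set (S' := addrows (branch (snd x) (rev_append (map snd L1) nil) L2) S) in HE1.
assert (A' : wf S' /\ satat S' (p ++ q) u).
{ apply addrows_sat; auto; apply branch_rows; auto.
  - intros y Hy; rewrite rev_append_rev, app_nil_r, <- in_rev in Hy; apply in_map_iff in Hy as (c & <- & Hc).
    split; [|now apply Lt]; apply VF; rewrite EL; apply in_app_iff; now left.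
  - intros c Hc; split; [|now apply Le]; apply VF; rewrite EL; apply in_app_iff; right; now right. }
destruct A' as [W5 Su5]; clearbody S'.
assert (Sat5 : sat S' (p ++ q)) by (apply sat_satat; eauto).
destruct (bare_sat _ _ W5 Sat5) as [W5' Sat5']; rewrite (infeasible_sat _ _ W5' Sat5') in HE1.
destruct (tighten_sat fuelT _ _ W5 Sat5) as (S6 & E6 & W6 & Sat6); rewrite E6 in HE1; clear E6.
destruct (normalize_sat _ _ W6 Sat6) as [W7 Sat7]; set (R := normalize S6) in *; clearbody R.
apply sat_satat in Sat7 as [w Sw]; pose proof Sw as (s' & t' & Hs' & Ht' & Hw & HR).
remember (minimals nil (candr bg R (zeros (strict R)) pl' ps)) as G eqn:EG.
pose proof Hw as [Hw0 Hw1].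
destruct (minimals_spec (strict R) w nil (candr bg R (zeros (strict R)) pl' ps) Hw0) as [MG1 MG2].
rewrite <- EG in MG1, MG2.
assert (CG : forall c, In c G -> snd c = form (skipn 6 (mat R)) (zeros (strict R)) (snd (fst c)) /\ listed bg (fst c) /\
  avail (ys ps) pl' (snd (fst c)) = true).
{ intros c Hc; destruct (MG1 c Hc) as [[]|Hc']; apply (candr_spec R _ _ _ _ G2 Hc'). }
assert (VG : forall c, In c G -> length (snd c) = length (strict R) /\ s' * dot (snd c) w = t' * qf q (snd (fst c))).
{ intros c Hc; destruct (CG c Hc) as (-> & _); split; [eapply formr_length; eauto|eapply formr_val; eauto]. }
assert (HG : G <> nil).
{ destruct (equi_witness _ _ _ _ _ Heq X3) as (v & V1 & _).
  destruct (candr_nonempty R (zeros (strict R)) pl' ps v Hg2 Mr V1) as (c & C1 & _).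
  destruct (MG2 c (or_intror C1)) as (c' & C3 & _); intros K; rewrite K in C3; easy. }
destruct (first_min (fun c : cand => dot (snd c) w) G HG) as (M1 & y & M2 & EM & Mt & Me).
rewrite EM in HE1; apply each_app in HE1; cbv beta in HE1.
assert (IG : In y G) by (rewrite EM; apply in_app_iff; right; now left).
destruct (CG y IG) as (Y1 & Y2 & Y3), (VG y IG) as (Y4 & Y5).
assert (Ymin : forall v, avail (ys ps) pl' v = true -> qf q (snd (fst y)) <= qf q v).
{ intros v Hv; destruct (candr_nonempty R (zeros (strict R)) pl' ps v Hg2 Mr Hv) as (c & C1 & C2).
  destruct (MG2 c (or_intror C1)) as (c' & C3 & C4); destruct (VG c' C3) as [_ C5].
  assert (C6 : dot (snd y) w <= dot (snd c') w).
  { rewrite EM in C3; apply in_app_iff in C3 as [C3|[<-|C3]]; [specialize (Mt c' C3); lia|lia|auto]. }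
  destruct (candr_spec R _ _ _ _ G2 C1) as (C7 & _).
  assert (C8 : s' * dot (snd c) w = t' * qf q (snd (fst c))) by (rewrite C7; eapply formr_val; eauto).
  apply Z.le_trans with (qf q (snd (fst c))); [|exact C2].
  apply (val_le s' t' Hs' Ht' (dot (snd y) w) (dot (snd c) w)); auto; lia. }
assert (Exy : qf p (snd (fst x)) = qf q (snd (fst y))) by (apply (equi_min _ _ _ _ _ _ Heq); auto).
set (S'' := addrows (branch (snd y) (rev_append (map snd M1) nil) M2) R) in HE1.
assert (A'' : wf S'' /\ satat S'' (p ++ q) w).
{ apply addrows_sat; auto; apply branch_rows; auto.
  - intros v Hv; rewrite rev_append_rev, app_nil_r, <- in_rev in Hv; apply in_map_iff in Hv as (c & <- & Hc).
    split; [|now apply Mt]; apply VG; rewrite EM; apply in_app_iff; now left.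
  - intros c Hc; split; [|now apply Me]; apply VG; rewrite EM; apply in_app_iff; right; now right. }
assert (ES : strict S'' = strict R) by reflexivity.
destruct A'' as [W8 Su8]; clearbody S''.
set (e := vsub (form (mat R) (zeros (strict R)) (snd (fst x))) (snd y)) in HE1.
assert (Le1 : length (form (mat R) (zeros (strict R)) (snd (fst x))) = length (strict R)) by (eapply forml_length; eauto).
assert (Hel : length e = length (strict S'')).
{ unfold e, vsub; rewrite zip2_length, Le1, ES; auto; transitivity (length (strict R)); auto. }
assert (He : dot e w = 0).
{ unfold e; rewrite dot_vsub by (transitivity (length (strict R)); auto).
  pose proof (forml_val R w s' t' W7 HR (snd (fst x))) as V; rewrite Exy, <- Y5 in V; nia. }
clearbody e.
assert (Sat8 : sat S'' (p ++ q)) by (apply sat_satat; eauto).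
destruct (bare_sat _ _ W8 Sat8) as [W8' _].
assert (Su8' : satat (bare S'') nil w).
{ destruct Su8 as (a & b & Ha & Hb & Hc & _); exists a, b; repeat split; auto; try apply Hc; constructor. }
destruct (addeq_sat e (bare S'') nil w W8' Hel Su8' He) as (T & ET & WT & SatT).
rewrite ET, (infeasible_sat _ _ WT SatT) in HE1.
destruct (addeq_sat e S'' (p ++ q) w W8 Hel Su8 He) as (T' & ET' & WT' & SatT').
rewrite ET' in HE1.
destruct (good_cons pl' ps (fst x) (fst y)) as [K1 K2]; auto.
exact (IH T' _ _ HE1 WT' SatT' K1 Hpl').
Qed.
End Pair.

(** * Reduction of ternary forms *)

Ltac v3ring := repeat match goal with v : v3 |- _ => destruct v as [[? ?] ?] | u : mtx |- _ => destruct u as [[? ?] ?] end;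
  unfold lin3, det3, add3, scale3; simpl; repeat (f_equal; try ring); try ring.

Definition comp3 (u w : mtx) : mtx := let '(y1, y2, y3) := w in (lin3 u y1, lin3 u y2, lin3 u y3).

Lemma lin3_comp u w v : lin3 u (lin3 w v) = lin3 (comp3 u w) v.
Proof. v3ring. Qed.

Lemma det3_comp u w : det3 (comp3 u w) = det3 u * det3 w.
Proof.
destruct u as [[[[? ?] ?] [[? ?] ?]] [[? ?] ?]], w as [[[[? ?] ?] [[? ?] ?]] [[? ?] ?]].
unfold det3, comp3, lin3, add3, scale3; ring.
Qed.

Definition adj3 (u : mtx) : mtx :=
  let '(y1, y2, y3) := u in let '(a, b, c) := y1 in let '(d, e, f) := y2 in let '(g, h, i) := y3 in
  ((e * i - f * h, c * h - b * i, b * f - c * e),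
   (f * g - d * i, a * i - c * g, c * d - a * f),
   (d * h - e * g, b * g - a * h, a * e - b * d)).

Lemma adj3_comp u v : lin3 (comp3 (adj3 u) u) v = scale3 (det3 u) v /\ lin3 (comp3 u (adj3 u)) v = scale3 (det3 u) v.
Proof.
destruct u as [[[[? ?] ?] [[? ?] ?]] [[? ?] ?]], v as [[? ?] ?].
unfold det3, comp3, adj3, lin3, add3, scale3; split; simpl; repeat match goal with |- (_, _) = (_, _) => f_equal end; ring.
Qed.

Lemma det3_adj u : det3 (adj3 u) = det3 u * det3 u.
Proof. destruct u as [[[[? ?] ?] [[? ?] ?]] [[? ?] ?]]; unfold det3, adj3; ring. Qed.

Lemma unimodular_inverse u : det3 u = 1 \/ det3 u = -1 -> exists w, (det3 w = 1 \/ det3 w = -1) /\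
  forall v, lin3 w (lin3 u v) = v /\ lin3 u (lin3 w v) = v.
Proof.
intros H; set (e := det3 u) in *.
(* The adjugate divided by the determinant, which is its own inverse. *)
exists (comp3 (adj3 u) ((e,0,0),(0,e,0),(0,0,e))); split.
- rewrite det3_comp, det3_adj; fold e; unfold det3; clearbody e; destruct H as [-> | ->]; [left|right]; reflexivity.
- intros v; destruct (adj3_comp u v) as [E1 E2].
  assert (K : forall v, lin3 ((e,0,0),(0,e,0),(0,0,e)) v = scale3 e v) by (intros; v3ring).
  assert (K1 : forall w v, lin3 w (scale3 e v) = scale3 e (lin3 w v)) by (intros; v3ring).
  assert (K2 : forall v, scale3 e (scale3 e v) = v) by (destruct H as [-> | ->]; intros [[? ?] ?]; v3ring).
  rewrite <- !lin3_comp, !K, !K1, !lin3_comp, E1, E2; fold e; now rewrite K2.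
Qed.

Lemma isom_sym p q : isom p q -> isom q p.
Proof.
intros (u & Hu & H); destruct (unimodular_inverse u Hu) as (w & Hw & K); exists w; split; auto.
intros v; now rewrite H, (proj2 (K v)).
Qed.

Lemma isom_trans p q r : isom p q -> isom q r -> isom p r.
Proof.
intros (u & Hu & H) (w & Hw & K); exists (comp3 w u); split.
- rewrite det3_comp; lia.
- intros v; now rewrite <- lin3_comp, H, K.
Qed.

Definition posdef (l : vec) : Prop := forall v, nonzero v = true -> 0 < qf l v.

Lemma lin3_nonzero u v : det3 u = 1 \/ det3 u = -1 -> nonzero (lin3 u v) = nonzero v.
Proof.
intros Hu; destruct (unimodular_inverse u Hu) as (w & _ & K).
assert (Z0 : forall v, nonzero v = false <-> v = (0,0,0)).
{ intros [[x y] z]; simpl; destruct (Z.eqb_spec x 0), (Z.eqb_spec y 0), (Z.eqb_spec z 0); simpl; split; intros; subst; try easy; congruence. }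
assert (L0 : forall u, lin3 u (0,0,0) = (0,0,0)) by (intros; v3ring).
destruct (nonzero v) eqn:E; destruct (nonzero (lin3 u v)) eqn:E'; auto.
- apply Z0 in E'; destruct (K v) as [K1 _]; rewrite E', L0 in K1; subst v; easy.
- apply Z0 in E; subst v; rewrite L0 in E'; easy.
Qed.

Lemma isom_posdef p q : isom p q -> posdef q -> posdef p.
Proof. intros (u & Hu & H) Q v Hv; rewrite H; apply Q; now rewrite lin3_nonzero. Qed.

Lemma isom_equi p q {W} (g : W -> Z) B : isom p q -> equi (qf q) nonzero g B -> equi (qf p) nonzero g B.
Proof.
intros (u & Hu & H) E m; destruct (E m) as (l & l' & [L1 L2] & L3 & L4).
destruct (unimodular_inverse u Hu) as (w & Hw & K).
exists (map (lin3 w) l), l'; rewrite length_map; split; [split|split; auto].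
- apply FinFun.Injective_map_NoDup; auto; intros x y Hxy.
  now rewrite <- (proj2 (K x)), Hxy, (proj2 (K y)).
- intros v; split.
  + intros V; apply in_map_iff in V as (x & <- & Hx); rewrite lin3_nonzero, H, (proj2 (K x)) by auto; now apply L2.
  + intros [V1 V2]; apply in_map_iff; exists (lin3 u v); split; [apply K|].
    apply L2; rewrite lin3_nonzero by auto; split; auto; now rewrite <- H.
Qed.

Definition trace3 (l : vec) : Z := nth 0 l 0 + nth 1 l 0 + nth 2 l 0.

(** These inequalities say that [a + b + c] does not drop when one basis vector is changed by plus
    or minus another one, or by a signed sum of both others. *)
Definition near (l : vec) : Prop := match l with
  | [a; b; c; r; s; t] => 2 * Z.abs t <= a /\ 2 * Z.abs t <= b /\ 2 * Z.abs s <= a /\ 2 * Z.abs s <= c /\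
     2 * Z.abs r <= b /\ 2 * Z.abs r <= c /\ forall e f, Z.abs e = 1 -> Z.abs f = 1 -> 
     0 <= a + b + 2 * e * f * t + 2 * e * s + 2 * f * r /\ 
     0 <= b + c + 2 * e * f * r + 2 * e * t + 2 * f * s /\ 
     0 <= a + c + 2 * e * f * s + 2 * e * r + 2 * f * t 
  | _ => False end.

Lemma near_or_smaller l : length l = 6%nat -> near l \/ exists l', isom l' l /\ length l' = 6%nat /\ trace3 l' < trace3 l.
Proof.
destruct l as [|a [|b [|c [|r [|s [|t [|]]]]]]]; try easy; intros _.
assert (A1 : forall x y, (exists e, Z.abs e = 1 /\ x + 2 * e * y < 0) \/ 2 * Z.abs y <= x).
{ intros x y; destruct (Z_lt_le_dec (x + 2 * y) 0); [left; exists 1; lia|].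
  destruct (Z_lt_le_dec (x - 2 * y) 0); [left; exists (-1); lia|right; lia]. }
assert (E1 : forall e, Z.abs e = 1 -> e * e = 1) by (intros; assert (e = 1 \/ e = -1) as [-> | ->] by lia; lia).
assert (M : forall u l', (forall v, qf l' v = qf [a;b;c;r;s;t] (lin3 u v)) -> det3 u = 1 -> length l' = 6%nat -> trace3 l' < trace3 [a;b;c;r;s;t] ->
  exists l', isom l' [a;b;c;r;s;t] /\ length l' = 6%nat /\ trace3 l' < trace3 [a;b;c;r;s;t]).
{ intros u l' H1 H2 H3 H4; exists l'; repeat split; auto; exists u; auto. }
Local Ltac use M u l' := right; apply (M u l'); [intros [[? ?] ?]; unfold qf; simpl; ring|unfold det3; ring|reflexivity|
  unfold trace3; simpl].
destruct (A1 a t) as [(e & He & K)|B1].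
{ use M ((1,0,0),(e,1,0),(0,0,1)) [a; b + 2 * e * t + e * e * a; c; r + e * s; s; t + e * a]. rewrite E1 by auto; lia. }
destruct (A1 b t) as [(e & He & K)|B2].
{ use M ((1,e,0),(0,1,0),(0,0,1)) [a + 2 * e * t + e * e * b; b; c; r; s + e * r; t + e * b]. rewrite E1 by auto; lia. }
destruct (A1 a s) as [(e & He & K)|B3].
{ use M ((1,0,0),(0,1,0),(e,0,1)) [a; b; c + 2 * e * s + e * e * a; r + e * t; s + e * a; t]. rewrite E1 by auto; lia. }
destruct (A1 c s) as [(e & He & K)|B4].
{ use M ((1,0,e),(0,1,0),(0,0,1)) [a + 2 * e * s + e * e * c; b; c; r; s + e * c; t + e * r]. rewrite E1 by auto; lia. }
destruct (A1 b r) as [(e & He & K)|B5].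
{ use M ((1,0,0),(0,1,0),(0,e,1)) [a; b; c + 2 * e * r + e * e * b; r + e * b; s + e * t; t]. rewrite E1 by auto; lia. }
destruct (A1 c r) as [(e & He & K)|B6].
{ use M ((1,0,0),(0,1,e),(0,0,1)) [a; b + 2 * e * r + e * e * c; c; r + e * c; s; t + e * s]. rewrite E1 by auto; lia. }
assert (A2 : forall P : Z -> Z -> Z, (exists e f, Z.abs e = 1 /\ Z.abs f = 1 /\ P e f < 0) \/ forall e f, Z.abs e = 1 -> Z.abs f = 1 -> 0 <= P e f).
{ intros P; destruct (Z_lt_le_dec (P 1 1) 0); [left; exists 1, 1; lia|].
  destruct (Z_lt_le_dec (P 1 (-1)) 0); [left; exists 1, (-1); lia|].
  destruct (Z_lt_le_dec (P (-1) 1) 0); [left; exists (-1), 1; lia|].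
  destruct (Z_lt_le_dec (P (-1) (-1)) 0); [left; exists (-1), (-1); lia|right].
  intros e f He Hf; assert (e = 1 \/ e = -1) as [-> | ->] by lia; assert (f = 1 \/ f = -1) as [-> | ->] by lia; auto. }
destruct (A2 (fun e f => a + b + 2 * e * f * t + 2 * e * s + 2 * f * r)) as [(e & f & He & Hf & K)|B7].
{ use M ((1,0,0),(0,1,0),(e,f,1)) [a; b; c + e * e * a + f * f * b + 2 * e * f * t + 2 * e * s + 2 * f * r; r + e * t + f * b; s + e * a + f * t; t].
  rewrite !E1 by auto; lia. }
destruct (A2 (fun e f => b + c + 2 * e * f * r + 2 * e * t + 2 * f * s)) as [(e & f & He & Hf & K)|B8].
{ use M ((1,e,f),(0,1,0),(0,0,1)) [a + e * e * b + f * f * c + 2 * e * f * r + 2 * e * t + 2 * f * s; b; c; r; s + e * r + f * c; t + e * b + f * r].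
  rewrite !E1 by auto; lia. }
destruct (A2 (fun e f => a + c + 2 * e * f * s + 2 * e * t + 2 * f * r)) as [(e & f & He & Hf & K)|B9].
{ use M ((1,0,0),(e,1,f),(0,0,1)) [a; b + e * e * a + f * f * c + 2 * e * f * s + 2 * e * t + 2 * f * r; c; r + e * s + f * c; s; t + e * a + f * s].
  rewrite !E1 by auto; lia. }
left; do 6 (split; auto); intros e f He Hf; pose proof (B9 f e Hf He) as H; cbv beta in H; split; [auto|split; [auto|lia]].
Qed.

(** Sorting the pairs lexicographically yields [a <= b <= c] together with both boundary conditions
    of [reduced]. *)
Definition le2 (x y x' y' : Z) : Prop := x < x' \/ x = x' /\ Z.abs y <= Z.abs y'.
(* Permuting the basis permutes the pairs [(a, r)], [(b, s)], [(c, t)] *)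
Definition ordered (l : vec) : Prop := match l with
  | [a; b; c; r; s; t] => le2 a r b s /\ le2 b s c t
  | _ => False end.

Lemma near_ordered l : near l -> exists l', isom l' l /\ near l' /\ ordered l'.
Proof.
destruct l as [|a [|b [|c [|r [|s [|t [|]]]]]]]; try easy; intros H.
assert (T : forall x y x' y', le2 x y x' y' \/ le2 x' y' x y) by (unfold le2; lia).
assert (Tr : forall x y x' y' x'' y'', le2 x y x' y' -> le2 x' y' x'' y'' -> le2 x y x'' y'') by (unfold le2; lia).
Local Ltac destruct_conjs := repeat match goal with H : _ /\ _ |- _ => destruct H end.
Local Ltac signs := match goal with H : forall e f, _ -> _ -> _ |- _ => let e := fresh in let f := fresh in let He := fresh in let Hf := fresh in
  intros e f He Hf; pose proof (H e f He Hf); pose proof (H f e Hf He); lia end.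
Local Ltac perm u l' := exists l'; split; [exists u; split; [(left; reflexivity) || (right; reflexivity)|
  intros [[? ?] ?]; unfold qf; simpl; ring]|split; [unfold near in *; destruct_conjs; do 6 (split; [assumption|]); signs|unfold ordered; split; eauto]].

destruct (T a r b s) as [K1|K1], (T b s c t) as [K2|K2], (T a r c t) as [K3|K3].
all: [> perm ((1,0,0),(0,1,0),(0,0,1)) [a;b;c;r;s;t] | perm ((1,0,0),(0,1,0),(0,0,1)) [a;b;c;r;s;t]
 | perm ((1,0,0),(0,0,1),(0,1,0)) [a;c;b;r;t;s] | perm ((0,0,1),(1,0,0),(0,1,0)) [c;a;b;t;r;s]
 | perm ((0,1,0),(1,0,0),(0,0,1)) [b;a;c;s;r;t] | perm ((0,1,0),(0,0,1),(1,0,0)) [b;c;a;s;t;r]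
 | perm ((0,0,1),(0,1,0),(1,0,0)) [c;b;a;t;s;r] | perm ((0,0,1),(0,1,0),(1,0,0)) [c;b;a;t;s;r] ].
Qed.

Lemma ordered_reduced l : near l -> ordered l -> posdef l -> exists e l', isom l' l /\ reduced e l'.
Proof.
destruct l as [|a [|b [|c [|r [|s [|t [|]]]]]]]; try easy; intros H O P.
assert (Pa : 0 < a) by (specialize (P (1,0,0) eq_refl); unfold qf in P; simpl in P; lia).
assert (S : forall e f g, Z.abs e = 1 -> Z.abs f = 1 -> Z.abs g = 1 -> isom [a;b;c;f*g*r;e*g*s;e*f*t] [a;b;c;r;s;t]).
{ intros e f g He Hf Hg; exists ((e,0,0),(0,f,0),(0,0,g)).
  assert (e = 1 \/ e = -1) as [-> | ->] by lia; assert (f = 1 \/ f = -1) as [-> | ->] by lia;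
    assert (g = 1 \/ g = -1) as [-> | ->] by lia; split; try (unfold det3; lia); intros [[? ?] ?]; unfold qf; simpl; ring. }
(* Sign changes of the basis preserve the sign of [r s t]. If it is positive, all three can be made
   positive, and otherwise all three nonpositive. *)
assert (R : exists e f g, Z.abs e = 1 /\ Z.abs f = 1 /\ Z.abs g = 1 /\
  (0 < f*g*r /\ 0 < e*g*s /\ 0 < e*f*t \/ f*g*r <= 0 /\ e*g*s <= 0 /\ e*f*t <= 0)).
{ destruct (Z.lt_trichotomy r 0) as [?|[?|?]], (Z.lt_trichotomy s 0) as [?|[?|?]], (Z.lt_trichotomy t 0) as [?|[?|?]];
    ((exists 1, 1, 1; lia) || (exists (-1), 1, 1; lia) || (exists 1, (-1), 1; lia) || (exists 1, 1, (-1); lia)). }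
destruct R as (e & f & g & He & Hf & Hg & R).
destruct H as (H1 & H2 & H3 & H4 & H5 & H6 & H7); destruct O as [O1 O2]; unfold le2 in *.
assert (A1 : Z.abs (f*g*r) = Z.abs r) by (rewrite !Z.abs_mul, Hf, Hg; lia).
assert (A2 : Z.abs (e*g*s) = Z.abs s) by (rewrite !Z.abs_mul, He, Hg; lia).
assert (A3 : Z.abs (e*f*t) = Z.abs t) by (rewrite !Z.abs_mul, He, Hf; lia).
assert (E1 : g * g = 1) by (clear - Hg; assert (g = 1 \/ g = -1) as [-> | ->] by lia; reflexivity).
destruct (H7 (e*g) (f*g)) as [H8 _]; [now rewrite Z.abs_mul, ?He, ?Hf, Hg..|].
replace (2 * (e * g) * (f * g) * t) with (2 * (e * f * t) * (g * g)) in H8 by ring; rewrite E1 in H8.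
replace (2 * (e * g) * s) with (2 * (e * g * s)) in H8 by ring.
replace (2 * (f * g) * r) with (2 * (f * g * r)) in H8 by ring.
specialize (S e f g He Hf Hg); clear H7 E1 He Hf Hg P.
set (r' := f*g*r) in *; set (s' := e*g*s) in *; set (t' := e*f*t) in *; clearbody r' s' t'; clear e f g.
destruct R as [R|R]; [exists true|exists false]; exists [a;b;c;r';s';t']; (split; [exact S|]);
  unfold reduced, pos_if, sgn; repeat split; try easy; lia.
Qed.

(** Descent on the sum of the diagonal coefficients, which stays a positive integer; once it cannot
    be lowered, a permutation and sign changes of the basis suffice. *)
Theorem reduction l : length l = 6%nat -> posdef l -> exists e l', isom l' l /\ reduced e l'.
Proof.
intros Hl P; remember (Z.to_nat (trace3 l)) as n eqn:Hn.
assert (Hn' : (Z.to_nat (trace3 l) <= n)%nat) by lia; clear Hn.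
revert l Hl P Hn'; induction n as [|n IH]; intros l Hl P Hn.
all: assert (Pt : 0 < trace3 l) by (destruct l as [|a [|b [|c [|r [|s [|t [|]]]]]]]; try easy;
  pose proof (P (1,0,0) eq_refl) as P1; pose proof (P (0,1,0) eq_refl) as P2; pose proof (P (0,0,1) eq_refl) as P3;
  unfold qf in *; simpl in *; unfold trace3; simpl; lia).
- lia.
- destruct (near_or_smaller l Hl) as [N|(l' & I & L & T)].
  + destruct (near_ordered l N) as (l' & I & N' & O).
    destruct (ordered_reduced l' N' O (isom_posdef _ _ I P)) as (e & l'' & I' & R).
    exists e, l''; split; auto; now apply isom_trans with l'.
  + destruct (IH l' L (isom_posdef _ _ I P)) as (e & l'' & I' & R); [lia|].
    exists e, l''; split; auto; now apply isom_trans with l'.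
Qed.

(** * The computation, and the theorem on ternary forms *)

Lemma search_tt : explore true true 40 (root true true) nil (false, false) = true.
Proof. vm_cast_no_check (eq_refl true). Qed.
Lemma search_ff : explore false false 40 (root false false) nil (false, false) = true.
Proof. vm_cast_no_check (eq_refl true). Qed.
Lemma search_tf : explore true false 40 (root true false) nil (false, false) = true.
Proof. vm_cast_no_check (eq_refl true). Qed.

Lemma root_sat bf bg p q : reduced bf p -> reduced bg q -> (eqb bf bg = true -> nth 2 p 0 <= nth 2 q 0) ->
  wf (root bf bg) /\ sat (root bf bg) (p ++ q).
Proof.
intros Hp Hq Hc; split; [split; destruct bf, bg; repeat constructor|].
destruct p as [|a [|b [|c [|r [|s [|t [|]]]]]]]; try easy; destruct q as [|a' [|b' [|c' [|r' [|s' [|t' [|]]]]]]]; try easy.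
simpl in Hc.
exists [a; b; c; sgn bf * r; sgn bf * s; sgn bf * t; a'; b'; c'; sgn bg * r'; sgn bg * s'; sgn bg * t'], 1, 1.
destruct Hp as (P1 & P2 & P3 & P4 & P5 & P6 & P7 & P8 & P9 & P10 & P11).
destruct Hq as (Q1 & Q2 & Q3 & Q4 & Q5 & Q6 & Q7 & Q8 & Q9 & Q10 & Q11).
split; [easy|split; [easy|split; [split|]]].
- repeat (constructor; [first [assumption | unfold pos_if; split; intros; lia]|]); constructor.
- destruct bf, bg; simpl in *; unfold pos_if in *; repeat (constructor; [split; [simpl; lia|easy]|]); constructor.
- destruct bf, bg; unfold root, unitrow; simpl; repeat (constructor; [simpl; lia|]); constructor.
Qed.

Theorem ternary_theta p q : length p = 6%nat -> length q = 6%nat -> posdef p -> posdef q ->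
  equi (qf p) nonzero (qf q) nonzero -> isom p q.
Proof.
intros Lp Lq Pp Pq E.
destruct (reduction p Lp Pp) as (bf & p' & Ip & Rp), (reduction q Lq Pq) as (bg & q' & Iq & Rq).
apply isom_trans with p'; [now apply isom_sym|]; apply isom_trans with q'; auto.
assert (E' : equi (qf p') nonzero (qf q') nonzero).
{ apply isom_equi with p; auto; apply equi_sym, isom_equi with q; auto; now apply equi_sym. }
pose proof (isom_posdef _ _ Ip Pp) as Pp'; pose proof (isom_posdef _ _ Iq Pq) as Pq'.
clear - Rp Rq E' Pp' Pq'.
assert (K : forall bf bg p q, explore bf bg 40 (root bf bg) nil (false, false) = true -> reduced bf p -> reduced bg q ->
  (eqb bf bg = true -> nth 2 p 0 <= nth 2 q 0) -> posdef p -> posdef q -> equi (qf p) nonzero (qf q) nonzero -> isom p q).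
{ intros b1 b2 x y HE R1 R2 H P1 P2 H12; destruct (root_sat b1 b2 x y R1 R2 H) as [W S].
  apply (explore_sound b1 b2 x y R1 R2 P1 P2 H12 _ _ _ _ HE W S); [repeat split; constructor|now right]. }
assert (E'' := equi_sym _ _ _ _ E').
(* For equal signs the forms are exchanged, if necessary, to make the third coefficient of the first
   one not larger; for different signs only one order has been searched. *)
destruct bf, bg.
- destruct (Z_le_gt_dec (nth 2 p' 0) (nth 2 q' 0)).
  + exact (K _ _ _ _ search_tt Rp Rq (fun _ => l) Pp' Pq' E').
  + apply isom_sym; refine (K _ _ _ _ search_tt Rq Rp (fun _ => _) Pq' Pp' E''); lia.
- exact (K _ _ _ _ search_tf Rp Rq ltac:(easy) Pp' Pq' E').
- apply isom_sym; exact (K _ _ _ _ search_tf Rq Rp ltac:(easy) Pq' Pp' E'').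
- destruct (Z_le_gt_dec (nth 2 p' 0) (nth 2 q' 0)).
  + exact (K _ _ _ _ search_ff Rp Rq (fun _ => l) Pp' Pq' E').
  + apply isom_sym; refine (K _ _ _ _ search_ff Rq Rp (fun _ => _) Pq' Pp' E''); lia.
Qed.

End Ternary.

Require Import Defs.
From HB Require Import structures.
From mathcomp Require Import all_boot all_order all_algebra all_field.
From mathcomp Require Import finmap boolp classical_sets functions reals complex.
From mathcomp Require Import topology normedtype sequences exp trigo.
From mathcomp.analysis.showcase Require Import summability.
From mathcomp Require Import ring lra zify ssrZ.

Set Implicit Arguments.
Unset Strict Implicit.
Unset Printing Implicit Defensive.

Import Order.TTheory GRing.Theory Num.Theory.
Import numFieldNormedType.Exports.

Local Open Scope ring_scope.

(** * Real embeddings and traces *)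

Notation "p ^F" := (map_poly (in_alg _) p) (at level 2, format "p ^F").

(* A primitive element [x] may be sent to any [r] satisfying the rational relations of [x]. *)
Lemma rmorphism_of_root (F : fieldExtType rat) (S : fieldType) (e : {rmorphism rat -> S}) (x : F) (r : S) :
  (forall y : F, exists p : {poly rat}, y = p^F.[x]) ->
  (forall p : {poly rat}, p^F.[x] = 0 -> (map_poly e p).[r] = 0) ->
  exists f : {rmorphism F -> S}, f x = r.
Proof.
move=> gen rel; have [P PE] := choice gen.
pose f y := (map_poly e (P y)).[r].
have fE p : f p^F.[x] = (map_poly e p).[r].
  apply/eqP; rewrite -subr_eq0 /f -hornerN -hornerD -rmorphB; apply/eqP/rel.
  by rewrite rmorphB hornerD hornerN -PE subrr.
have fB : zmod_morphism f.
  by move=> y z; rewrite {1}(PE y) {1}(PE z) -hornerN -hornerD -rmorphB fE rmorphB hornerD hornerN.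
have fM : monoid_morphism f.
  split; last by move=> y z; rewrite {1}(PE y) {1}(PE z) -hornerM -rmorphM fE rmorphM hornerM.
  by rewrite (_ : 1 = (1 : {poly rat})^F.[x]) ?fE ?rmorph1 ?hornerC.
pose fA := GRing.isZmodMorphism.Build F S f fB.
pose fU := GRing.isMonoidMorphism.Build F S f fM.
pose g : {rmorphism F -> S} := HB.pack f fA fU.
exists g; rewrite /= (_ : x = ('X : {poly rat})^F.[x]) ?map_polyX ?hornerX //.
by have := fE 'X; rewrite !map_polyX !hornerX.
Qed.

Section Embeddings.
Variables (R : realType) (F : fieldExtType rat).
Local Notation n := (\dim {:F}).

Lemma primitive_root : exists (x : F) (m : {poly rat}), [/\ m \is monic, size m = n.+1, separable_poly m,
  (forall y : F, exists2 p : {poly rat}, (size p <= n)%N & y = p^F.[x]) &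
  (forall p : {poly rat}, p^F.[x] = 0 -> m %| p)].
Proof.
have ch0 : has_char0 F by move=> p; rewrite pchar_lalg; exact: pchar_num.
pose x := separable_generator 1%AS {:F}%AS.
have Fx : {:F}%VS = <<1; x>>%VS.
  by apply: (@eq_adjoin_separable_generator _ _ {:F}%AS 1%AS); rewrite ?sub1v //; apply/separableP => y _; exact: pcharf0_separable.
have deg : adjoin_degree 1 x = n by rewrite [in RHS]Fx dim_Fadjoin dimv1 muln1.
have /polyOver1P[m mE] := minPolyOver 1%AS x.
exists x, m; split.
- by rewrite -(map_monic (in_alg F)) -mE monic_minPoly.
- by rewrite -(size_map_poly (in_alg F)) -mE size_minPoly deg.
- by rewrite -(separable_map (in_alg F)) -mE; have := pcharf0_separable 1%AS ch0 x.
- move=> y; have /polyOver1P[p pE] := Fadjoin_polyOver 1%AS x y.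
  exists p; last by rewrite -pE (@Fadjoin_poly_eq _ _ 1%AS) // -Fx memvf.
  by rewrite -(size_map_poly (in_alg F)) -pE -deg size_Fadjoin_poly.
- move=> p px; rewrite -(dvdp_map (in_alg F)) -mE minPoly_dvdp //.
    by apply/polyOver1P; exists p.
  by rewrite /root px.
Qed.

(** The minimal polynomial of a primitive element has [n] distinct roots in [R[i]]. Each gives an
    embedding into [R[i]], which takes real values by hypothesis and is replaced by its real
    part. *)
Lemma real_embeddings : totally_real R F -> exists (s : 'I_n -> {rmorphism F -> R}) (x : F),
  injective (s^~ x) /\ (forall y : F, exists2 p : {poly rat}, (size p <= n)%N & y = p^F.[x]).
Proof.
move=> rF; have [x [m [mm sm sepm gen rel]]] := primitive_root.
have [r rE] := closed_field_poly_normal (map_poly (ratr : rat -> R[i]) m).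
have lm : lead_coef (map_poly (ratr : rat -> R[i]) m) = 1 by rewrite lead_coef_map (monicP mm) rmorph1.
rewrite lm scale1r in rE.
have szr : size r = n by apply: succn_inj; rewrite -(size_prod_XsubC _ id) -rE size_map_poly.
have ur : uniq r by rewrite -separable_prod_XsubC -rE separable_map.
have cx i : (i < n)%N -> exists f : {rmorphism F -> R}, ((f x)%:C)%C = r`_i.
  move=> ltin; have ri : root (map_poly (ratr : rat -> R[i]) m) r`_i by rewrite rE root_prod_XsubC mem_nth ?szr.
  have [f fx] : exists f : {rmorphism F -> R[i]}, f x = r`_i.
    apply: (@rmorphism_of_root F R[i] (ratr : {rmorphism rat -> R[i]})) => [y|p /rel/dvdpP[q ->]].
      by have [p _ ->] := gen y; exists p.
    by rewrite rmorphM hornerM (rootP ri) mulr0.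
  have fE y : f y = ((complex.Re (f y))%:C)%C by have := rF f y; case: (f y) => a b /= ->.
  pose g y := complex.Re (f y).
  have gB : zmod_morphism g by move=> y z; rewrite /g rmorphB; case: (f y) (f z) => ? ? [].
  have gM : monoid_morphism g.
    by split => [|y z]; rewrite /g ?rmorph1 // rmorphM (fE y) (fE z) /=; rewrite !mul0r subr0.
  pose gA := GRing.isZmodMorphism.Build F R g gB.
  pose gU := GRing.isMonoidMorphism.Build F R g gM.
  pose h : {rmorphism F -> R} := HB.pack g gA gU.
  by exists h; rewrite /= -fx -fE.
have /choice[s sE] : forall i : 'I_n, exists f : {rmorphism F -> R}, ((f x)%:C)%C = r`_i by move=> i; exact: cx.
exists s, x; split; last exact: gen.
move=> i j ij; apply/val_inj/eqP; rewrite -(nth_uniq 0 _ _ ur) ?szr ?(ltn_ord i) ?(ltn_ord j) //.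
by apply/eqP; rewrite -!sE /= ij.
Qed.
End Embeddings.

Lemma unitmx_ker (K : fieldType) n (A : 'M[K]_n) : (forall v : 'rV_n, v *m A = 0 -> v = 0) -> A \in unitmx.
Proof.
move=> H; rewrite -row_free_unit -kermx_eq0; apply/eqP/row_matrixP => i; rewrite row0.
by apply: H; rewrite -row_mul mulmx_ker row0.
Qed.

Lemma det_Vandermonde_neq0 (K : fieldType) n (a : 'I_n -> K) : injective a -> \det (Vandermonde n (\row_i a i)) != 0.
Proof.
move=> inj; rewrite det_Vandermonde; apply/prodf_neq0 => i _; apply/prodf_neq0 => j ij.
by rewrite !mxE subr_eq0; apply: contraTneq ij => /inj ->; rewrite ltnn.
Qed.

Section Trace.
Variables (R : realType) (F : fieldExtType rat).
Local Notation n := (\dim {:F}).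
Variables (s : 'I_n -> {rmorphism F -> R}) (x : F).
Hypothesis inj : injective (s^~ x).

Definition conjmx m (b : 'I_m -> F) : 'M[R]_(n, m) := \matrix_(i, j) s i (b j).

(** Dedekind's independence of embeddings, read off from the Vandermonde determinant of the
    conjugates of [x]. *)
Lemma embeddings_indep (v : 'rV[R]_n) : (forall z, \sum_i v 0 i * s i z = 0) -> v = 0.
Proof.
move=> H; have V : (Vandermonde n (\row_i s i x))^T \in unitmx by rewrite unitmx_tr unitmxE unitfE; exact: det_Vandermonde_neq0.
rewrite -(mulmxK V v) (_ : v *m _ = 0) ?mul0mx //; apply/rowP => k; rewrite !mxE -[RHS](H (x ^+ k)).
by apply: eq_bigr => i _; rewrite !mxE rmorphXn.
Qed.

Lemma conjmx_unit (b : 'I_n -> F) : (forall z, exists q : 'I_n -> rat, z = \sum_j q j *: b j) -> conjmx b \in unitmx.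
Proof.
move=> span; apply: unitmx_ker => v Hv; apply: embeddings_indep => z.
have [q ->] := span z.
under eq_bigr do rewrite raddf_sum mulr_sumr.
rewrite exchange_big /= big1 // => j _.
under eq_bigr do rewrite rmorphZ_num mulrCA.
rewrite -mulr_sumr; have /matrixP/(_ 0 j) := Hv; rewrite !mxE => e.
by rewrite (_ : \sum_i _ = 0) ?mulr0 // -[RHS]e; apply: eq_bigr => i _; rewrite !mxE.
Qed.

(** The matrix of conjugates of the basis diagonalizes multiplication by [y], with the conjugates of
    [y] on the diagonal. *)
Lemma trace_mx (b : 'I_n -> F) (A : 'M[rat]_n) y :
  (forall z, exists q : 'I_n -> rat, z = \sum_j q j *: b j) ->
  (forall j, y * b j = \sum_k A j k *: b k) -> ratr (\tr A) = \sum_i s i y :> R.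
Proof.
move=> span yb; have W := conjmx_unit span.
have e : conjmx b *m (map_mx ratr A)^T = diag_mx (\row_i s i y) *m conjmx b.
  apply/matrixP => i j; rewrite mul_diag_mx !mxE -rmorphM yb raddf_sum /=.
  by apply: eq_bigr => k _; rewrite !mxE rmorphZ_num mulrC.
have : \tr (map_mx ratr A)^T = \tr (diag_mx (\row_i s i y)) :> R.
  by rewrite -[in LHS](mulKmx W (map_mx ratr A)^T) e mxtrace_mulC mulmxK.
rewrite mxtrace_tr mxtrace_diag => h.
transitivity (\sum_i (\row_j s j y) 0 i : R); last by apply: eq_bigr => i _; rewrite mxE.
by rewrite -h /mxtrace raddf_sum; apply: eq_bigr => i _; rewrite mxE.
Qed.

Lemma trace_embeddings y : ratr (field_trace y) = \sum_i s i y :> R.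
Proof.
have bb := vbasisP {:F}.
apply: (@trace_mx (fun i => (vbasis {:F})`_i)).
  by move=> z; exists (fun i => coord (vbasis {:F}) i z); rewrite [LHS](coord_vbasis (memvf z)).
move=> j; have := passmx.mul_mxof (vbasis {:F}) (vbasis {:F}) (amull y) 'e_j.
rewrite passmx.vecof_delta -rowE => /(congr1 (passmx.vecof (vbasis {:F}))); rewrite passmx.rVofK // lfunE /= => <-.
by rewrite /passmx.vecof; apply: eq_bigr => k _; rewrite !mxE.
Qed.
End Trace.

(** * Lattices of integers with the same trace form *)

(** Both embeddings have the same image, the rational span of the common values, so [t^-1 s] is an
    isomorphism. *)
Lemma isomorphism_of_values (S : fieldType) (K L : fieldExtType rat) (s : {rmorphism K -> S}) (t : {rmorphism L -> S})
    m (b : 'I_m -> K) (c : 'I_m -> L) :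
  (forall z, exists q : 'I_m -> rat, z = \sum_j q j *: b j) ->
  (forall z, exists q : 'I_m -> rat, z = \sum_j q j *: c j) ->
  (forall j, t (c j) = s (b j)) -> exists f : {rmorphism K -> L}, bijective f.
Proof.
move=> bs cs e.
have /choice[f fE] : forall x, exists y, t y = s x.
  move=> x; have [q ->] := bs x; exists (\sum_j q j *: c j).
  by rewrite !rmorph_sum; apply: eq_bigr => j _ /=; rewrite !rmorphZ_num e.
have /choice[g gE] : forall x, exists y, s y = t x.
  move=> x; have [q ->] := cs x; exists (\sum_j q j *: b j).
  by rewrite !rmorph_sum; apply: eq_bigr => j _ /=; rewrite !rmorphZ_num e.
have fB : zmod_morphism f by move=> x y; apply: (fmorph_inj t); rewrite rmorphB !fE rmorphB.
have fM : monoid_morphism f.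
  by split => [|x y]; apply: (fmorph_inj t); rewrite ?rmorph1 ?rmorphM !fE ?rmorph1 ?rmorphM.
pose fA := GRing.isZmodMorphism.Build K L f fB.
pose fU := GRing.isMonoidMorphism.Build K L f fM.
pose h : {rmorphism K -> L} := HB.pack f fA fU.
exists h; exists g => x; first by apply: (fmorph_inj s); rewrite gE fE.
by apply: (fmorph_inj t); rewrite fE gE.
Qed.

(** * Algebraic integers *)

Section Integral.
Variable S : numFieldType.
Notation integral x := (integralOver (intr : int -> S) x).

Lemma integralD (x y : S) : integral x -> integral y -> integral (x + y).
Proof. exact: (@integral_add _ _ (intr : {rmorphism int -> S})). Qed.
Lemma integralM (x y : S) : integral x -> integral y -> integral (x * y).
Proof. exact: (@integral_mul _ _ (intr : {rmorphism int -> S})). Qed.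
Lemma integralz (z : int) : integral (z%:~R : S).
Proof. exact: (@integral_id _ _ (intr : {rmorphism int -> S})). Qed.
Lemma integral_sum (I : finType) (x : I -> S) : (forall i, integral (x i)) -> integral (\sum_i x i).
Proof.
move=> H; elim/big_ind: _ => //; last by move=> *; exact: integralD.
exact: (@integral0 _ _ (intr : {rmorphism int -> S})).
Qed.
Lemma integralX (x : S) k : integral x -> integral (x ^+ k).
Proof.
move=> H; elim: k => [|k IH]; last by rewrite exprS; exact: integralM.
exact: (@integral1 _ _ (intr : {rmorphism int -> S})).
Qed.
Lemma integral_sqr (x : S) : integral (x ^+ 2) -> integral x.
Proof.
move=> [p pm pr]; exists (p \Po 'X^2).
  apply/monicP; have p0 : p != 0 by exact: monic_neq0.
  by rewrite lead_coef_comp ?size_polyXn // (monicP pm) lead_coefXn expr1n mulr1.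
by rewrite map_comp_poly map_polyXn /root horner_comp hornerXn.
Qed.
Lemma integral_emb (F : fieldExtType rat) (s : {rmorphism F -> S}) x : ring_of_integers F x -> integral (s x).
Proof.
move=> [p pm /(rmorph_root s)]; rewrite -map_poly_comp => pr; exists p => //.
by congr (root _ _): pr; apply: eq_map_poly => z /=; rewrite rmorph_int.
Qed.
End Integral.

Lemma integral_rat (S : numFieldType) (q : rat) : integralOver (intr : int -> S) (ratr q) -> exists z : int, q = z%:~R.
Proof.
move=> [p pm pr]; apply/intrP; rewrite -Cint_rat; apply: Cint_rat_Aint; first exact: Crat_rat.
have mapE (K : numFieldType) : map_poly (intr : int -> K) p = map_poly ratr (map_poly (intr : int -> rat) p).
  by rewrite -map_poly_comp; apply: eq_map_poly => z /=; rewrite ratr_int.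
apply: (@root_monic_Aint (map_poly intr p)).
- rewrite mapE fmorph_root; by rewrite mapE fmorph_root in pr.
- exact: monic_map.
- by apply/polyOverP => i; rewrite coef_map /= intr_int.
Qed.

(** * Radicals of trace forms modulo a prime *)

Lemma prime_dvdzM (p : nat) (x y : int) : prime p -> (p%:Z %| x * y)%Z -> (p%:Z %| x)%Z \/ (p%:Z %| y)%Z.
Proof. by move=> pp; rewrite !dvdzE abszM /= Euclid_dvdM // => /orP. Qed.

Lemma dvdz_sumr (I : finType) (p : int) (f : I -> int) : (forall i, (p %| f i)%Z) -> (p %| \sum_i f i)%Z.
Proof. by move=> H; elim/big_ind: _ => // x y; exact: rpredD. Qed.

(* The kernel of a matrix modulo [p] has dimension at most one when some cofactor is not divisible by [p] *)
Lemma kernel_coord n (T : 'M[int]_n) (p : nat) (r s : 'I_n) (v : 'I_n -> int) : prime p ->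
  ~ (p%:Z %| \adj T r s)%Z -> (forall i, (p%:Z %| \sum_j T i j * v j)%Z) -> (p%:Z %| v r)%Z ->
  forall j, (p%:Z %| v j)%Z.
Proof.
move=> pp Ars Tv vr j.
(* Row [s] is replaced by the condition that coordinate [r] vanishes. The determinant becomes the
   given cofactor, so the new matrix is invertible modulo [p]. *)
pose T' := \matrix_(i, k) (if i == s then (k == r)%:R else T i k).
have T'v i : (p%:Z %| \sum_k T' i k * v k)%Z.
  have [->|/negbTE is_] := eqVneq i s.
    rewrite (bigD1 r) //= mxE !eqxx mul1r big1 ?addr0 // => k /negbTE kr.
    by rewrite mxE eqxx kr mul0r.
  by under eq_bigr do rewrite mxE is_; exact: Tv.
have dT' : \det T' = \adj T r s.
  rewrite (expand_det_row _ s) (bigD1 r) //= big1 => [|k /negbTE kr]; last by rewrite !mxE eqxx kr mul0r.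
  rewrite !mxE !eqxx mul1r addr0 /cofactor; congr (_ * \det _).
  by apply/matrixP => x y; rewrite !mxE eq_sym (negbTE (neq_lift _ _)).
suff H : (p%:Z %| \adj T r s * v j)%Z by case: (prime_dvdzM pp H).
have <- : (\adj T' *m (T' *m \col_k v k)) j 0 = \adj T r s * v j.
  by rewrite mulmxA mul_adj_mx mul_scalar_mx dT' !mxE.
rewrite mxE; apply: dvdz_sumr => k; rewrite dvdz_mull // mxE; under eq_bigr do rewrite [(\col_k v k) _ _]mxE.
exact: T'v.
Qed.

(** The combination [w_r v - v_r w] is in the kernel modulo [p], and its coordinate at [r]
    vanishes. *)
Lemma kernel_proportional n (T : 'M[int]_n) (p : nat) (r s : 'I_n) (v w : 'I_n -> int) : prime p ->
  ~ (p%:Z %| \adj T r s)%Z -> (forall i, (p%:Z %| \sum_j T i j * v j)%Z) -> (forall i, (p%:Z %| \sum_j T i j * w j)%Z) ->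
  forall j, (p%:Z %| w r * v j - v r * w j)%Z.
Proof.
move=> pp Ars Tv Tw; apply: (kernel_coord pp Ars) => [i|]; last by rewrite mulrC subrr dvdz0.
under eq_bigr do rewrite mulrBr !(mulrCA (T i _)).
by rewrite sumrB -!mulr_sumr rpredB // dvdz_mull.
Qed.

Definition zspan (F : fieldExtType rat) n (b : 'I_n -> F) : Prop :=
  (forall j, ring_of_integers F (b j)) /\
  (forall x, ring_of_integers F x -> exists v : 'I_n -> int, x = \sum_j b j *~ v j).

Lemma ring_of_integersM (F : fieldExtType rat) (x y : F) :
  ring_of_integers F x -> ring_of_integers F y -> ring_of_integers F (x * y).
Proof. exact: (@integral_mul _ _ (intr : {rmorphism int -> F})). Qed.

Section OneField.
Variables (R : realType) (F : fieldExtType rat) (n : nat) (s : 'I_n -> {rmorphism F -> R}).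
Hypothesis trE : forall y, ratr (field_trace y) = \sum_i s i y :> R.
Hypothesis trM : forall (b : 'I_n -> F) (A : 'M[rat]_n) y, (forall z, exists q : 'I_n -> rat, z = \sum_j q j *: b j) ->
  (forall j, y * b j = \sum_k A j k *: b k) -> \tr A = field_trace y.

Lemma trace_int (y : F) : ring_of_integers F y -> exists z : int, field_trace y = z%:~R.
Proof. by move=> yi; apply: (@integral_rat R); rewrite trE; apply: integral_sum => i; exact: integral_emb. Qed.

Lemma field_traceD (x y : F) : field_trace (x + y) = field_trace x + field_trace y.
Proof.
apply: (fmorph_inj (ratr : {rmorphism rat -> R})); rewrite rmorphD /= !trE -big_split /=.
by apply: eq_bigr => i _; rewrite rmorphD.
Qed.
Lemma field_traceZ (q : rat) (x : F) : field_trace (q *: x) = q * field_trace x.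
Proof.
apply: (fmorph_inj (ratr : {rmorphism rat -> R})); rewrite rmorphM /= !trE mulr_sumr.
by apply: eq_bigr => i _; rewrite rmorphZ_num.
Qed.
Lemma scaler_int_intr (x : F) (z : int) : x *~ z = (z%:~R : rat) *: x.
Proof. by rewrite scaler_int. Qed.
Lemma field_trace_sum (I : finType) (x : I -> F) (v : I -> int) :
  field_trace (\sum_i x i *~ v i) = \sum_i (v i)%:~R * field_trace (x i).
Proof.
elim/big_ind2: _ => [|x1 x2 y1 y2 <- <-|i _]; last by rewrite scaler_int_intr field_traceZ.
  by rewrite -(scale0r 0) field_traceZ mul0r.
by rewrite field_traceD.
Qed.

Variables (b : 'I_n -> F) (T : 'M[int]_n).
Hypothesis bZ : zspan b.
Hypothesis bT : forall i j, field_trace (b i * b j) = (T i j)%:~R.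
Hypothesis dT : \det T != 0.
Variable i0 : 'I_n.

Definition cmx : 'M[R]_n := \matrix_(i, j) s i (b j).

Lemma cmx_gram : cmx^T *m cmx = map_mx intr T.
Proof.
apply/matrixP => i j; rewrite !mxE -(ratr_int R) -bT trE.
by apply: eq_bigr => k _; rewrite !mxE rmorphM.
Qed.

Lemma gram_unit (S : numFieldType) : (map_mx intr T : 'M[S]_n) \in unitmx.
Proof. by rewrite unitmxE det_map_mx unitfE intr_eq0. Qed.

Lemma cmx_unit : cmx \in unitmx.
Proof. by have := gram_unit R; rewrite -cmx_gram unitmx_mul => /andP[]. Qed.

(** The inverse Gram matrix gives a combination with the same traces against all [b i]. The
    difference is orthogonal to every [b i], so its conjugates vanish because [cmx] is
    invertible. *)
Lemma zspan_span z : exists q : 'I_n -> rat, z = \sum_j q j *: b j.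
Proof.
pose S : 'M[rat]_n := invmx (map_mx intr T); pose u : 'cV[rat]_n := \col_i field_trace (z * b i).
have [q qE] : exists q, map_mx intr T *m q = u by exists (S *m u); rewrite mulKVmx ?gram_unit.
exists (fun j => q j 0); apply/eqP; rewrite -subr_eq0; apply/eqP.
set y := z - _.
have y0 i : field_trace (y * b i) = 0.
  rewrite /y mulrBl -[X in _ - X]scale1r -scaleNr field_traceD field_traceZ mulr_suml.
  have -> : field_trace (\sum_j q j 0 *: b j * b i) = \sum_j q j 0 * field_trace (b j * b i).
    elim/big_ind2: _ => [|x1 x2 y1 y2 <- <-|j _]; last by rewrite -scalerAl field_traceZ.
      by rewrite -(scale0r 0) field_traceZ mul0r.
    by rewrite field_traceD.
  have /matrixP/(_ i 0) := qE; rewrite !mxE => <-.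
  apply/eqP; rewrite mulN1r subr_eq0; apply/eqP/eq_bigr => j _.
  by rewrite !mxE -bT mulrC [b i * _]mulrC.
have : \row_i s i y *m cmx = 0.
  apply/rowP => j; rewrite !mxE.
  transitivity (ratr (field_trace (y * b j)) : R); last by rewrite y0 rmorph0.
  by rewrite trE; apply: eq_bigr => i _; rewrite !mxE rmorphM.
move=> /(congr1 (mulmx^~ (invmx cmx))); rewrite mulmxK ?cmx_unit // mul0mx => /rowP/(_ i0).
by rewrite !mxE => /eqP; rewrite fmorph_eq0 => /eqP.
Qed.


Lemma zcomb_integral (v : 'I_n -> int) : ring_of_integers F (\sum_j b j *~ v j).
Proof.
elim/big_ind: _ => [|x y|j _]; first exact: (@integral0 _ _ (intr : {rmorphism int -> F})).
  exact: (@integral_add _ _ (intr : {rmorphism int -> F})).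
rewrite -mulrzr; apply: ring_of_integersM; first exact: bZ.1.
exact: (@integral_id _ _ (intr : {rmorphism int -> F})).
Qed.

Lemma trace_comb i (v : 'I_n -> int) : field_trace (b i * \sum_j b j *~ v j) = (\sum_j T i j * v j)%:~R.
Proof.
rewrite mulr_sumr; under eq_bigr do rewrite mulrzAr.
by rewrite field_trace_sum rmorph_sum; apply: eq_bigr => j _; rewrite bT -intrM mulrC.
Qed.

(** The radical modulo [p] is an ideal, here of dimension at most one, and [B] belongs to it. Hence
    multiplication by [B] has rank at most one modulo [p], so that [B^2 = Tr(B) B]; and [Tr(B)] is
    divisible by [p] because [B] is orthogonal to 1. *)
Lemma radical_square (p : nat) (r t : 'I_n) (v : 'I_n -> int) : prime p -> ~ (p%:Z %| \adj T r t)%Z ->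
  (forall i, (p%:Z %| \sum_j T i j * v j)%Z) ->
  exists2 g, ring_of_integers F g & (\sum_j b j *~ v j) ^+ 2 = g *~ p.
Proof.
move=> pp Art Tv; have dv := kernel_proportional pp Art; have dv0 := kernel_coord pp Art.
set B := \sum_j b j *~ v j; have Bi : ring_of_integers F B by exact: zcomb_integral.
have bi := bZ.1.
have /choice[M ME] : forall k, exists m : 'I_n -> int, B * b k = \sum_j b j *~ m j.
  by move=> k; apply: bZ.2; exact: ring_of_integersM.
have trB y : ring_of_integers F y -> exists z : int, field_trace (B * y) = (z * p)%:~R.
  move=> /bZ.2[g ->]; rewrite mulr_sumr; under eq_bigr do rewrite mulrzAr.
  rewrite field_trace_sum; under eq_bigr do rewrite mulrC mulrC [B * _]mulrC trace_comb -intrM.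
  rewrite -rmorph_sum; have /dvdzP[z ->] : (p%:Z %| \sum_i g i * \sum_j T i j * v j)%Z; last by exists z.
  by apply: dvdz_sumr => i; rewrite dvdz_mull.
have TM k i : (p%:Z %| \sum_j T i j * M k j)%Z.
  have [z zE] := trB _ (ring_of_integersM (bi i) (bi k)).
  suff -> : \sum_j T i j * M k j = z * p by rewrite dvdz_mull.
  by apply: (@intr_inj rat); rewrite -trace_comb -ME -zE; congr field_trace; ring.
pose s_ j := \sum_k v k * M k j.
have Ts i : (p%:Z %| \sum_j T i j * s_ j)%Z.
  under eq_bigr do rewrite mulr_sumr; rewrite exchange_big; apply: dvdz_sumr => k.
  by under eq_bigr do rewrite mulrCA; rewrite -mulr_sumr dvdz_mull.
have BB : B ^+ 2 = \sum_j b j *~ s_ j.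
  rewrite expr2 {2}/B mulr_sumr; under eq_bigr do rewrite mulrzAr ME mulrz_suml.
  rewrite exchange_big /=; apply: eq_bigr => j _; rewrite /s_ mulrz_sumr; apply: eq_bigr => k _.
  by rewrite -mulrzA mulrC.
have sr : (p%:Z %| s_ r)%Z.
  have [z zE] := trB 1 (@integral1 _ _ (intr : {rmorphism int -> F})).
  have trM' : \sum_k M k k = z * p.
    apply: (@intr_inj rat); rewrite -zE mulr1 -(@trM b (map_mx intr (\matrix_(i, j) M i j))).
    - by rewrite /mxtrace rmorph_sum; apply: eq_bigr => k _; rewrite !mxE.
    - exact: zspan_span.
    - by move=> j; rewrite ME; apply: eq_bigr => k _; rewrite !mxE scaler_int_intr.
  (* The coordinate at [r] of [B^2 = Tr(B) B] modulo [p]: the terms of the sum are divisible by [p]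
     because row [k] of [M] is proportional to [v]. *)
  have -> : s_ r = \sum_k (M k r * v k - v r * M k k) + v r * (z * p).
    by rewrite -trM' mulr_sumr -big_split; apply: eq_bigr => k _ /=; ring.
  rewrite rpredD ?mulrA ?dvdz_mull //; apply: dvdz_sumr => k; exact: dv.
have ds j : (p%:Z %| s_ j)%Z by exact: dv0.
exists (\sum_j b j *~ (s_ j %/ p)%Z); first exact: zcomb_integral.
rewrite BB mulrz_suml; apply: eq_bigr => j _; by rewrite -mulrzA divzK.
Qed.
End OneField.

Definition all_embeddings (R : realType) (F : fieldExtType rat) n (s : 'I_n -> {rmorphism F -> R}) : Prop :=
  (forall y, ratr (field_trace y) = \sum_i s i y :> R) /\
  (forall (b : 'I_n -> F) (A : 'M[rat]_n) y, (forall z, exists q : 'I_n -> rat, z = \sum_j q j *: b j) ->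
  (forall j, y * b j = \sum_k A j k *: b k) -> \tr A = field_trace y).

(** The coordinates [e] of 1 are recorded so that two fields with the same [T] and [e] are related
    by an isometry that fixes 1. *)
Definition gram_basis (F : fieldExtType rat) n (b : 'I_n -> F) (T : 'M[int]_n) (e : 'I_n -> int) : Prop :=
  [/\ zspan b, forall i j, field_trace (b i * b j) = (T i j)%:~R & 1 = \sum_j b j *~ e j].

Lemma cmx_det_sqr (R : realType) (F : fieldExtType rat) n (s : 'I_n -> {rmorphism F -> R}) (b : 'I_n -> F) T e :
  all_embeddings s -> gram_basis b T e -> \det (cmx s b) ^+ 2 = (\det T)%:~R.
Proof.
move=> sE [_ bT _]; have := cmx_gram sE.1 bT => /(congr1 determinant).
by rewrite det_mulmx det_tr det_map_mx -expr2.
Qed.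

(** * The orthogonal matrix between the conjugates of two fields *)

Section TwoFields.
Variables (R : realType) (K L : fieldExtType rat) (n : nat).
Variables (s : 'I_n -> {rmorphism K -> R}) (t : 'I_n -> {rmorphism L -> R}).
Hypothesis (sE : all_embeddings s) (tE : all_embeddings t).
Variables (b : 'I_n -> K) (c : 'I_n -> L) (T : 'M[int]_n) (e : 'I_n -> int) (i0 : 'I_n).
Hypothesis (bT : gram_basis b T e) (cT : gram_basis c T e).
Hypothesis dT : \det T != 0.
Notation TR := (map_mx intr T : 'M[R]_n).
Notation integral x := (integralOver (intr : int -> R) x).

(* [transport] sends the conjugates of [b j] to the conjugates of [c j], for all [j]. *)
Definition transport : 'M[R]_n := cmx t c *m invmx TR *m (cmx s b)^T.

Lemma cmx_s : (cmx s b)^T *m cmx s b = TR.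
Proof. by case: bT => _ bT' _; exact: cmx_gram sE.1 _ _ bT'. Qed.
Lemma cmx_t : (cmx t c)^T *m cmx t c = TR.
Proof. by case: cT => _ cT' _; exact: cmx_gram tE.1 _ _ cT'. Qed.
Lemma TR_unit : TR \in unitmx.
Proof. exact: gram_unit. Qed.

Lemma transport_basis : transport *m cmx s b = cmx t c.
Proof. by rewrite /transport -!mulmxA cmx_s mulVmx ?TR_unit // mulmx1. Qed.

Lemma transport_orthogonal : transport *m transport^T = 1%:M.
Proof.
have tu : cmx t c \in unitmx by have := TR_unit; rewrite -cmx_t unitmx_mul => /andP[].
have tu' : (cmx t c)^T \in unitmx by rewrite unitmx_tr.
rewrite {2}/transport !trmx_mul trmxK trmx_inv.
have -> : TR^T = TR by rewrite -cmx_t trmx_mul trmxK.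
rewrite !mulmxA transport_basis -cmx_t.
have -> : invmx ((cmx t c)^T *m cmx t c) = invmx (cmx t c) *m invmx ((cmx t c)^T).
  have u : (cmx t c)^T *m cmx t c \in unitmx by rewrite unitmx_mul tu tu'.
  apply: (can_inj (mulKmx u)); rewrite mulmxV // mulmxA -[_ *m _ *m invmx (cmx t c)]mulmxA.
  by rewrite mulmxV // mulmx1 mulmxV.
by rewrite mulmxA mulmxV // mul1mx mulVmx.
Qed.

(** The isometry fixes 1, whose conjugates are all 1. *)
Lemma transport_row j : \sum_i transport j i = 1.
Proof.
have gen (U : 'M[R]_n) : U *m const_mx 1 = const_mx 1 :> 'cV_n -> forall j, \sum_i U j i = 1.
  move=> H k; have /matrixP/(_ k 0) := H; rewrite !mxE => <-.
  by apply: eq_bigr => i _; rewrite mxE mulr1.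
have sum1 (F : fieldExtType rat) (u : 'I_n -> {rmorphism F -> R}) (x : 'I_n -> F) : 1 = \sum_k x k *~ e k ->
    cmx u x *m (\col_k (e k)%:~R) = const_mx 1.
  move=> x1; apply/matrixP => i ?; rewrite !mxE -[RHS](rmorph1 (u i)) x1 rmorph_sum.
  by apply: eq_bigr => k _; rewrite !mxE rmorphMz mulrzr.
have [[_ _ b1] [_ _ c1]] := (bT, cT).
have /gen/(_ j) // : transport *m const_mx 1 = const_mx 1 :> 'cV_n.
  by rewrite -[in LHS](sum1 _ s _ b1) mulmxA transport_basis (sum1 _ t _ c1).
Qed.

(** Writing [transport] with the inverse Gram matrix shows that [\det T] clears denominators: the
    conjugates are algebraic integers and the adjugate has integral entries. *)
Lemma transport_adj j i : (\det T)%:~R * transport j i = \sum_l \sum_k t j (c k) * (\adj T k l)%:~R * s i (b l).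
Proof.
have -> : (\det T)%:~R * transport j i = (cmx t c *m map_mx intr (\adj T) *m (cmx s b)^T) j i.
  rewrite map_mx_adj -(mulmxK TR_unit (\adj TR)) mul_adj_mx det_map_mx mul_scalar_mx.
  by rewrite -scalemxAr -scalemxAl [RHS]mxE.
rewrite !mxE; apply: eq_bigr => l _; rewrite !mxE mulr_suml; apply: eq_bigr => k _.
by rewrite !mxE.
Qed.

Definition denominator (N : int) := forall j i, integral (N%:~R * transport j i).

Lemma tc_integral j k : integral (t j (c k)).
Proof. by apply: integral_emb; case: cT => -[]. Qed.
Lemma sb_integral i k : integral (s i (b k)).
Proof. by apply: integral_emb; case: bT => -[]. Qed.

Lemma det_denominator : denominator (\det T).
Proof.
move=> j i; rewrite transport_adj; do 2![apply: integral_sum => ?].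
apply: integralM; last exact: sb_integral.
by apply: integralM; [exact: tc_integral|exact: integralz].
Qed.

Lemma T_sym : T^T = T.
Proof.
apply/matrixP => i j; rewrite mxE; apply: (@intr_inj rat); case: bT => _ bT' _.
by rewrite -!bT' mulrC.
Qed.

(** If some cofactor [\adj T r u] is prime to [p], the adjugate has rank one modulo [p]. After
    multiplication by this cofactor, the double sum of [transport_adj] divided by [p] is, up to an
    integral term, [s_i(B) t_j(C) / p], where [B] and [C] lie in the radicals. Its square is
    integral by [radical_square]. *)
Lemma prime_denominator (p : nat) : prime p -> (p%:Z %| \det T)%Z -> ~ ((p * p)%N%:Z %| \det T)%Z ->
  exists2 N, denominator N & ~ (p%:Z %| N)%Z.
Proof.
move=> pp /dvdzP[d dE] pd.
have p0 : p%:R != 0 :> R by rewrite pnatr_eq0 -lt0n prime_gt0.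
have pd' : ~ (p%:Z %| d)%Z by case/dvdzP => d' d'E; apply: pd; rewrite dE d'E -mulrA -PoszM dvdz_mull.
have dU N j i : (N * d)%:~R * transport j i = p%:R^-1 * (N%:~R * ((\det T)%:~R * transport j i)).
  by rewrite dE !intrM; field.
(* If all cofactors are divisible by [p], one factor [p] of the determinant cancels directly. *)
have [[r [u Aru]]|noA] := pselect (exists r u, ~ (p%:Z %| \adj T r u)%Z); last first.
  exists d => // j i; rewrite -[d]mul1r dU mul1r transport_adj mulr_sumr; apply: integral_sum => l.
  rewrite mulr_sumr; apply: integral_sum => k.
  have /dvdzP[q ->] : (p%:Z %| \adj T k l)%Z by apply: contrapT => H; apply: noA; exists k, l.
  have -> : p%:R^-1 * (t j (c k) * (q * p)%:~R * s i (b l)) = t j (c k) * q%:~R * s i (b l) by rewrite intrM; field.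
  apply: integralM; last exact: sb_integral.
  by apply: integralM; [exact: tc_integral|exact: integralz].
have TA l i : (p%:Z %| \sum_j T i j * \adj T j l)%Z.
  have /matrixP/(_ i l) := mul_mx_adj T; rewrite !mxE => ->.
  by rewrite dE -mulrnAl dvdz_mull.
have AT l i : (p%:Z %| \sum_j T i j * \adj T l j)%Z.
  have /matrixP/(_ l i) := mul_adj_mx T; rewrite mxE [RHS]mxE => h.
  have -> : \sum_j T i j * (\adj T) l j = (\det T) *+ (l == i).
    rewrite -h; apply: eq_bigr => j _; rewrite mulrC; congr (_ * _).
    by rewrite -{1}T_sym mxE.
  by rewrite dE -mulrnAl dvdz_mull.
exists (\adj T r u * d); last by case/(prime_dvdzM pp).
move=> j i; rewrite dU transport_adj.
have [[bz bT' b1] [cz cT' c1]] := (bT, cT).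
have [g gi gE] := radical_square sE.1 sE.2 bz bT' dT i0 pp Aru (AT r).
have [h hi hE] := radical_square tE.1 tE.2 cz cT' dT i0 pp Aru (TA u).
have pr := kernel_proportional pp Aru (TA _) (TA u).
pose q l k := ((\adj T r u * \adj T k l - \adj T r l * \adj T k u) %/ p%:Z)%Z.
have qE l k : \adj T r u * \adj T k l = q l k * p + \adj T r l * \adj T k u.
  by rewrite divzK ?subrK //; exact: pr.
set B := \sum_j _ in gE; set C := \sum_j _ in hE.
have -> : p%:R^-1 * ((\adj T r u)%:~R * \sum_l \sum_k t j (c k) * (\adj T k l)%:~R * s i (b l)) =
    p%:R^-1 * (s i B * t j C) + \sum_l \sum_k t j (c k) * (q l k)%:~R * s i (b l).
  have -> : s i B * t j C = \sum_l \sum_k (\adj T r l * \adj T k u)%:~R * (t j (c k) * s i (b l)).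
    rewrite /B /C !rmorph_sum mulr_suml; apply: eq_bigr => l _; rewrite mulr_sumr; apply: eq_bigr => k _ /=.
    rewrite (rmorphMz (s i)) (rmorphMz (t j)) /= intrM.
    rewrite -[s i _ *~ _]mulrzr -[t j _ *~ _]mulrzr.
    by move: (s i (b l)) (t j (c k)) ((\adj T r l)%:~R : R) ((\adj T k u)%:~R : R) => w x y z; ring.
  rewrite !mulr_sumr -big_split; apply: eq_bigr => l _; rewrite /= !mulr_sumr -big_split; apply: eq_bigr => k _ /=.
  have -> : p%:R^-1 * ((\adj T r u)%:~R * (t j (c k) * (\adj T k l)%:~R * s i (b l))) =
    p%:R^-1 * ((\adj T r u * \adj T k l)%:~R * (t j (c k) * s i (b l))).
    rewrite intrM; move: (s i (b l)) (t j (c k)) ((\adj T r u)%:~R : R) ((\adj T k l)%:~R : R) (p%:R : R) => w x y z p'.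
    by ring.
  rewrite qE intrD [(q l k * p)%:~R]intrM; move: (s i (b l)) (t j (c k)) ((q l k)%:~R : R) p0 => w x y p0.
  by move: ((_ * _)%:~R : R) => z; field.
apply: integralD; last first.
  do 2![apply: integral_sum => ?]; apply: integralM; last exact: sb_integral.
  by apply: integralM; [exact: tc_integral|exact: integralz].
apply: integral_sqr.
have -> : (p%:R^-1 * (s i B * t j C)) ^+ 2 = s i g * t j h.
  rewrite !exprMn -!rmorphXn gE hE (rmorphMz (s i)) (rmorphMz (t j)) -[s i _ *~ _]mulrzr -[t j _ *~ _]mulrzr.
  by move: (s i g) (t j h) p0 => x y p0; field.
by apply: integralM; exact: integral_emb.
Qed.

(** The denominators form an ideal of the integers containing [\det T]. A prime divisor of its
    generator would divide [\det T], and exactly once, and then some denominator is prime to it. *)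
Lemma transport_integral : squarefree (\det T) -> denominator 1.
Proof.
move=> sf.
have JB N M : denominator N -> denominator M -> forall k : int, denominator (N - k * M).
  move=> HN HM k j i.
  have -> : (N - k * M)%:~R * transport j i = N%:~R * transport j i + (- k)%:~R * (M%:~R * transport j i).
    by rewrite intrB intrM intrN; ring.
  by apply: integralD => //; apply: integralM => //; exact: integralz.
have ex : exists g : nat, (0 < g)%N && `[< denominator g >].
  exists `|\det T|%N; rewrite absz_gt0 dT; apply/asboolP.
  have -> : `|\det T|%N%:Z = \det T - (1 - Num.sg (\det T)) * \det T.
    by rewrite mulrBl mul1r opprB addrC subrK -normrEsg.
  by apply: JB; exact: det_denominator.
have [g /andP[g0 /asboolP Jg] gmin] := ex_minnP ex.
have dvg N : denominator N -> (g%:Z %| N)%Z.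
  move=> JN; have mE : (N %% g)%Z = N - (N %/ g)%Z * g by apply/eqP; rewrite eq_sym subr_eq addrC -divz_eq.
  have Jm : denominator (N %% g)%Z by rewrite mE; exact: JB.
  have gz : g%:Z != 0 by rewrite eqz_nat -lt0n.
  have := ltz_pmod N (g0 : 0 < g%:Z); have := modz_ge0 N gz.
  case E : (N %% g)%Z Jm => [[|m]|m] // Jm _ mg; first exact/dvdz_mod0P.
  by have := gmin m.+1; rewrite asboolT // => /(_ isT); rewrite leqNgt -ltz_nat mg.
have [g1|g1] := eqVneq g 1%N; first by rewrite g1 in Jg.
have pp : prime (pdiv g) by rewrite pdiv_prime // ltn_neqAle eq_sym g1.
have pg N : denominator N -> ((pdiv g)%:Z %| N)%Z by move/dvg; apply: dvdz_trans; rewrite dvdzE; exact: pdiv_dvd.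
have [||N JN []] := @prime_denominator (pdiv g) pp; last exact: pg.
  exact: pg det_denominator.
by rewrite PoszM -expr2 => /sf [H]; move: pp; rewrite H.
Qed.

(* [trace_form X]: the matrix [X] comes from an element of the tensor product of [L] and [K], so that
   the sum of its entries is a rational number. *)
Definition trace_form (X : 'I_n -> 'I_n -> R) : Prop :=
  exists2 w : seq (L * K), True & forall j i, X j i = \sum_(x <- w) t j x.1 * s i x.2.

Lemma trace_formM X Y : trace_form X -> trace_form Y -> trace_form (fun j i => X j i * Y j i).
Proof.
move=> [w _ wE] [v _ vE]; exists [seq (x.1 * y.1, x.2 * y.2) | x <- w, y <- v] => // j i.
rewrite wE vE big_allpairs_dep mulr_suml; apply: eq_bigr => x _; rewrite mulr_sumr; apply: eq_bigr => y _ /=.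
by rewrite !rmorphM mulrACA.
Qed.

Lemma trace_form_rational X : trace_form X -> exists q : rat, \sum_j \sum_i X j i = ratr q.
Proof.
move=> [w _ wE]; exists (\sum_(x <- w) field_trace x.1 * field_trace x.2).
under eq_bigr do under eq_bigr do rewrite wE.
under eq_bigr do rewrite exchange_big /=.
rewrite exchange_big rmorph_sum; apply: eq_bigr => x _ /=.
rewrite rmorphM /= sE.1 tE.1 mulr_suml; apply: eq_bigr => j _.
by rewrite mulr_sumr.
Qed.

Lemma transport_trace_form : trace_form transport.
Proof.
exists [seq (((\det T)%:~R^-1 * (\adj T x.1 x.2)%:~R : rat) *: c x.1, b x.2) | x <- enum {: 'I_n * 'I_n}] => // j i.
have d0 : (\det T)%:~R != 0 :> R by rewrite intr_eq0.
apply: (mulfI d0); rewrite transport_adj big_map big_enum exchange_big pair_big mulr_sumr.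
apply: eq_bigr => x _ /=; rewrite rmorphZ_num rmorphM fmorphV !rmorph_int.
by rewrite !mulrA mulfV // mul1r [t j _ * _]mulrC.
Qed.

(** The sum is rational, because entrywise powers still come from the tensor product of the fields,
    and it is integral because the entries are. *)
Lemma transport_power_sum k : squarefree (\det T) ->
  exists z : int, \sum_j \sum_i transport j i ^+ k = z%:~R.
Proof.
move=> sf; have [|q qE] := @trace_form_rational (fun j i => transport j i ^+ k).
  elim: k => [|k IH]; last first.
    by have [w _ wE] := trace_formM transport_trace_form IH; exists w => // j i; rewrite exprS wE.
  exists [seq x : L * K | x <- [:: (1, 1)]] => // j i.
  by rewrite big_seq1 /= !rmorph1 mulr1.
have [|z zE] := @integral_rat R q; last by exists z; rewrite qE zE ratr_int.
rewrite -qE; do 2![apply: integral_sum => ?]; apply: integralX.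
by have := transport_integral sf; rewrite /denominator => H; rewrite -[transport _ _]mul1r; exact: H.
Qed.

Lemma transport_entry j i : squarefree (\det T) -> transport j i ^+ 2 = transport j i ^+ 4.
Proof.
move=> sf.
have row1 j' : \sum_i' transport j' i' ^+ 2 = 1.
  have /matrixP/(_ j' j') := transport_orthogonal; rewrite [LHS]mxE [RHS]mxE eqxx => h; apply: etrans h.
  by apply: eq_bigr => i' _; rewrite [transport^T _ _]mxE.
have le1 j' i' : transport j' i' ^+ 2 <= 1.
  rewrite -(row1 j') (bigD1 i') //= lerDl; apply: sumr_ge0 => *; exact: sqr_ge0.
pose f k := \sum_j \sum_i transport j i ^+ (2 * k.+1).
have fS k : f k - f k.+1 = \sum_j \sum_i transport j i ^+ (2 * k.+1) * (1 - transport j i ^+ 2).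
  rewrite /f -sumrB; apply: eq_bigr => j' _; rewrite -sumrB; apply: eq_bigr => i' _.
  by rewrite (mulnS 2 k.+1) exprD; ring.
have ge0 k j' i' : 0 <= transport j' i' ^+ (2 * k.+1) * (1 - transport j' i' ^+ 2).
  by rewrite mulr_ge0 ?subr_ge0 // exprM exprn_ge0 ?sqr_ge0.
(* A sequence of natural numbers cannot decrease forever. Where two consecutive sums agree, each of
   the nonnegative terms of their difference is zero. *)
have [k fk] : exists k, f k = f k.+1.
  have /choice[z zE] : forall k, exists z : nat, f k = z%:R.
    move=> k; have [z zE] := transport_power_sum (2 * k.+1) sf; exists `|z|%N.
    have : 0 <= f k by do 2![apply: sumr_ge0 => ? _]; rewrite exprM exprn_ge0 ?sqr_ge0.
    by rewrite /f zE ler0z => /gez0_abs zz; rewrite -[in LHS]zz.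
  have zS k : (z k.+1 <= z k)%N.
    rewrite -(ler_nat R) -!zE -subr_ge0 fS; do 2![apply: sumr_ge0 => ? _]; exact: ge0.
  apply: contrapT => H; have zlt k : (z k.+1 < z k)%N.
    rewrite ltn_neqAle zS andbT; apply/eqP => E; apply: H; exists k; by rewrite !zE E.
  have zk k : (z k + k <= z 0)%N by elim: k => [|k IH]; [rewrite addn0|have := zlt k; lia].
  have := zk (z 0%N).+1; lia.
have := fS k; rewrite fk subrr => /esym/eqP; rewrite psumr_eq0 => [/allP/(_ j)|j' _]; last by apply: sumr_ge0.
rewrite mem_index_enum => /(_ isT); rewrite psumr_eq0 // => /allP/(_ i); rewrite mem_index_enum => /(_ isT).
rewrite exprM mulf_eq0 expf_eq0 /= => /orP[/eqP u0|]; first by rewrite (exprM _ 2 2) u0 expr0n.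
by rewrite subr_eq0 => /eqP u1; rewrite (exprM _ 2 2) -u1 expr1n.
Qed.

Lemma transport_one j : squarefree (\det T) -> exists i, forall k, t j (c k) = s i (b k).
Proof.
move=> sf.
have row1 : \sum_i transport j i ^+ 2 = 1.
  have /matrixP/(_ j j) := transport_orthogonal; rewrite [LHS]mxE [RHS]mxE eqxx => h; apply: etrans h.
  by apply: eq_bigr => i' _; rewrite [transport^T _ _]mxE.
(* Both [sum x ^ 2 = 1] and [sum x = 1], with entries in {-1, 0, 1}. *)
have [i ui] : exists i, transport j i = 1.
  apply: contrapT => H; have : \sum_i transport j i <= 0.
    apply: sumr_le0 => i _; have /eqP := transport_entry j i sf.
    rewrite -subr_eq0 (_ : _ - _ = transport j i * transport j i * (transport j i + 1) * (1 - transport j i)); last by ring.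
    rewrite !mulf_eq0 orbb => /orP[/orP[/eqP u0|]|]; first by rewrite u0.
      by rewrite addr_eq0 => /eqP ->; rewrite lerNl oppr0.
    by rewrite subr_eq0 => /eqP h; case: H; exists i.
  by rewrite transport_row ler10.
exists i => k.
have other i' : i' != i -> transport j i' = 0.
  move=> ii; move: row1; rewrite (bigD1 i) //= ui expr1n => /eqP; rewrite -subr_eq0 addrAC subrr add0r psumr_eq0 => [/allP/(_ i')|*]; last exact: sqr_ge0.
  by rewrite mem_index_enum ii => /(_ isT) /=; rewrite sqrf_eq0 => /eqP.
have /matrixP/(_ j k) := transport_basis; rewrite [RHS]mxE => <-.
rewrite [LHS]mxE (bigD1 i) //= ui mul1r big1 ?addr0 ?mxE // => i' /other ->; by rewrite mul0r.
Qed.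

Theorem same_gram_isomorphic : squarefree (\det T) -> exists f : {rmorphism K -> L}, bijective f.
Proof.
move=> sf; have [i iE] := transport_one i0 sf.
have [[bz bT' _] [cz cT' _]] := (bT, cT).
apply: (isomorphism_of_values (s := s i) (t := t i0) _ _ iE).
  exact: (zspan_span sE.1 bT' dT i0).
exact: (zspan_span tE.1 cT' dT i0).
Qed.
End TwoFields.

(** * Cubic fields *)

Section Forms.
Variable S : comNzRingType.
(* Invariants of the triple [x, y, -x-y]: half the sum of squares, the product, the Vandermonde determinant *)
Definition qform (x y : S) := x ^+ 2 + x * y + y ^+ 2.
Definition cform (x y : S) := - (x * y * (x + y)).
Definition vform (x y : S) := (y - x) * (2 * x + y) * (x + 2 * y).

(** The discriminant of [X^3 - qform X - cform], the polynomial with roots [x], [y] and [-x-y]. *)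
Lemma cubic_discriminant x y : 27 * cform x y ^+ 2 + vform x y ^+ 2 = 4 * qform x y ^+ 3.
Proof. by rewrite /cform /vform /qform; ring. Qed.
End Forms.

(* An isometry of the plane [x + y + z = 0] is multiplication by [u = alpha + beta rho], with [rho] a cube root
   of unity, possibly followed by an exchange; the form below is then a multiple of the cube of [qform],
   by the imaginary part of [u ^ 3]. *)
Lemma isometry_invariant (R : realFieldType) (a1 a2 b1 b2 a1' a2' b1' b2' : R) :
  qform a1 a2 = qform a1' a2' -> qform b1 b2 = qform b1' b2' ->
  qform (a1 + b1) (a2 + b2) = qform (a1' + b1') (a2' + b2') -> a1 * b2 - a2 * b1 != 0 ->
  exists k eps : R, (eps = 1 \/ eps = -1) /\ forall m n : R,
  let x1 := m * a1 + n * b1 in let x2 := m * a2 + n * b2 in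
  let y1 := m * a1' + n * b1' in let y2 := m * a2' + n * b2' in
  cform x1 x2 * vform y1 y2 - eps * (cform y1 y2 * vform x1 x2) = k * qform x1 x2 ^+ 3.
Proof.
move=> h1 h2 h3 d0.
have rot (A1 A2 B1 B2 : R) : qform a1 a2 = qform A1 A2 -> qform b1 b2 = qform B1 B2 ->
    qform (a1 + b1) (a2 + b2) = qform (A1 + B1) (A2 + B2) -> a1 * b2 - a2 * b1 = A1 * B2 - A2 * B1 ->
    exists k, forall m n : R,
      let x1 := m * a1 + n * b1 in let x2 := m * a2 + n * b2 in
      let y1 := m * A1 + n * B1 in let y2 := m * A2 + n * B2 in
      cform x1 x2 * vform y1 y2 - cform y1 y2 * vform x1 x2 = k * qform x1 x2 ^+ 3.
  rewrite /qform => g1 g2 g3 gd.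
  (* The first coordinate of the linear map determines [al] and [be]; that it is an isometry
     preserving orientation then forces the second coordinate. *)
  pose al := (A1 * b2 - B1 * a2) / (a1 * b2 - a2 * b1); pose be := (a1 * B1 - b1 * A1) / (a1 * b2 - a2 * b1).
  have eA1 : A1 = al * a1 + be * a2 by rewrite /al /be; field.
  have eB1 : B1 = al * b1 + be * b2 by rewrite /al /be; field.
  have g3' : 2 * a1 * b1 + a1 * b2 + a2 * b1 + 2 * a2 * b2 = 2 * A1 * B1 + A1 * B2 + A2 * B1 + 2 * A2 * B2 by lra.
  have eA2 : A2 = - be * a1 + (al - be) * a2.
    have : 2 * ((a1 * b2 - a2 * b1) * A2 + (a1 * B1 - b1 * A1) * (a1 + a2) - (A1 * b2 - B1 * a2) * a2) = 0.
      have -> : 2 * ((a1 * b2 - a2 * b1) * A2 + (a1 * B1 - b1 * A1) * (a1 + a2) - (A1 * b2 - B1 * a2) * a2) =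
        2 * ((a1 * b2 - a2 * b1) - (A1 * B2 - A2 * B1)) * A2 + 2 * B1 * ((a1 ^+ 2 + a1 * a2 + a2 ^+ 2) - (A1 ^+ 2 + A1 * A2 + A2 ^+ 2))
        - A1 * (2 * a1 * b1 + a1 * b2 + a2 * b1 + 2 * a2 * b2 - (2 * A1 * B1 + A1 * B2 + A2 * B1 + 2 * A2 * B2)
          - ((a1 * b2 - a2 * b1) - (A1 * B2 - A2 * B1))) by ring.
      by rewrite g1 g3' gd !subrr; ring.
    move=> /eqP; rewrite mulf_eq0 pnatr_eq0 /= => /eqP E.
    apply: (mulfI d0); rewrite (_ : (a1 * b2 - a2 * b1) * (- be * a1 + (al - be) * a2) = - (a1 * B1 - b1 * A1) * (a1 + a2) + (A1 * b2 - B1 * a2) * a2).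
      by lra.
    by rewrite /al /be; field.
  have eB2 : B2 = - be * b1 + (al - be) * b2.
    have : 2 * ((a1 * b2 - a2 * b1) * B2 + (a1 * B1 - b1 * A1) * (b1 + b2) - (A1 * b2 - B1 * a2) * b2) = 0.
      have -> : 2 * ((a1 * b2 - a2 * b1) * B2 + (a1 * B1 - b1 * A1) * (b1 + b2) - (A1 * b2 - B1 * a2) * b2) =
        2 * ((a1 * b2 - a2 * b1) - (A1 * B2 - A2 * B1)) * B2 - 2 * A1 * ((b1 ^+ 2 + b1 * b2 + b2 ^+ 2) - (B1 ^+ 2 + B1 * B2 + B2 ^+ 2))
        + B1 * (2 * a1 * b1 + a1 * b2 + a2 * b1 + 2 * a2 * b2 - (2 * A1 * B1 + A1 * B2 + A2 * B1 + 2 * A2 * B2)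
          + ((a1 * b2 - a2 * b1) - (A1 * B2 - A2 * B1))) by ring.
      by rewrite g2 g3' gd !subrr; ring.
    move=> /eqP; rewrite mulf_eq0 pnatr_eq0 /= => /eqP E.
    apply: (mulfI d0); rewrite (_ : (a1 * b2 - a2 * b1) * (- be * b1 + (al - be) * b2) = - (a1 * B1 - b1 * A1) * (b1 + b2) + (A1 * b2 - B1 * a2) * b2).
      by lra.
    by rewrite /al /be; field.
  clearbody al be; exists (2 * al * be * (al - be)) => m n /=.
  have -> : m * A1 + n * B1 = al * (m * a1 + n * b1) + be * (m * a2 + n * b2) by rewrite eA1 eB1; ring.
  have -> : m * A2 + n * B2 = - be * (m * a1 + n * b1) + (al - be) * (m * a2 + n * b2) by rewrite eA2 eB2; ring.
  by rewrite /cform /vform; ring.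
(* The square of the area is determined by the values of [qform]. The sign of the area decides
   whether the two coordinates have to be exchanged. *)
have : (a1 * b2 - a2 * b1) ^+ 2 = (a1' * b2' - a2' * b1') ^+ 2.
  have E (x1 x2 y1 y2 : R) : 3 * (x1 * y2 - x2 * y1) ^+ 2 = 4 * qform x1 x2 * qform y1 y2 -
    (qform (x1 + y1) (x2 + y2) - qform x1 x2 - qform y1 y2) ^+ 2 by rewrite /qform; ring.
  by have := E a1 a2 b1 b2; have := E a1' a2' b1' b2'; rewrite -h1 -h2 -h3; lra.
move=> /eqP; rewrite eqf_sqr => /orP[]/eqP de.
  have [k kE] := rot _ _ _ _ h1 h2 h3 de; exists k, 1; split; first by left.
  by move=> m n; have := kE m n; rewrite /= mul1r.
have sw (x y : R) : qform x y = qform y x by rewrite /qform; ring.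
have [||||k kE] := rot a2' a1' b2' b1'; rewrite 1?[RHS]sw //; first by rewrite de; ring.
exists (- k), (-1); split; first by right.
move=> m n /=; have := kE m n; rewrite /=.
move: (m * a1 + _) (m * a2 + _) (m * a1' + _) (m * a2' + _) => x y z w.
by rewrite /cform /vform; lra.
Qed.

(** Says that the binary form with coefficients [p], [q], [r] is primitive: a common prime factor
    [l] gives [l^2 | 3 d]. The prime 3 is excluded by [d3]. For [l = 2] and [d = 4 m] one gets
    [3 m = 4 p' r' - q'^2], so [m] is 0 or 1 modulo 4, against the definition of a fundamental
    discriminant. *)
Lemma fundamental_square (d : int) (l : nat) (p q r : int) : fundamental_discriminant d -> ~ (3 %| d)%Z ->
  prime l -> 4 * p * r - q ^+ 2 = 3 * d -> (l%:Z %| p)%Z -> (l%:Z %| q)%Z -> (l%:Z %| r)%Z -> False.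
Proof.
move=> fd d3 pl E /dvdzP[p' pE] /dvdzP[q' qE] /dvdzP[r' rE].
have l1 := prime_gt1 pl.
have E' : (4 * p' * r' - q' ^+ 2) * l%:Z ^+ 2 = 3 * d by rewrite -E pE qE rE; ring.
have [l2|l2] := eqVneq l 2%N.
  rewrite {}l2 in E'; case: fd => [[d4 _]|[m [dE m4 _]]]; first by move: E'; lia.
  have : (4 * p' * r' - q' ^+ 2) = 3 * m by lia.
  have [k [c [qk c01]]] : exists k c : int, q' = 2 * k + c /\ (c = 0 \/ c = 1).
    by exists (q' %/ 2)%Z, (q' %% 2)%Z; lia.
  have -> : 4 * p' * r' - q' ^+ 2 = 4 * (p' * r' - k ^+ 2 - k * c) - c.
    by rewrite qk; case: c01 => ->; ring.
  by move: (p' * r' - k ^+ 2 - k * c) => P; case: c01 => ->; lia.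
have l3 : l != 3%N.
  apply/eqP => l3; apply: d3; apply/dvdzP; exists (4 * p' * r' - q' ^+ 2).
  by move: E'; rewrite l3; lia.
have ld : (l%:Z ^+ 2 %| d)%Z.
  have c3 : coprimez (l%:Z ^+ 2) 3.
    rewrite coprimezXl // coprimezE /= prime_coprime //; apply/negP => /(dvdn_leq (isT : 0 < 3)%N).
    by move: l1 l2 l3 => {pE qE rE E' pl}; case: l => [|[|[|[|l]]]].
  by rewrite -(Gauss_dvdzr _ c3) -E' dvdz_mull.
have lz : `|l%:Z| = l%:Z by [].
case: fd => [[_ sf]|[m [dE _ sf]]]; first by have := sf _ ld; rewrite lz => -[le]; move: l1; rewrite le.
have lm : (l%:Z ^+ 2 %| m)%Z.
  have c4 : coprimez (l%:Z ^+ 2) 4.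
    rewrite coprimezXl // (_ : 4 = 2%:Z ^+ 2) // coprimezXr // coprimezE /= prime_coprime //.
    apply/negP => /(dvdn_leq (isT : 0 < 2)%N).
    by move: l1 l2 l3 => {pE qE rE E' pl ld dE lz}; case: l => [|[|[|l]]].
  by rewrite -(Gauss_dvdzr _ c4) -dE.
by have := sf _ lm; rewrite lz => -[le]; move: l1; rewrite le.
Qed.

Definition i0 : 'I_3 := ord0.
Definition i1 : 'I_3 := lift ord0 ord0.
Definition i2 : 'I_3 := lift ord0 (lift ord0 ord0).

Lemma sum3 (V : nmodType) (f : 'I_3 -> V) : \sum_i f i = f i0 + (f i1 + f i2).
Proof. by rewrite !big_ord_recl big_ord0 addr0. Qed.

Section OneCubic.
Variables (R : realType) (F : fieldExtType rat) (s : 'I_3 -> {rmorphism F -> R}).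
Hypothesis sE : all_embeddings s.
Variables (b : 'I_3 -> F) (T : 'M[int]_3) (e : 'I_3 -> int).
Hypothesis bT : gram_basis b T e.
Notation integral x := (integralOver (intr : int -> R) x).
Variable xi : F.
Hypothesis (xiO : ring_of_integers F xi) (xi0 : field_trace xi = 0).
Notation x := (s i0 xi).
Notation y := (s i1 xi).

Lemma third_conjugate : s i2 xi = - x - y.
Proof. by have := sE.1 xi; rewrite xi0 rmorph0 sum3 => h; lra. Qed.

Lemma trace_square : ratr (field_trace (xi ^+ 2)) = 2 * qform x y :> R.
Proof. by rewrite sE.1 sum3 !rmorphXn third_conjugate /qform; ring. Qed.

Lemma integral_conj i : integral (s i xi). Proof. exact: integral_emb. Qed.

Lemma integralN' (u : R) : integral u -> integral (- u).
Proof. by move=> ui; rewrite -mulN1r; apply: integralM => //; exact: (integralz R (-1)). Qed.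

Lemma qform_int : exists h : int, qform x y = h%:~R.
Proof.
have [|h hE] := @integral_rat R (field_trace (xi ^+ 2) / 2); last first.
  by exists h; rewrite -(ratr_int R) -hE fmorph_div /= trace_square ratr_nat; field.
have -> : ratr (field_trace (xi ^+ 2) / 2) = qform x y by rewrite fmorph_div /= trace_square ratr_nat; field.
rewrite /qform; apply: integralD; last by apply: integralX; exact: integral_conj.
by apply: integralD; [apply: integralX; exact: integral_conj|apply: integralM; exact: integral_conj].
Qed.

Lemma cform_int : exists N : int, cform x y = N%:~R.
Proof.
have E : ratr (field_trace (xi ^+ 3) / 3) = cform x y.
  by rewrite fmorph_div /= sE.1 sum3 !rmorphXn third_conjugate /cform ratr_nat; field.
have [|h hE] := @integral_rat R (field_trace (xi ^+ 3) / 3); last first.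
  by exists h; rewrite -(ratr_int R) -hE E.
rewrite E /cform; apply: integralN'; apply: integralM; first by apply: integralM; exact: integral_conj.
by apply: integralD; exact: integral_conj.
Qed.

Definition power (i : 'I_3) : F := xi ^+ i.

Lemma power_integral i : ring_of_integers F (power i).
Proof.
rewrite /power; elim: (i : nat) => [|k IH].
  exact: (@integral1 _ _ (intr : {rmorphism int -> F})).
by rewrite exprS; exact: ring_of_integersM.
Qed.

Lemma det_power : \det (cmx s power) = vform x y.
Proof.
rewrite (expand_det_row _ ord0) sum3 /cofactor !(expand_det_row _ ord0) !big_ord_recl !big_ord0 /cofactor.
rewrite !det_mx11 !mxE /= /power /= !rmorphXn /= -[s ord0]/(s i0) -[s (lift ord0 ord0)]/(s i1).
rewrite -[s (lift ord0 (lift ord0 ord0))]/(s i2) third_conjugate /vform; ring.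
Qed.

(** The integer is the value of the index form: the determinant of the coordinates of 1, [xi],
    [xi^2] in the basis [b]. *)
Lemma vform_int : exists z : int, vform x y = \det (cmx s b) * z%:~R.
Proof.
have [bz _ _] := bT.
have /choice[M ME] : forall i, exists v : 'I_3 -> int, power i = \sum_j b j *~ v j.
  by move=> i; apply: bz.2; exact: power_integral.
exists (\det (\matrix_(j, i) M i j)); rewrite -det_power -det_map_mx -det_mulmx; congr (\det _).
apply/matrixP => k i; rewrite !mxE ME rmorph_sum; apply: eq_bigr => j _.
by rewrite !mxE rmorphMz mulrzr.
Qed.

Lemma power_span : vform x y != 0 -> forall z, exists q : 'I_3 -> rat, z = \sum_j q j *: power j.
Proof.
move=> v0.
have tr i j : exists z : int, field_trace (power i * power j) = z%:~R.
  by apply: (trace_int sE.1); apply: ring_of_integersM; exact: power_integral.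
have /choice[f fE] : forall ij : 'I_3 * 'I_3, exists z : int, field_trace (power ij.1 * power ij.2) = z%:~R by move=> ij.
have PT i j : field_trace (power i * power j) = ((\matrix_(i, j) f (i, j)) i j)%:~R by rewrite mxE -fE.
apply: (zspan_span sE.1 PT _ i0).
have := cmx_gram sE.1 PT => /(congr1 determinant).
rewrite det_mulmx det_tr det_power det_map_mx => h.
by rewrite -(intr_eq0 R) -h mulf_neq0.
Qed.
End OneCubic.

Lemma conjugate_root (R : realFieldType) (x y u v : R) : qform u v = qform x y -> cform u v = cform x y ->
  [\/ u = x, u = y | u = - x - y].
Proof.
move=> q c; have : (u - x) * (u - y) * (u - (- x - y)) = 0.
  have -> : (u - x) * (u - y) * (u - (- x - y)) = u ^+ 3 - qform x y * u - cform x y by rewrite /qform /cform; ring.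
  by rewrite -q -c /qform /cform; ring.
move=> /eqP; rewrite !mulf_eq0 !subr_eq0 -orbA => /or3P[]/eqP ->; [exact: Or31|exact: Or32|exact: Or33].
Qed.

(** The number [k] is rational, and its denominator divides the three cubes; so a prime factor of it
    would divide [p], [r] and [w]. *)
Lemma integer_multiplier (R : realType) (k : R) (p r w zp zr zw : int) : p != 0 ->
  k * (p ^+ 3)%:~R = zp%:~R -> k * (r ^+ 3)%:~R = zr%:~R -> k * (w ^+ 3)%:~R = zw%:~R ->
  (forall l : nat, prime l -> (l%:Z %| p)%Z -> (l%:Z %| r)%Z -> (l%:Z %| w)%Z -> False) ->
  exists z : int, k = z%:~R.
Proof.
move=> p0 kp kr kw cop.
have p3 : (p ^+ 3)%:~R != 0 :> R by rewrite intr_eq0 expf_neq0.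
pose q : rat := zp%:~R / (p ^+ 3)%:~R.
have kE : k = ratr q by rewrite /q fmorph_div /= !ratr_int -kp mulfK.
have dvd (a z : int) : k * (a ^+ 3)%:~R = z%:~R -> (denq q %| a ^+ 3)%Z.
  rewrite kE -(ratr_int R (a ^+ 3)) -(ratr_int R z) -rmorphM => /fmorph_inj.
  rewrite -{1}[q]divq_num_den => /(congr1 (fun t => t * (denq q)%:~R)).
  rewrite mulrAC divfK ?intr_eq0 ?denq_eq0 // -!intrM => /intr_inj E.
  have c : coprimez (denq q) (numq q) by rewrite coprimezE coprime_sym coprime_num_den.
  by rewrite -(Gauss_dvdzr _ c) E dvdz_mull.
have [d1|d1] := eqVneq (denq q) 1.
  by exists (numq q); rewrite kE -{1}[q]divq_num_den d1 divr1 ratr_int.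
have dn : `|denq q|%N != 1%N.
  by apply: contra_neq d1 => h; rewrite -[RHS]/(1%N%:Z) -h gez0_abs // ltW // denq_gt0.
have pl : prime (pdiv `|denq q|%N).
  rewrite pdiv_prime // ltn_neqAle eq_sym dn absz_gt0 denq_eq0 //.
have ld a z : k * (a ^+ 3)%:~R = z%:~R -> ((pdiv `|denq q|%N)%:Z %| a)%Z.
  move=> /dvd h; have : ((pdiv `|denq q|%N)%:Z %| a ^+ 3)%Z.
    by apply: dvdz_trans h; rewrite dvdzE; exact: pdiv_dvd.
  by rewrite !dvdzE /= abszX Euclid_dvdX // => /andP[].
by case: (cop _ pl (ld _ _ kp) (ld _ _ kr) (ld _ _ kw)).
Qed.

Section Combination.
Variables (R : realType) (F : fieldExtType rat) (s : 'I_3 -> {rmorphism F -> R}).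
Hypothesis sE : all_embeddings s.
Variables (u1 u2 : F).
Hypothesis (u1O : ring_of_integers F u1) (u2O : ring_of_integers F u2).
Hypothesis (u10 : field_trace u1 = 0) (u20 : field_trace u2 = 0).
Definition comb2 (m n : int) : F := u1 *~ m + u2 *~ n.
Lemma comb2_integral m n : ring_of_integers F (comb2 m n).
Proof.
rewrite /comb2 -(mulrzr u1) -(mulrzr u2).
by apply: (@integral_add _ _ (intr : {rmorphism int -> F})); apply: ring_of_integersM => //;
  exact: (@integral_id _ _ (intr : {rmorphism int -> F})).
Qed.
Lemma comb2_trace m n : field_trace (comb2 m n) = 0.
Proof. by rewrite /comb2 (field_traceD sE.1) !scaler_int_intr !(field_traceZ sE.1) u10 u20 !mulr0 addr0. Qed.
Lemma comb2_conj i m n : s i (comb2 m n) = m%:~R * s i u1 + n%:~R * s i u2.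
Proof. by rewrite rmorphD (rmorphMz (s i)) (rmorphMz (s i)) /= -(mulrzl (s i u1)) -(mulrzl (s i u2)). Qed.
Lemma qform_trace : [/\ 2 * qform (s i0 u1) (s i1 u1) = ratr (field_trace (u1 * u1)) :> R,
  2 * qform (s i0 u2) (s i1 u2) = ratr (field_trace (u2 * u2)) :> R &
  qform (s i0 u1 + s i0 u2) (s i1 u1 + s i1 u2) - qform (s i0 u1) (s i1 u1) - qform (s i0 u2) (s i1 u2) =
    ratr (field_trace (u1 * u2)) :> R].
Proof.
have h1 := third_conjugate sE u10; have h2 := third_conjugate sE u20.
by split; rewrite sE.1 sum3 !rmorphM /= ?h1 ?h2 /qform; ring.
Qed.
End Combination.

Section CubicFields.
Variables (R : realType) (K L : fieldExtType rat).
Variables (s : 'I_3 -> {rmorphism K -> R}) (t : 'I_3 -> {rmorphism L -> R}).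
Hypothesis (sE : all_embeddings s) (tE : all_embeddings t).
Variables (b : 'I_3 -> K) (T : 'M[int]_3) (e : 'I_3 -> int) (c : 'I_3 -> L) (U : 'M[int]_3) (e' : 'I_3 -> int) (d : int).
Hypothesis (bT : gram_basis b T e) (cU : gram_basis c U e') (Td : \det T = d) (Ud : \det U = d).
Hypothesis (fd : fundamental_discriminant d) (d3 : ~ (3 %| d)%Z).
Variables (u1 u2 : K) (w1 w2 : L).
Hypothesis (u1O : ring_of_integers K u1) (u2O : ring_of_integers K u2) (w1O : ring_of_integers L w1) (w2O : ring_of_integers L w2).
Hypothesis (u10 : field_trace u1 = 0) (u20 : field_trace u2 = 0) (w10 : field_trace w1 = 0) (w20 : field_trace w2 = 0).
Hypothesis (G11 : field_trace (u1 * u1) = field_trace (w1 * w1)) (G12 : field_trace (u1 * u2) = field_trace (w1 * w2))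
  (G22 : field_trace (u2 * u2) = field_trace (w2 * w2)).
Hypothesis (G : field_trace (u1 * u1) * field_trace (u2 * u2) - field_trace (u1 * u2) ^+ 2 = (3 * d)%:~R).
Notation xi := (comb2 u1 u2).
Notation eta := (comb2 w1 w2).

Theorem cubic_isomorphic (m0 n0 : int) : vform (s i0 (xi m0 n0)) (s i1 (xi m0 n0)) != 0 ->
  exists f : {rmorphism K -> L}, bijective f.
Proof.
move=> v0.
have [q1 q2 q12] := qform_trace sE u10 u20.
have [q1' q2' q12'] := qform_trace tE w10 w20.
rewrite -G11 -q1 in q1'; rewrite -G22 -q2 in q2'; rewrite -G12 -q12 in q12'.
have h1 : qform (s i0 u1) (s i1 u1) = qform (t i0 w1) (t i1 w1) by lra.
have h2 : qform (s i0 u2) (s i1 u2) = qform (t i0 w2) (t i1 w2) by lra.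
have h3 : qform (s i0 u1 + s i0 u2) (s i1 u1 + s i1 u2) = qform (t i0 w1 + t i0 w2) (t i1 w1 + t i1 w2) by lra.
have detq : 4 * qform (s i0 u1) (s i1 u1) * qform (s i0 u2) (s i1 u2) -
    (qform (s i0 u1 + s i0 u2) (s i1 u1 + s i1 u2) - qform (s i0 u1) (s i1 u1) - qform (s i0 u2) (s i1 u2)) ^+ 2 = 3 * d%:~R :> R.
  rewrite q12; have := congr1 (ratr : rat -> R) G; rewrite rmorphB rmorphM rmorphXn /= -q1 -q2 ratr_int intrM => <-.
  by ring.
have de2 : (s i0 u1 * s i1 u2 - s i1 u1 * s i0 u2) ^+ 2 = d%:~R.
  have E (x y z w : R) : 3 * (x * w - y * z) ^+ 2 = 4 * qform x y * qform z w -
    (qform (x + z) (y + w) - qform x y - qform z w) ^+ 2 by rewrite /qform; ring.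
  have := E (s i0 u1) (s i1 u1) (s i0 u2) (s i1 u2); rewrite detq; lra.
have d0 : d != 0.
  apply/eqP => dz; case: fd => [[]|[m [dm m4 _]]]; first by rewrite dz mod0z.
  have mz : m = 0 by lia.
  by move: m4; rewrite mz mod0z; case.
have dR0 : d%:~R != 0 :> R by rewrite intr_eq0.
have dgt : (0 < d)%R by rewrite -(ltr0z R) lt_neqAle eq_sym dR0 -de2 sqr_ge0.
have de0 : s i0 u1 * s i1 u2 - s i1 u1 * s i0 u2 != 0 by rewrite -sqrf_eq0 de2.
have [k [eps [epsE H]]] := isometry_invariant h1 h2 h3 de0.
have D2 := cmx_det_sqr sE bT; have D2' := cmx_det_sqr tE cU.
rewrite Td in D2; rewrite Ud in D2'; set D := \det (cmx s b) in D2; set D' := \det (cmx t c) in D2'.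
have D0 : D != 0 by rewrite -sqrf_eq0 D2.
have [ez ezE] : exists z : int, eps = z%:~R by case: epsE => ->; [exists 1|exists (-1)].
have [z1 z1E] : exists z : int, D' = z%:~R * D.
  have /eqP : D' ^+ 2 = D ^+ 2 by rewrite D2 D2'.
  by rewrite eqf_sqr => /orP[]/eqP ->; [exists 1; rewrite mul1r|exists (-1); rewrite mulN1r].
have xiO m n : ring_of_integers K (xi m n) by exact: comb2_integral.
have etaO m n : ring_of_integers L (eta m n) by exact: comb2_integral.
have xi0 m n : field_trace (xi m n) = 0 by exact: (comb2_trace sE).
have eta0 m n : field_trace (eta m n) = 0 by exact: (comb2_trace tE).
have H' m n : cform (s i0 (xi m n)) (s i1 (xi m n)) * vform (t i0 (eta m n)) (t i1 (eta m n)) -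
    eps * (cform (t i0 (eta m n)) (t i1 (eta m n)) * vform (s i0 (xi m n)) (s i1 (xi m n))) =
    k * qform (s i0 (xi m n)) (s i1 (xi m n)) ^+ 3.
  by rewrite !comb2_conj; exact: H.
have qE m n : qform (t i0 (eta m n)) (t i1 (eta m n)) = qform (s i0 (xi m n)) (s i1 (xi m n)).
  have E (x y z w : R) : qform (m%:~R * x + n%:~R * z) (m%:~R * y + n%:~R * w) = m%:~R ^+ 2 * qform x y + n%:~R ^+ 2 * qform z w +
    m%:~R * n%:~R * (qform (x + z) (y + w) - qform x y - qform z w) by rewrite /qform; ring.
  by rewrite !comb2_conj !E -h1 -h2 -h3.
(* At each lattice point [k h^3 / D] is the difference or sum of [N I'] and [N' I], up to sign. The
   points (1,0), (0,1) and (1,1) determine the coefficients of [h], which have no common factor, so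
   [k / D] is an integer. *)
have val m n (h : int) : qform (s i0 (xi m n)) (s i1 (xi m n)) = h%:~R -> exists z : int, k / D * (h ^+ 3)%:~R = z%:~R.
  move=> hE; have [N NE] := cform_int sE (xiO m n) (xi0 m n); have [N' NE'] := cform_int tE (etaO m n) (eta0 m n).
  have [I IE] := vform_int sE bT (xiO m n) (xi0 m n); have [I' IE'] := vform_int tE cU (etaO m n) (eta0 m n).
  exists (N * z1 * I' - ez * N' * I); have := H' m n.
  rewrite NE NE' IE IE' -/D -/D' z1E hE ezE => h'; apply: (mulfI D0).
  rewrite mulrA mulrCA mulfV // mulr1 rmorphXn /= -h' !(intrB, intrM); ring.
have [p pE] := qform_int sE (xiO 1 0) (xi0 1 0).
have [r rE] := qform_int sE (xiO 0 1) (xi0 0 1).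
have [w wE] := qform_int sE (xiO 1 1) (xi0 1 1).
have [zp zpE] := val _ _ _ pE; have [zr zrE] := val _ _ _ rE; have [zw zwE] := val _ _ _ wE.
have pqr : 4 * p * r - (w - p - r) ^+ 2 = 3 * d.
  apply: (@intr_inj R); rewrite !(intrB, intrM, rmorphXn) /= -pE -rE -wE !comb2_conj.
  by rewrite !mul0r !mul1r !addr0 !add0r.
have p0 : p != 0.
  by apply/eqP => pz; move: pqr; rewrite pz mulr0 mul0r => E; have := sqr_ge0 (w - 0 - r); lia.
have [|z zE] := integer_multiplier p0 zpE zrE zwE.
  move=> l pl lp lr lw; apply: (fundamental_square fd d3 pl pqr lp _ lr).
  by rewrite !rpredB.
have kz : k = z%:~R * D by rewrite -zE divfK.
(* Brahmagupta's identity for the product of the two values of [27 N^2 + V^2], each equal to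
   [4 h^3]: it exhibits [27 (k h^3)^2] as one of two squares with sum [16 h^6]. *)
have bound : 27 * k ^+ 2 <= 16.
  have c1 := cubic_discriminant (s i0 (xi 1 0)) (s i1 (xi 1 0)); have c2 := cubic_discriminant (t i0 (eta 1 0)) (t i1 (eta 1 0)).
  have := H' 1 0; rewrite qE in c2; move: c1 c2; rewrite pE.
  move: (cform (s i0 _) _) (vform (s i0 _) _) (cform (t i0 _) _) (vform (t i0 _) _) => N V N' V' c1 c2 hk.
  have pR : 0 < ((p%:~R : R) ^+ 3) ^+ 2 by rewrite lt_neqAle sqr_ge0 eq_sym sqrf_eq0 expf_eq0 intr_eq0 p0.
  rewrite -(ler_pM2r pR).
  have ee : eps ^+ 2 = 1 by case: epsE => ->; ring.
  have -> : 16 * (p%:~R ^+ 3) ^+ 2 = (27 * N ^+ 2 + V ^+ 2) * (27 * N' ^+ 2 + V' ^+ 2) :> R by rewrite c1 c2; ring.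
  have -> : 27 * k ^+ 2 * (p%:~R ^+ 3) ^+ 2 = 27 * (N * V' - eps * (N' * V)) ^+ 2 by rewrite hk; ring.
  have -> : (27 * N ^+ 2 + V ^+ 2) * (27 * N' ^+ 2 + V' ^+ 2) = 27 * (N * V' - eps * (N' * V)) ^+ 2 + (27 * eps * N * N' + V * V') ^+ 2
    + (1 - eps ^+ 2) * 27 * N' ^+ 2 * (V ^+ 2 + 27 * N ^+ 2) by ring.
  by rewrite ee subrr !mul0r addr0 lerDl sqr_ge0.
(* With [k = z D] and [D^2 = d >= 1], a nonzero integer [z] would give [k^2 >= 1], against the
   bound. *)
have k0 : k = 0.
  have : 27 * (z ^+ 2 * d) <= 16 by rewrite -(ler_int R) !(intrM, rmorphXn) /= -D2; move: bound; rewrite kz exprMn.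
  have [z0 _|zn] := eqVneq z 0; first by rewrite kz z0 mul0r.
  have : 1 <= z ^+ 2 by rewrite -gtz0_ge1 lt_neqAle sqr_ge0 eq_sym sqrf_eq0 zn.
  by move: (z ^+ 2) => z2 *; nia.
have c1 := cubic_discriminant (s i0 (xi m0 n0)) (s i1 (xi m0 n0)).
have c2 := cubic_discriminant (t i0 (eta m0 n0)) (t i1 (eta m0 n0)).
have := H' m0 n0; rewrite k0 mul0r; have Q := qE m0 n0; rewrite Q in c2.
have ee : eps ^+ 2 = 1 by case: epsE => ->; ring.
move=> /eqP; rewrite subr_eq0 => /eqP E.
have Q0 : qform (s i0 (xi m0 n0)) (s i1 (xi m0 n0)) != 0.
  apply: contraNneq v0 => q0; move: c1; rewrite q0 expr0n mulr0 => c1.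
  by rewrite -sqrf_eq0; apply/eqP; have := sqr_ge0 (cform (s i0 (xi m0 n0)) (s i1 (xi m0 n0))); have := sqr_ge0 (vform (s i0 (xi m0 n0)) (s i1 (xi m0 n0))); lra.
have N2 : cform (s i0 (xi m0 n0)) (s i1 (xi m0 n0)) ^+ 2 = cform (t i0 (eta m0 n0)) (t i1 (eta m0 n0)) ^+ 2.
  have q3 : 4 * qform (s i0 (xi m0 n0)) (s i1 (xi m0 n0)) ^+ 3 != 0 by rewrite mulf_neq0 ?pnatr_eq0 // expf_neq0.
  apply: (mulfI q3); move: E c1 c2; move: (cform (s i0 _) _) (vform (s i0 _) _) (cform (t i0 _) _) (vform (t i0 _) _) (4 * _) => N V N' V' q.
  move=> E c1 c2; have : (N * V') ^+ 2 = (N' * V) ^+ 2 by rewrite E exprMn ee mul1r.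
  move=> E2; rewrite -{1}c2 -c1.
  have -> : (27 * N' ^+ 2 + V' ^+ 2) * N ^+ 2 = 27 * N' ^+ 2 * N ^+ 2 + (N * V') ^+ 2 by ring.
  by rewrite E2; ring.
have V0 : vform (t i0 (eta m0 n0)) (t i1 (eta m0 n0)) != 0.
  rewrite -sqrf_eq0 (_ : _ ^+ 2 = vform (s i0 (xi m0 n0)) (s i1 (xi m0 n0)) ^+ 2) ?sqrf_eq0 //.
  by move: c1 c2; rewrite N2; lra.
(* The conjugates of [eta], or those of [- eta], are the conjugates of [xi]. *)
have [s2 [s2E cE]] : exists s2 : int, (s2 = 1 \/ s2 = -1) /\
    cform (t i0 (eta (s2 * m0) (s2 * n0))) (t i1 (eta (s2 * m0) (s2 * n0))) = cform (s i0 (xi m0 n0)) (s i1 (xi m0 n0)).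
  move: N2 => /eqP; rewrite eqf_sqr => /orP[]/eqP ->.
    by exists 1; split; [left|rewrite !mul1r].
  exists (-1); split; first by right.
  by rewrite !comb2_conj !mulN1r !rmorphN /cform; ring.
have q2E : qform (t i0 (eta (s2 * m0) (s2 * n0))) (t i1 (eta (s2 * m0) (s2 * n0))) = qform (s i0 (xi m0 n0)) (s i1 (xi m0 n0)).
  rewrite -Q !comb2_conj !intrM /qform; case: s2E => ->; rewrite ?rmorphN1 ?rmorph1; ring.
have v2 : vform (t i0 (eta (s2 * m0) (s2 * n0))) (t i1 (eta (s2 * m0) (s2 * n0))) != 0.
  case: s2E => ->; first by rewrite !mul1r.
  rewrite (_ : vform _ _ = - vform (t i0 (eta m0 n0)) (t i1 (eta m0 n0))) ?oppr_eq0 //.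
  by rewrite !comb2_conj !mulN1r !rmorphN /vform; ring.
have [j jE] : exists j, t i0 (eta (s2 * m0) (s2 * n0)) = s j (xi m0 n0).
  have [->|->|h] := conjugate_root q2E cE; [by exists i0|by exists i1|].
  by exists i2; rewrite (third_conjugate sE (xi0 m0 n0)).
apply: (@isomorphism_of_values _ _ _ (s j) (t i0) _ (power (xi m0 n0)) (power (eta (s2 * m0) (s2 * n0)))).
- exact: (power_span sE (xiO _ _) (xi0 _ _) v0).
- exact: (power_span tE (etaO _ _) (eta0 _ _) v2).
- by move=> i; rewrite /power !rmorphXn /= jE.
Qed.
End CubicFields.

(** * Positive definite integral forms *)

Definition bil r (G : 'M[int]_r) (v w : 'rV[int]_r) : int := (v *m G *m w^T) 0 0.
Definition quad r (G : 'M[int]_r) (v : 'rV[int]_r) : int := bil G v v.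
Definition positive_form r (G : 'M[int]_r) : Prop := G^T = G /\ forall v, v != 0 -> 0 < quad G v.

Lemma bilDl r (G : 'M[int]_r) u v w : bil G (u + v) w = bil G u w + bil G v w.
Proof. by rewrite /bil !mulmxDl mxE. Qed.
Lemma bilZl r (G : 'M[int]_r) x v w : bil G (x *: v) w = x * bil G v w.
Proof. by rewrite /bil -!scalemxAl mxE. Qed.

Section Bounds.
Variables (r : nat) (G : 'M[int]_r).
Hypothesis GP : positive_form G.

Lemma bilC v w : bil G v w = bil G w v.
Proof.
rewrite /bil -[in LHS]GP.1.
have -> : v *m G^T *m w^T = (w *m G *m v^T)^T by rewrite !trmx_mul trmxK mulmxA.
by rewrite mxE.
Qed.

Lemma quadD v w (x y : int) : quad G (x *: v + y *: w) = x ^+ 2 * quad G v + y ^+ 2 * quad G w + 2 * x * y * bil G v w.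
Proof.
rewrite /quad !(bilDl, bilZl) ![bil G _ (_ + _)]bilC !(bilDl, bilZl) (bilC w v); ring.
Qed.

Lemma quad0 : quad G 0 = 0.
Proof. by rewrite /quad /bil !mul0mx mxE. Qed.

Lemma quad_ge0 v : 0 <= quad G v.
Proof. by have [->|v0] := eqVneq v 0; [rewrite quad0|rewrite ltW // GP.2]. Qed.

Lemma quad_eq0 v : quad G v = 0 -> v = 0.
Proof. by move=> q0; apply/eqP/contraT => /GP.2; rewrite q0 ltxx. Qed.

(** Cauchy-Schwarz bounds the square of the left side by the right side. For nonzero vectors the
    right side is at least 1, so it bounds the left side itself, and no square root is needed. *)
Lemma bil_le v w : `|bil G v w| <= quad G v * quad G w.
Proof.
have [->|v0] := eqVneq v 0; first by rewrite quad0 mul0r /bil !mul0mx mxE normr0.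
have [->|w0] := eqVneq w 0; first by rewrite bilC quad0 mulr0 /bil !mul0mx mxE normr0.
have qv := GP.2 _ v0; have qw := GP.2 _ w0.
have := quad_ge0 (quad G w *: v + (- bil G v w) *: w); rewrite quadD.
move: (quad G v) (quad G w) (bil G v w) qv qw => a b c a0 b0.
have -> : b ^+ 2 * a + (- c) ^+ 2 * b + 2 * b * - c * c = b * (a * b - c ^+ 2) by ring.
rewrite pmulr_rge0 // subr_ge0 => cab.
have ab0 : 0 < a * b by rewrite mulr_gt0.
move: (a * b) cab ab0 => m cm m0; have : `|c| ^+ 2 <= m ^+ 2.
  by rewrite real_normK ?num_real //; nia.
by rewrite ler_pXn2r // nnegrE ltW.
Qed.

Lemma positive_det : \det G != 0.
Proof.
apply/negP => /eqP d0.
have d0' : \det (map_mx intr G : 'M[rat]_r) == 0 by rewrite det_map_mx d0.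
have /det0P[v v0 vG] := d0'.
pose D := \prod_j denq (v 0 j).
have D0 : D != 0 by apply/prodf_neq0 => j _; rewrite denq_eq0.
have /choice[z zE] : forall j, exists z : int, D%:~R * v 0 j = z%:~R.
  move=> j; rewrite /D (bigD1 j) //= intrM mulrAC (mulrC _ (v 0 j)) -numqE -intrM.
  by exists (numq (v 0 j) * \prod_(i < r | i != j) denq (v 0 i)).
pose w : 'rV[int]_r := \row_j z j.
have wE : map_mx intr w = (D%:~R : rat) *: v by apply/rowP => j; rewrite !mxE zE.
have wG : w *m G = 0.
  apply/rowP => j; apply: (@intr_inj rat).
  have /rowP/(_ j) : map_mx intr (w *m G) = 0 :> 'rV[rat]_r by rewrite map_mxM wE -scalemxAl vG scaler0.
  by rewrite !mxE => ->.
have w0 : w = 0 by apply: quad_eq0; rewrite /quad /bil wG mul0mx mxE.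
have : (D%:~R : rat) *: v == 0 by rewrite -wE w0 map_mx0.
by rewrite scaler_eq0 intr_eq0 (negbTE D0) (negbTE v0).
Qed.

(** Cramer's rule expresses [\det G] times a coordinate through the products of [v] with the basis
    vectors, and [bil_le] bounds these by multiples of [quad G v]. Finiteness of the fibres and
    convergence both rest on this. *)
Lemma coordinate_bound : exists C : nat, forall (v : 'rV[int]_r) j, (`|v 0%R j| <= C * `|quad G v|)%N.
Proof.
pose C := \sum_k \sum_j `|(quad G (delta_mx 0 k) * \adj G k j)%R|%N.
exists C => v j.
have E : \det G * v 0 j = \sum_k bil G v (delta_mx 0 k) * \adj G k j.
  transitivity ((v *m G *m \adj G) 0 j); first by rewrite -mulmxA mul_mx_adj mul_mx_scalar mxE.
  rewrite mxE; apply: eq_bigr => k _; congr (_ * _); rewrite /bil -[v *m G]mulmx1 [RHS]mxE.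
  rewrite mulmx1 (bigD1 k) //= big1 => [|i /negbTE ik]; first by rewrite !mxE !eqxx mulr1 addr0.
  by rewrite !mxE eqxx ik mulr0.
rewrite -lez_nat PoszM !abszE (ger0_norm (quad_ge0 v)).
have d1 : 1 <= `|\det G| by rewrite -gtz0_ge1 normr_gt0 positive_det.
have : `|v 0 j| <= `|\det G * v 0 j| by rewrite normrM ler_peMl.
move=> h; apply: le_trans h _; rewrite {}E.
apply: le_trans (ler_norm_sum _ _ _) _.
apply: le_trans (_ : \sum_k quad G v * `|quad G (delta_mx 0 k) * \adj G k j| <= _).
  apply: ler_sum => k _; rewrite !normrM mulrA ler_wpM2r // (ger0_norm (quad_ge0 _)); exact: bil_le.
rewrite -mulr_sumr mulrC ler_wpM2r ?quad_ge0 //.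
rewrite /C (big_morph Posz PoszD (erefl _)) ler_sum // => k _.
rewrite (big_morph Posz PoszD (erefl _)) (bigD1 j) //= abszE lerDl.
by apply: sumr_ge0 => *; rewrite le0z_nat.
Qed.

Definition signed_row B (f : {ffun 'I_r -> bool * 'I_B.+1}) : 'rV[int]_r := \row_j ((-1) ^+ (f j).1 * (f j).2%:Z).
Definition signs B (v : 'rV[int]_r) : {ffun 'I_r -> bool * 'I_B.+1} := [ffun j => (v 0 j < 0, inord `|v 0%R j|)].

Lemma signsK B (v : 'rV[int]_r) : (forall j, (`|v 0%R j| <= B)%N) -> signed_row (signs B v) = v.
Proof. by move=> vB; apply/rowP => j; rewrite !mxE ffunE /= inordK ?ltnS // abszE -intEsign. Qed.

Lemma quad_fibre (m : nat) : exists A : {fset 'rV[int]_r}, forall v, (v \in A) = (`|quad G v|%N == m).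
Proof.
have [C CE] := coordinate_bound; pose B := (C * m)%N.
exists [fset v in [seq signed_row f | f : {ffun 'I_r -> bool * 'I_B.+1}] | `|quad G v|%N == m]%fset => v.
rewrite !inE /=; apply/andP/eqP => [[_ /eqP //]|qv]; split; last exact/eqP.
by apply/mapP; exists (signs B v); rewrite ?mem_enum ?signsK // => j; rewrite /B -qv.
Qed.

Lemma geometric_sum_le (R : realType) B : \sum_(k < B.+1) 2^-1 ^+ k <= 2 :> R.
Proof.
suff -> : \sum_(k < B.+1) 2^-1 ^+ k = 2 - 2^-1 ^+ B :> R by rewrite gerBl exprn_ge0 // invr_ge0.
elim: B => [|B IH]; first by rewrite big_ord1 !expr0; lra.
by rewrite big_ord_recr IH /= exprS; field.
Qed.

(** With [|v_j| <= C q(v)] and [r0 = 2^-(r C + 1)], the terms are at most the products of the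
    [2^-|v_j|]. Each coordinate contributes at most 4, that is, two signs times a geometric sum. The
    1 in the exponent keeps [r0] below 1 even if [r C = 0]. *)
Lemma quad_summable (R : realType) : exists2 r0 : R, 0 < r0 < 1 &
  forall A : {fset 'rV[int]_r}, \sum_(v <- A) r0 ^+ `|quad G v|%N <= 4 ^+ r.
Proof.
have [C CE] := coordinate_bound.
have h0 : 0 < 2^-1 :> R by rewrite invr_gt0.
exists (2^-1 ^+ (r * C).+1).
  by rewrite exprn_gt0 //= exprn_ilt1 ?ltW // invf_lt1 // ltr1n.
move=> A; pose w (v : 'rV[int]_r) : R := \prod_j 2^-1 ^+ `|v 0%R j|%N.
apply: le_trans (_ : \sum_(v <- A) w v <= _).
  apply: ler_sum => v _; rewrite -exprM /w prodrXr.
  rewrite ler_wiXn2l ?(ltW h0) // ?invf_le1 ?ler1n //.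
  apply: leq_trans (_ : \sum_(j < r) C * `|quad G v|%N <= _)%N; first by apply: leq_sum => j _; exact: CE.
  by rewrite sum_nat_const card_ord mulnA leq_mul2r leqnSn orbT.
pose B := \max_(v <- A) \max_j `|v 0%R j|%N.
have vB v : v \in A -> forall j, (`|v 0%R j| <= B)%N.
  move=> vA j; apply: leq_trans (_ : \max_j `|v 0%R j|%N <= B)%N; first exact: leq_bigmax.
  by rewrite /B (big_rem v) //= leq_maxl.
pose F (f : {ffun 'I_r -> bool * 'I_B.+1}) : R := \prod_j 2^-1 ^+ (f j).2.
have -> : \sum_(v <- A) w v = \sum_(f <- map (signs B) A) F f.
  rewrite big_map; apply: eq_big_seq => v vA; apply: eq_bigr => j _; rewrite ffunE /= inordK // ltnS; exact: vB.
have us : uniq (map (signs B) A).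
  by rewrite map_inj_in_uniq ?fset_uniq // => v v' vA v'A e; rewrite -(signsK (vB _ vA)) e signsK //; exact: vB.
rewrite big_uniq //=.
apply: le_trans (_ : \sum_f F f <= _).
  rewrite [leRHS](bigID (mem (map (signs B) A))) /= lerDl sumr_ge0 // => f _.
  by apply: prodr_ge0 => j _; rewrite exprn_ge0 // ltW.
rewrite -(bigA_distr_bigA (fun (j : 'I_r) (x : bool * 'I_B.+1) => 2^-1 ^+ x.2 : R)) /=.
have -> : 4 ^+ r = \prod_(j < r) 4 :> R by rewrite prodr_const card_ord.
apply: ler_prod => j _.
rewrite -(pair_big xpredT xpredT (fun (a : bool) (k : 'I_B.+1) => 2^-1 ^+ k : R)) /= big_bool /=.
have := geometric_sum_le R B; set S := \sum_k _ => S2.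
have S0 : 0 <= S by apply: sumr_ge0 => k _; rewrite exprn_ge0 // ltW.
by apply/andP; split; lra.
Qed.
End Bounds.


(** * Forms in at most three variables with the same values *)

Section Isometry.

Definition same_values r (G H : 'M[int]_r) : Prop :=
  exists2 f : 'rV[int]_r -> 'rV[int]_r, bijective f & forall v, quad H (f v) = quad G v.

Definition theta_determines r : Prop := forall G H : 'M[int]_r, positive_form G -> positive_form H ->
  same_values G H -> exists2 U : 'M[int]_r, U \in unitmx & forall v, quad H (v *m U) = quad G v.

Lemma In_mem (T : eqType) (x : T) (s : seq T) : List.In x s <-> x \in s.
Proof.
elim: s => //= y s IH; rewrite inE; split=> [[->|/IH ->]|/orP[/eqP ->|/IH]]; rewrite ?eqxx ?orbT //; by [left|right].
Qed.
Lemma uniq_NoDup (T : eqType) (s : seq T) : uniq s -> List.NoDup s.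
Proof.
elim: s => [|x s IH] /=; first by move=> _; constructor.
by move=> /andP[xs us]; constructor; [move/In_mem; apply/negP|exact: IH].
Qed.

Definition row3 (v : Ternary.v3) : 'rV[int]_3 :=
  \row_(i < 3) nth 0 [:: int_of_Z v.1.1; int_of_Z v.1.2; int_of_Z v.2] i.
Definition triple (v : 'rV[int]_3) : Ternary.v3 := (Z_of_int (v 0 0), Z_of_int (v 0 1), Z_of_int (v 0 2%R)).
Definition coefficients (G : 'M[int]_3) : seq BinNums.Z :=
  [:: Z_of_int (G 0 0); Z_of_int (G 1 1); Z_of_int (G 2%R 2%R); Z_of_int (G 1 2%R); Z_of_int (G 0 2%R); Z_of_int (G 0 1)].

Lemma row3K : cancel row3 triple.
Proof. by case=> [[x y] z]; rewrite /triple !mxE /= !int_of_ZK. Qed.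
Lemma tripleK : cancel triple row3.
Proof.
move=> v; apply/rowP => -[[|[|[|]]] // p]; rewrite !mxE /= Z_of_intK; congr (v _ _); exact/val_inj.
Qed.

Lemma qf_quad (G : 'M[int]_3) v : G^T = G -> Ternary.qf (coefficients G) v = Z_of_int (quad G (row3 v)).
Proof.
move=> Gs; rewrite -[v]row3K; move: (row3 v) => {}v; rewrite tripleK.
have s01 : G 1 0 = G 0 1 by rewrite -{1}Gs mxE.
have s02 : G 2%R 0 = G 0 2%R by rewrite -{1}Gs mxE.
have s12 : G 2%R 1 = G 1 2%R by rewrite -{1}Gs mxE.
have E : quad G v = v 0 0 * v 0 0 * G 0 0 + (v 0 1 * v 0 1 * G 1 1 + (v 0 2%R * v 0 2%R * G 2%R 2%R +
   (2 * v 0 1 * v 0 2%R * G 1 2%R + (2 * v 0 0 * v 0 2%R * G 0 2%R + (2 * v 0 0 * v 0 1 * G 0 1 + 0))))).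
  rewrite /quad /bil !mxE !big_ord_recl !big_ord0 !mxE !big_ord_recl !big_ord0.
  have -> : ord0 = 0 :> 'I_3 by exact/val_inj. 
  have -> : lift ord0 ord0 = 1 :> 'I_3 by exact/val_inj.
  have -> : lift ord0 (lift ord0 ord0) = 2%R :> 'I_3 by exact/val_inj.
  rewrite s01 s02 s12; ring.
by rewrite E !(rmorphD, rmorphM) /=.
Qed.
End Isometry.

Lemma row3_nonzero v : Ternary.nonzero v = true <-> row3 v != 0.
Proof.
have E : row3 v == 0 = (v == (BinNums.Z0, BinNums.Z0, BinNums.Z0)).
  rewrite -(can_eq tripleK) row3K; congr (v == _).
  by rewrite /triple !mxE.
rewrite E; case: v {E} => [[x y] z]; rewrite /= !xpair_eqE /=.
have eqE (t : BinNums.Z) : (t == BinNums.Z0) = BinInt.Z.eqb t BinNums.Z0.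
  by apply/eqP/idP => [->//|/BinInt.Z.eqb_eq].
rewrite !eqE; by case: (BinInt.Z.eqb x _); case: (BinInt.Z.eqb y _); case: (BinInt.Z.eqb z _).
Qed.

Lemma coefficients_posdef G : positive_form G -> Ternary.posdef (coefficients G).
Proof.
move=> GP v /row3_nonzero v0; rewrite qf_quad ?GP.1 //.
have := GP.2 _ v0; lia.
Qed.

Lemma coefficients_equi G H : positive_form G -> positive_form H -> same_values G H ->
  Ternary.equi (Ternary.qf (coefficients G)) Ternary.nonzero (Ternary.qf (coefficients H)) Ternary.nonzero.
Proof.
move=> GP HP [f [g fK gK] fE].
have f0 v : (f v == 0) = (v == 0).
  apply/eqP/eqP => [fv|->]; [apply: (quad_eq0 GP); rewrite -fE fv|apply: (quad_eq0 HP); rewrite fE]; exact: quad0.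
apply: (@Ternary.equi_map _ _ _ _ _ _ (triple \o f \o row3) (triple \o g \o row3)).
- move=> m; have [A AE] := quad_fibre GP `|int_of_Z m|%N.
  exists [seq triple v | v <- A & (quad G v == int_of_Z m) && (v != 0)]; split.
    by apply/uniq_NoDup; rewrite (map_inj_uniq (can_inj tripleK)) filter_uniq ?fset_uniq.
  move=> v; split=> [/In_mem/mapP[w]|[/row3_nonzero v0 qv]].
    rewrite mem_filter => /andP[/andP[/eqP qw w0] _] ->; split; first by apply/row3_nonzero; rewrite tripleK.
    by rewrite qf_quad ?GP.1 // tripleK qw int_of_ZK.
  apply/In_mem/mapP; exists (row3 v); rewrite ?row3K // mem_filter v0 AE -qv qf_quad ?GP.1 //.
  by rewrite Z_of_intK !eqxx.
- move=> v /row3_nonzero v0; split; [|split].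
  + by apply/row3_nonzero; rewrite /comp tripleK f0.
  + by rewrite /comp tripleK fK row3K.
  + by rewrite /comp !qf_quad ?GP.1 ?HP.1 // tripleK fE.
- move=> w /row3_nonzero w0; split; last by rewrite /comp tripleK gK row3K.
  by apply/row3_nonzero; rewrite /comp tripleK -f0 gK.
Qed.

Lemma int_of_ZM x y : int_of_Z (BinInt.Z.mul x y) = int_of_Z x * int_of_Z y. Proof. by lia. Qed.
Lemma int_of_ZD x y : int_of_Z (BinInt.Z.add x y) = int_of_Z x + int_of_Z y. Proof. by lia. Qed.
Lemma int_of_ZB x y : int_of_Z (BinInt.Z.sub x y) = int_of_Z x - int_of_Z y. Proof. by lia. Qed.

Lemma theta_determines3 : theta_determines 3.
Proof.
move=> G H GP HP GH.
have [[[y1 y2] y3] [du uE]] := @Ternary.ternary_theta (coefficients G) (coefficients H) (erefl _) (erefl _)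
  (coefficients_posdef GP) (coefficients_posdef HP) (coefficients_equi GP HP GH).
pose U : 'M[int]_3 := \matrix_(i, j) row3 (nth y1 [:: y1; y2; y3] i) 0 j.
exists U.
  have dU : \det U = int_of_Z (Ternary.det3 (y1, y2, y3)).
    rewrite (expand_det_row _ ord0) !big_ord_recl big_ord0 /cofactor !(expand_det_row _ ord0) !big_ord_recl !big_ord0 /cofactor.
    rewrite !det_mx11 !mxE /=; case: y1 y2 y3 {U uE du} => [[a b] c] [[d e] f] [[g h] i] /=.
    rewrite !(int_of_ZM, int_of_ZD, int_of_ZB); ring.
  by rewrite unitmxE dU; case: du => ->.
move=> v; apply: (can_inj Z_of_intK); rewrite -[in RHS](tripleK v) -qf_quad ?GP.1 // uE qf_quad ?HP.1 //.
congr (Z_of_int (quad H _)); apply/rowP => j; rewrite !mxE !big_ord_recl big_ord0 !mxE /=.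
have -> : ord0 = 0 :> 'I_3 by exact/val_inj. 
have -> : lift ord0 ord0 = 1 :> 'I_3 by exact/val_inj.
have -> : lift ord0 (lift ord0 ord0) = 2%R :> 'I_3 by exact/val_inj.
case: y1 y2 y3 {U uE du} => [[a b] c] [[d e] f] [[g h] i].
by case: j => -[|[|[|]]] //= p; rewrite !(int_of_ZM, int_of_ZD) !Z_of_intK addr0.
Qed.

Lemma theta_determines_pred r : theta_determines (r + 1) -> theta_determines r.
Proof.
move=> IH G H GP HP [f [g fK gK] fE].
pose N : int := 1 + \sum_i quad G (delta_mx 0 i).
have qG i : quad G (delta_mx 0 i) < N.
  rewrite /N (bigD1 i) //= addrCA ltrDl; apply: ltr_wpDr; last by [].
  by apply: sumr_ge0 => k _; exact: quad_ge0.
have N0 : 0 < N by rewrite /N; apply: ltr_wpDr => //; apply: sumr_ge0 => k _; exact: quad_ge0.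
pose pad (M : 'M[int]_r) : 'M[int]_(r + 1) := block_mx M 0 0 N%:M.
have padE M v z : quad (pad M) (row_mx v (z%:M : 'M_1)) = quad M v + N * z ^+ 2.
  rewrite /quad /bil /pad mul_row_block tr_row_mx mul_row_col !mulmx0 addr0 add0r mxE; congr (_ + _).
  by rewrite tr_scalar_mx -!scalar_mxM mxE eqxx mulr1n; ring.
have splitE (w : 'rV[int]_(r + 1)) : w = row_mx (lsubmx w) ((rsubmx w 0 0)%:M : 'M_1) by rewrite -mx11_scalar hsubmxK.
have padP M : positive_form M -> positive_form (pad M).
  move=> MP; split; first by rewrite /pad tr_block_mx MP.1 !trmx0 tr_scalar_mx.
  move=> w w0; rewrite (splitE w) padE; have q0 := quad_ge0 MP (lsubmx w).
  have [z0|z0] := eqVneq (rsubmx w 0 0) 0; last first.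
    by apply: ltr_wpDl => //; rewrite mulr_gt0 // lt_neqAle eq_sym sqrf_eq0 z0 sqr_ge0.
  rewrite z0 expr0n mulr0 addr0 MP.2 //; apply: contraNneq w0 => l0.
  by rewrite (splitE w) l0 z0 raddf0 row_mx0.
have [|U Uu UE] := IH (pad G) (pad H) (padP _ GP) (padP _ HP).
  exists (fun w => row_mx (f (lsubmx w)) ((rsubmx w 0 0)%:M : 'M_1)); last first.
    by move=> w; rewrite padE fE [in RHS](splitE w) padE.
  exists (fun w => row_mx (g (lsubmx w)) ((rsubmx w 0 0)%:M : 'M_1)) => w;
    by rewrite row_mxKl row_mxKr mxE eqxx mulr1n ?fK ?gK -splitE.
(* The images of the basis vectors are shorter than [N], hence have no last component. *)
have ur0 : ursubmx U = 0.
  apply/matrixP => i j; rewrite ord1 [RHS]mxE.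
  have := UE (row_mx (delta_mx 0 i) ((0 : int)%:M : 'M_1)); rewrite padE expr0n mulr0 addr0 (splitE (_ *m U)) padE => h.
  have z0 : rsubmx (row_mx (delta_mx 0 i) ((0 : int)%:M : 'M_1) *m U) 0 0 = ursubmx U i 0.
    rewrite -[U in LHS]submxK mul_row_block row_mxKr raddf0 mul0mx addr0 -rowE.
    by rewrite mxE.
  rewrite z0 in h; have q0 := quad_ge0 HP (lsubmx (row_mx (delta_mx 0 i) ((0 : int)%:M : 'M_1) *m U)).
  have := qG i; rewrite -h; move: (ursubmx U i 0) (quad H _) q0 => z q q0; clear -q0 N0; move: N N0 => N' N0' lt.
  apply/eqP/contraT => zn; have : 1 <= z ^+ 2 by rewrite -gtz0_ge1 lt_neqAle sqr_ge0 eq_sym sqrf_eq0 zn.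
  move: (z ^+ 2) lt => z2 lt; nia.
exists (ulsubmx U).
  move: Uu; rewrite !unitmxE -[U in \det U]submxK ur0 det_lblock unitrM => /andP[]//.
move=> v; have := UE (row_mx v ((0 : int)%:M : 'M_1)); rewrite padE expr0n mulr0 addr0 => <-.
rewrite -[U in RHS]submxK ur0 mul_row_block raddf0 !mul0mx mulmx0 !addr0.
by have := padE H (v *m ulsubmx U) 0; rewrite raddf0 expr0n mulr0 addr0 => ->.
Qed.

Lemma theta_determines_le3 r : (r <= 3)%N -> theta_determines r.
Proof.
have t3 := theta_determines3; have t2 := theta_determines_pred (t3 : theta_determines (2 + 1)).
have t1 := theta_determines_pred (t2 : theta_determines (1 + 1)).
have t0 := theta_determines_pred (t1 : theta_determines (0 + 1)).
by case: r => [|[|[|[|]]]].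
Qed.

(** * Theta series *)

Section Sums.
Local Open Scope classical_set_scope.

Lemma partial_sumE (I : choiceType) (V : zmodType) (x : I -> V) (A : {fset I}) :
  partial_sum x A = \sum_(i <- A) x i.
Proof. by rewrite /partial_sum big_seq_fsetE. Qed.

Lemma sum_reindex (I J : choiceType) (K : numDomainType) (V : normedModType K)
    (h : I -> J) (g : J -> I) (x : J -> V) : cancel h g -> cancel g h ->
  summability.sum (x \o h) = summability.sum x.
Proof.
move=> hK gK; rewrite /summability.sum; congr (lim _).
suff sub (I' J' : choiceType) (h' : I' -> J') (g' : J' -> I') (y : J' -> V) :
    cancel h' g' -> cancel g' h' ->
    (partial_sum (y \o h') @ totally) `<=` (partial_sum y @ totally).
  apply/seteqP; split; first exact: sub hK gK.
  have -> : x = (x \o h) \o g by apply/funext => j /=; rewrite gK.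
  apply: subset_trans (sub _ _ _ _ _ gK hK) _.
  by have -> : (((x \o h) \o g) \o h) = x \o h by apply/funext => j /=; rewrite hK.
move=> {hK gK} hK gK P [A _ AP]; exists (h' @` A)%fset => //= B /= AB.
have := AP (g' @` B)%fset; rewrite /= !partial_sumE.
rewrite big_imfset /=; last by move=> ? ? _ _; exact: can_inj gK _ _.
under eq_bigr do rewrite gK.
apply; apply/fsubsetP => a aA; apply/imfsetP; exists (h' a) => //=.
by apply: (fsubsetP AB); apply/imfsetP; exists a.
Qed.

Section Real.
Variable R : realType.

Definition supsum (I : choiceType) (t : I -> R) : R := sup [set \sum_(i <- A) t i | A in [set: {fset I}]].

Lemma supsum_has_sup (I : choiceType) (t : I -> R) (M : R) :
  (forall A : {fset I}, \sum_(i <- A) t i <= M) -> has_sup [set \sum_(i <- A) t i | A in [set: {fset I}]].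
Proof.
move=> H; split; first by exists (\sum_(i <- fset0) t i); exists fset0.
by exists M => _ [A _ <-].
Qed.

Lemma sum_nonneg (I : choiceType) (t : I -> R) (M : R) : (forall i, 0 <= t i) ->
  (forall A : {fset I}, \sum_(i <- A) t i <= M) ->
  summability.sum (fun i => (t i)%:C%C : (R[i] : numFieldType)) = ((supsum t)%:C)%C.
Proof.
move=> t0 tM; have hs := supsum_has_sup tM.
have FF : ProperFilter (@totally I) by exact: totally_filter.
apply: cvg_lim; first exact: norm_hausdorff.
apply/cvgrPdist_lt => e e0.
have eR : e = ((complex.Re e)%:C)%C by move: (e0 : (0 : R[i]) < e); rewrite ltcE /= => /andP[/eqP ime _]; case: e ime {e0} => a b /= ->.
have e0' : 0 < complex.Re e by move: (e0 : (0 : R[i]) < e); rewrite ltcE /= => /andP[].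
have [_ [A _ <-] hA] := sup_adherent e0' hs.
exists A => // B /= AB; rewrite partial_sumE.
have -> : \sum_(i <- B) (t i)%:C%C = (\sum_(i <- B) t i)%:C%C :> R[i] by rewrite rmorph_sum.
rewrite -rmorphB /= eR normc_def /= expr0n /= addr0 sqrtr_sqr ltcR.
have B1 : \sum_(i <- B) t i <= supsum t by apply: ub_le_sup; [exact: hs.2|exists B].
rewrite ger0_norm ?subr_ge0 // ltrBlDr addrC -ltrBlDr.
apply: lt_le_trans hA _.
rewrite (big_fsetID _ (mem A) B) /= ler_wpDr //; first by apply: sumr_ge0 => *.
rewrite le_eqVlt; apply/orP; left; apply/eqP; apply: eq_fbigl => i.
by rewrite !inE; apply/idP/andP => [iA|[]//]; split=> //; exact: (fsubsetP AB).
Qed.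

Lemma low_part (I : choiceType) (q : I -> nat) (A : {fset I}) (r : R) m :
  \sum_(i <- A | (q i <= m)%N) r ^+ q i = \sum_(k < m.+1) r ^+ k *+ count (fun i => q i == k) A.
Proof.
rewrite (partition_big (fun i => inord (q i) : 'I_m.+1) predT) //=.
apply: eq_bigr => k _.
rewrite (eq_bigl (fun i => q i == k)) => [|i].
  rewrite (eq_bigr (fun=> r ^+ k)) => [|i /eqP -> //].
  by rewrite big_const_seq iter_addr_0.
apply/andP/eqP => [[qi /eqP <-]|qi]; first by rewrite inordK.
by rewrite qi -ltnS ltn_ord; split=> //; apply/eqP/val_inj; rewrite /= inordK.
Qed.

Lemma count_fibre_le (I : choiceType) (q : I -> nat) (f : {fset I}) (A : {fset I}) k :
  (forall i, (i \in f) = (q i == k)) -> (count (fun i => q i == k) A <= #|` f|)%N.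
Proof.
move=> fE; rewrite -size_filter.
apply: uniq_leq_size; first by rewrite filter_uniq.
by move=> i; rewrite mem_filter fE => /andP[].
Qed.

(** Coefficients are compared at a small positive [r]. If the counts first differ at [m], and in the
    wrong direction, an extra term [r^m] on one side outweighs the whole tail of the other, which is
    bounded through the sum at [r0]. *)
Lemma fibre_card_le (I J : choiceType) (q : I -> nat) (q' : J -> nat)
    (f : nat -> {fset I}) (f' : nat -> {fset J}) (r0 M : R) m :
  (forall k i, (i \in f k) = (q i == k)) -> (forall k i, (i \in f' k) = (q' i == k)) ->
  0 < r0 -> r0 < 1 ->
  (forall A : {fset I}, \sum_(i <- A) r0 ^+ q i <= M) ->
  (forall A : {fset J}, \sum_(i <- A) r0 ^+ q' i <= M) ->
  (forall r, 0 < r <= r0 -> supsum (fun i => r ^+ q' i) <= supsum (fun i => r ^+ q i)) ->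
  (forall k, (k < m)%N -> #|` f k| = #|` f' k|) -> (#|` f' m| <= #|` f m|)%N.
Proof.
move=> fE f'E r00 r01 hM hM' hs hk; rewrite leqNgt; apply/negP => lt.
have M0 : 0 <= M by apply: le_trans (hM fset0); rewrite big_seq_fset0.
(* With this choice the bound [(r / r0)^(m+1) M] for the tail equals [r^m M / (M + 1)], which is
   less than [r^m]. *)
have [r rE] : exists r, r = r0 ^+ m.+1 / (M + 1) by exists (r0 ^+ m.+1 / (M + 1)).
have M1 : 0 < M + 1 by lra.
have r_gt0 : 0 < r by rewrite rE divr_gt0 ?exprn_gt0.
have r_le : r <= r0.
  rewrite rE ler_pdivrMr // exprS ler_pM2l //.
  by apply: le_trans (_ : 1 <= _); [rewrite exprn_ile1 ?ltW|lra].
have rr0 (q0 : nat) : r ^+ q0 <= r0 ^+ q0 by apply: lerXn2r; rewrite ?nnegrE ?(ltW r_gt0) ?(ltW r00).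
have bnd (T : choiceType) (p : T -> nat) (A : {fset T}) : (forall A : {fset T}, \sum_(i <- A) r0 ^+ p i <= M) ->
    \sum_(i <- A) r ^+ p i <= M.
  by move=> h; apply: le_trans (h A); apply: ler_sum => i _; exact: rr0.
have := hs r; rewrite r_gt0 r_le => /(_ isT).
apply/negP; rewrite -ltNge.
pose S := \sum_(k < m.+1) r ^+ k *+ #|` f k|.
apply: (@le_lt_trans _ _ (S + (r / r0) ^+ m.+1 * M)).
  apply: ge_sup; first by exists (\sum_(i <- fset0) r ^+ q i); exists fset0.
  move=> _ [A _ <-]; rewrite (bigID (fun i => q i <= m)%N) /= lerD //.
    rewrite low_part; apply: ler_sum => k _; apply: ler_wpMn2l; first by rewrite exprn_ge0 ?ltW.
    exact: count_fibre_le.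
  apply: le_trans (_ : (r / r0) ^+ m.+1 * \sum_(i <- A | ~~ (q i <= m)%N) r0 ^+ q i <= _).
    rewrite mulr_sumr; apply: ler_sum => i; rewrite -ltnNge => mi.
    move: (q i - m.+1)%N (subnK mi) => k <-.
    rewrite expr_div_n [r ^+ (k + _)%N]exprD [r0 ^+ (k + _)%N]exprD mulrCA divfK ?expf_neq0 ?gt_eqF //.
    by rewrite ler_pM2r ?exprn_gt0 //; exact: rr0.
  apply: ler_wpM2l; first by rewrite exprn_ge0 // divr_ge0 ?ltW.
  apply: le_trans (hM A); rewrite [leRHS](bigID (fun i => q i <= m)%N) /= ler_wpDl //.
  by apply: sumr_ge0 => i _; rewrite exprn_ge0 ?ltW.
pose B := (\bigcup_(k <- iota 0 m.+1) f' k)%fset.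
apply: (@lt_le_trans _ _ (\sum_(i <- B) r ^+ q' i)); last first.
  apply: ub_le_sup; last by exists B.
  by exists M => _ [A _ <-]; exact: bnd.
apply: lt_le_trans (_ : \sum_(k < m.+1) r ^+ k *+ #|` f' k| <= _); last first.
  rewrite [leRHS](bigID (fun i => q' i <= m)%N) /= low_part ler_wpDr //.
    by apply: sumr_ge0 => i _; rewrite exprn_ge0 ?ltW.
  apply: ler_sum => k _; apply: ler_wpMn2l; first by rewrite exprn_ge0 ?ltW.
  rewrite -size_filter; apply: uniq_leq_size; first exact: fset_uniq.
  move=> i ik; rewrite mem_filter -f'E ik /=.
  by apply/bigfcupP; exists (k : nat) => //; rewrite mem_iota /= add0n ltn_ord.
rewrite /S !big_ord_recr /= (eq_bigr (fun k : 'I_m => r ^+ k *+ #|` f' k|)) => [|k _]; last by rewrite hk.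
rewrite -addrA ltrD2l.
apply: lt_le_trans (_ : r ^+ m *+ (#|` f m|).+1 <= _); last by apply: ler_wpMn2l => //; rewrite exprn_ge0 ?ltW.
have -> : (r / r0) ^+ m.+1 * M = r ^+ m * (M / (M + 1)).
  rewrite expr_div_n exprS {1}rE; have z0 : r0 ^+ m.+1 != 0 by rewrite expf_neq0 ?gt_eqF.
  move: (r0 ^+ m.+1) z0 => z z0.
  by field; rewrite z0 gt_eqF.
rewrite mulrSr ltrD2l gtr_pMr ?exprn_gt0 //.
by rewrite ltr_pdivrMr // mul1r; lra.
Qed.
End Real.

End Sums.

(** * The theta series on the imaginary axis *)

Section ThetaValues.
Local Open Scope classical_set_scope.

Definition parametrizes (F : fieldExtType rat) r (G : 'M[int]_r) (h : 'rV[int]_r -> F) : Prop :=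
  set_bij setT (trace_zero_integers F) h /\ forall v, field_trace (h v ^+ 2) = (quad G v)%:~R.

Lemma cexp_imaginary (R : realType) (m : int) (y : R) : 0 <= m ->
  cexp (Complex 0 (pi : R) * ratr (m%:~R : rat) * Complex 0 y) = ((expR (- (pi * y)) ^+ `|m|%N)%:C)%C.
Proof.
move=> m0; have -> : ratr (m%:~R : rat) = ((m%:~R : R)%:C)%C :> R[i] by rewrite ratr_int rmorph_int.
have -> : Complex 0 (pi : R) * ((m%:~R : R)%:C)%C * Complex 0 y = ((`|m|%N%:R * - (pi * y) : R)%:C)%C.
  rewrite -[in LHS](gez0_abs m0); apply/eqP; rewrite eq_complex /=; apply/andP; split; apply/eqP; rewrite /=.
    by rewrite -pmulrn; ring.
  by ring.
by rewrite /cexp /= cos0 sin0 mulr1 mulr0 expRM_natl.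
Qed.

Lemma eq_sum (R : realType) (I : choiceType) (x y : I -> (R[i] : numFieldType)) :
  x =1 y -> summability.sum x = summability.sum y :> R[i].
Proof. by move=> /funext ->. Qed.

Lemma theta_quad (R : realType) (F : fieldExtType rat) r (G : 'M[int]_r) h (y : R) (y0 : 0 < y) : positive_form G ->
  @parametrizes F r G h ->
  theta F (exist (fun z : R[i] => is_true (0 < complex.Im z)) (Complex 0 y) y0) =
  summability.sum (fun v => (expR (- (pi * y)) ^+ `|quad G v|%N)%:C%C : (R[i] : numFieldType)).
Proof.
move=> GP [[hT hI hS] hq].
have hO v : h v \in trace_zero_integers F by apply/mem_set/hT.
pose H v : trace_zero_integers F := exist _ (h v) (hO v).
have /choice[g gE] : forall a : trace_zero_integers F, exists v, H v = a.
  move=> a; have [v _ va] := hS (\val a) (set_mem (valP a)); exists v; exact/val_inj.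
have HK : cancel H g.
  move=> v; apply: hI; rewrite ?inE //; by have := congr1 val (gE (H v)).
rewrite /theta -(sum_reindex _ HK gE); apply: eq_sum => v.
by rewrite /comp [X in ratr (field_trace (X ^+ 2))]/= hq -cexp_imaginary ?quad_ge0.
Qed.

Lemma theta_same_values (R : realType) (K L : fieldExtType rat) r (G H : 'M[int]_r) hK hL :
  positive_form G -> positive_form H -> @parametrizes K r G hK -> @parametrizes L r H hL ->
  theta K = theta L :> (upper_half_plane R -> R[i]) -> same_values G H.
Proof.
move=> GP HP Kh Lh KL.
have [a /andP[a0 a1] aS] := quad_summable GP R; have [b /andP[b0 b1] bS] := quad_summable HP R.
pose r0 := Num.min a b.
have r00 : 0 < r0 by rewrite lt_min a0.
have r01 : r0 < 1 by rewrite gt_min a1.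
have mono (M : 'M[int]_r) (x x' : R) : 0 < x -> x <= x' -> (forall A : {fset 'rV[int]_r}, \sum_(v <- A) x' ^+ `|quad M v|%N <= 4 ^+ r) ->
    forall A : {fset 'rV[int]_r}, \sum_(v <- A) x ^+ `|quad M v|%N <= 4 ^+ r.
  move=> x0 xx' S A; apply: le_trans (S A); apply: ler_sum => v _.
  by apply: lerXn2r; rewrite ?nnegrE ?(ltW x0) ?(le_trans (ltW x0)).
have ra : r0 <= a by rewrite ge_min lexx.
have rb : r0 <= b by rewrite ge_min lexx orbT.
have aS0 := mono G _ _ r00 ra aS.
have bS0 := mono H _ _ r00 rb bS.
have supE x : 0 < x <= r0 -> supsum (fun v => x ^+ `|quad G v|%N) = supsum (fun v => x ^+ `|quad H v|%N).
  (* At [z = iy] the term of a vector is [exp(- pi y)] to the power of its value, which for this [y]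
     is a power of [x]. *)
  move=> /andP[x0 xr]; pose y := - ln x / pi.
  have x1 := le_lt_trans xr r01.
  have y0 : 0 < y by rewrite divr_gt0 ?pi_gt0 // oppr_gt0 ln_lt0 // x0.
  have xE : expR (- (pi * y)) = x.
    by rewrite /y mulrCA mulfV ?gt_eqF ?pi_gt0 // mulr1 opprK lnK // posrE.
  have := congr1 (fun f => f (exist (fun z : R[i] => is_true (0 < complex.Im z)) (Complex 0 y) y0)) KL.
  rewrite (theta_quad y0 GP Kh) (theta_quad y0 HP Lh) xE.
  have x0' v (M : 'M[int]_r) : 0 <= x ^+ `|quad M v|%N by rewrite exprn_ge0 ?ltW.
  rewrite (sum_nonneg (M := 4 ^+ r)) // ?(sum_nonneg (M := 4 ^+ r)) //; last 2 first.
  - exact: mono xr bS0.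
  - exact: mono xr aS0.
  by move=> /(congr1 (@complex.Re R)).
have /choice[f fE] := quad_fibre GP; have /choice[f' fE'] := quad_fibre HP.
have card m : #|` f m| = #|` f' m|.
  elim/ltn_ind: m => m IH; apply/eqP; rewrite eqn_leq; apply/andP; split.
    apply: (fibre_card_le (q := fun v => `|quad H v|%N) (q' := fun v => `|quad G v|%N) (f := f') (f' := f) (r0 := r0) (M := 4 ^+ r)) => //.
      by move=> x /supE ->.
    by move=> k /IH.
  apply: (fibre_card_le (q := fun v => `|quad G v|%N) (q' := fun v => `|quad H v|%N) (f := f) (f' := f') (r0 := r0) (M := 4 ^+ r)) => //.
  by move=> x /supE ->.
(* A vector is sent to the one in the same position in the fibre of the other form. *)
have build (M N : 'M[int]_r) (p p' : nat -> {fset 'rV[int]_r}) :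
    (forall k v, (v \in p k) = (`|quad M v|%N == k)) -> (forall k v, (v \in p' k) = (`|quad N v|%N == k)) ->
    (forall m, #|` p m| = #|` p' m|) ->
    forall v, let w := nth 0 (p' `|quad M v|%N) (index v (p `|quad M v|%N)) in
     `|quad N w|%N = `|quad M v|%N /\ nth 0 (p `|quad N w|%N) (index w (p' `|quad N w|%N)) = v.
  move=> pE p'E c v w.
  have vp : v \in p `|quad M v|%N by rewrite pE.
  have sz : (index v (p `|quad M v|%N) < size (p' `|quad M v|%N))%N by rewrite -[size _]/(#|` p' _|) -c index_mem.
  have qw : `|quad N w|%N = `|quad M v|%N by apply/eqP; rewrite -p'E mem_nth.
  by split=> //; rewrite qw index_uniq ?fset_uniq // nth_index.
have B1 := build _ _ _ _ fE fE' card; have B2 := build _ _ _ _ fE' fE (fun m => esym (card m)).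
exists (fun v => nth 0 (f' `|quad G v|%N) (index v (f `|quad G v|%N))).
  by exists (fun w => nth 0 (f `|quad H w|%N) (index w (f' `|quad H w|%N))) => v; [have [_ ->] := B1 v|have [_ ->] := B2 v].
by move=> v; have [qv _] := B1 v; rewrite -(gez0_abs (quad_ge0 HP _)) qv gez0_abs ?quad_ge0.
Qed.

End ThetaValues.

(** * Bases adapted to the trace *)

Section Basis.
Variables (R : realType) (F : fieldExtType rat) (r : nat) (s : 'I_r.+1 -> {rmorphism F -> R}).
Hypothesis sE : all_embeddings s.

Lemma zspan_gram (b : 'I_r.+1 -> F) : zspan b -> exists T e, gram_basis b T e.
Proof.
move=> bz; have [e eE] := bz.2 1 (@integral1 _ _ (intr : {rmorphism int -> F})).
have tr i j : exists z : int, field_trace (b i * b j) = z%:~R.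
  by apply: (trace_int sE.1); apply: ring_of_integersM; exact: bz.1.
have /choice[f fE] : forall ij : 'I_r.+1 * 'I_r.+1, exists z : int, field_trace (b ij.1 * b ij.2) = z%:~R by move=> ij.
by exists (\matrix_(i, j) f (i, j)), e; split=> // i j; rewrite mxE -fE.
Qed.

Lemma gram_basis_of_discriminant (d : int) : \dim {:F} = r.+1 -> discriminant F = d -> d != 0 ->
  exists (b : 'I_r.+1 -> F) T e, gram_basis b T e /\ \det T = d.
Proof.
move=> dimF dF d0; set P := [set d : int | exists2 b : (\dim {:F}).-tuple F, integral_basis b & \det (trace_gram b) = d%:~R :> rat]%classic.
(* A nonzero discriminant is not the default value 0, so it comes from an integral basis. *)
have Pd : P d.
  have [[z Pz]|noP] := pselect (exists z, P z).
    by rewrite -dF /discriminant; exact: (@xgetPex _ 0 P (ex_intro _ z Pz)).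
  by move: d0; rewrite -dF /discriminant xgetPN ?eqxx // => z Pz; apply: noP; exists z.
case: Pd => b [bT bI bS]; move: b bT bI bS; rewrite dimF => b bT _ bS bd.
have comb (v : 'I_r.+1 -> int) : int_comb b (finfun v) = \sum_j tnth b j *~ v j.
  by apply: eq_bigr => j _; rewrite ffunE.
have bz : zspan (tnth b).
  split=> [j|x /bS[v _ <-]]; last by exists v; rewrite -comb; congr int_comb; apply/ffunP => j; rewrite ffunE.
  have -> : tnth b j = int_comb b (finfun (fun i => (i == j)%:R : int)).
    by rewrite comb (bigD1 j) //= eqxx mulr1z big1 ?addr0 // => i /negbTE ->; rewrite mulr0z.
  exact: bT.
have [T [e bTe]] := zspan_gram bz; exists (tnth b), T, e; split=> //.
apply: (@intr_inj rat); rewrite -bd -det_map_mx; congr (\det _); apply/matrixP => i j.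
by have [_ bTr _] := bTe; rewrite !mxE bTr.
Qed.

Definition change (b : 'I_r.+1 -> F) (W : 'M[int]_r.+1) i := \sum_j b j *~ W i j.

Lemma change_comb b W (u : 'rV[int]_r.+1) : \sum_i change b W i *~ u 0 i = \sum_j b j *~ (u *m W) 0 j.
Proof.
under eq_bigr do rewrite /change mulrz_suml.
rewrite exchange_big; apply: eq_bigr => j _; rewrite mxE mulrz_sumr; apply: eq_bigr => i _.
by rewrite -mulrzA mulrC.
Qed.

Lemma change_basis b T e W : gram_basis b T e -> W \in unitmx ->
  exists T' e', gram_basis (change b W) T' e' /\ \det T' = \det T.
Proof.
move=> bT Wu; have [bz _ _] := bT.
have cz : zspan (change b W).
  split=> [i|x /bz.2[v ->]]; first exact: zcomb_integral.
  exists (fun i => (\row_j v j *m invmx W) 0 i); rewrite change_comb mulmxKV //.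
  by apply: eq_bigr => j _; rewrite mxE.
have [T' [e' cT]] := zspan_gram cz; exists T', e'; split=> //.
apply: (@intr_inj R); rewrite -(cmx_det_sqr sE cT) -(cmx_det_sqr sE bT).
have -> : cmx s (change b W) = cmx s b *m (map_mx intr W)^T.
  apply/matrixP => k i; rewrite !mxE rmorph_sum; apply: eq_bigr => j _.
  by rewrite !mxE (rmorphMz (s k)) -[s k _ *~ _]mulrzr.
rewrite det_mulmx det_tr det_map_mx exprMn -rmorphXn /=.
have -> : (\det W) ^+ 2 = 1.
  have : (\det W) \is a GRing.unit by rewrite -unitmxE.
  by case/orP => /eqP ->.
by rewrite mulr1.
Qed.

Lemma gram_mul_coord (b : 'I_r.+1 -> F) T e i : gram_basis b T e -> (\sum_j T i j * e j)%:~R = field_trace (b i).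
Proof. by move=> [bz bT b1]; rewrite -(trace_comb sE.1 bT) -b1 mulr1. Qed.

Lemma trace1 : field_trace (1 : F) = r.+1%:R.
Proof.
apply: (fmorph_inj (ratr : {rmorphism rat -> R})); rewrite /= sE.1 ratr_nat.
under eq_bigr do rewrite rmorph1.
by rewrite sumr_const card_ord.
Qed.

(* When the degree is prime to the discriminant, the trace is onto [Z]: a common divisor [g] of the traces divides the degree,
   and, by Cramer's rule, [d] times the coordinates of 1. *)
Lemma trace_generator (b : 'I_r.+1 -> F) T e (g : int) : gram_basis b T e -> coprimez r.+1%:Z (\det T) ->
  field_trace (b ord0) = g%:~R -> (forall j, field_trace (b (lift ord0 j)) = 0) -> g ^+ 2 = 1.
Proof.
move=> bT cop g0 gj; have [bz bTr b1] := bT.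
have trE i : \sum_j T i j * e j = g *+ (i == ord0).
  apply: (@intr_inj rat); rewrite (gram_mul_coord _ bT).
  by case: (unliftP ord0 i) => [j ->|->]; [rewrite gj eq_sym (negbTE (neq_lift _ _))|rewrite g0 eqxx].
have nE : r.+1%:Z = g * e ord0.
  apply: (@intr_inj rat); rewrite -[LHS]trace1 b1 (field_trace_sum sE.1) big_ord_recl g0 big1 => [|j _].
    by rewrite addr0 intrM mulrC.
  by rewrite gj mulr0.
have gN0 : g != 0 by apply: contra_eq_neq nE => ->; rewrite mul0r.
have [g1|g1] := eqVneq `|g|%N 1%N.
  by rewrite [g]intEsign g1 mulr1 sqrr_sign.
have pp : prime (pdiv `|g|%N) by rewrite pdiv_prime // ltn_neqAle eq_sym g1 absz_gt0.
set p := pdiv _ in pp; have pg : (p%:Z %| g)%Z by rewrite dvdzE; exact: pdiv_dvd.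
have pe j : (p%:Z %| e j)%Z.
  have pde : (p%:Z %| \det T * e j)%Z.
    have <- : (\adj T *m (T *m \col_k e k)) j 0 = \det T * e j.
      by rewrite mulmxA mul_adj_mx mul_scalar_mx !mxE.
    rewrite mxE; apply: dvdz_sumr => k; rewrite dvdz_mull // mxE.
    under eq_bigr do rewrite [(\col_k _) _ _]mxE.
    by rewrite trE; case: eqP => _; rewrite ?mulr1n ?mulr0n ?dvdz0.
  have [pd|//] := prime_dvdzM pp pde.
  have : (p%:Z %| r.+1%:Z)%Z by rewrite nE dvdz_mulr.
  move: cop pd; rewrite coprimezE !dvdzE /= => c pd pn.
  have : (p %| gcdn r.+1 `|\det T|)%N by rewrite dvdn_gcd pn pd.
  by rewrite (eqP (c : coprime _ _)) dvdn1 => /eqP p1; rewrite p1 in pp.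
have oneE : 1 = (\sum_j b j *~ (e j %/ p)%Z) *~ p.
  rewrite b1 mulrz_suml; apply: eq_bigr => j _; by rewrite -mulrzA divzK.
have p0 : p%:R != 0 :> R by rewrite pnatr_eq0 -lt0n prime_gt0.
have sy : s ord0 (\sum_j b j *~ (e j %/ p)%Z) = ratr (p%:R^-1 : rat).
  rewrite fmorphV /= ratr_nat; apply: (mulIf p0); rewrite mulVf //.
  by rewrite -[RHS](rmorph1 (s ord0)) oneE (rmorphMz (s ord0)) -[RHS]mulrzr.
have [|z zE] := @integral_rat R (p%:R^-1 : rat).
  by rewrite -sy; apply: integral_emb; exact: zcomb_integral.
have p0' : p%:R != 0 :> rat by rewrite pnatr_eq0 -lt0n prime_gt0.
have : 1 = z * p by apply: (@intr_inj rat); rewrite intrM -zE mulVf.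
move=> /(congr1 absz); rewrite abszM /= => /esym/eqP; rewrite muln_eq1 => /andP[_ /eqP p1].
by rewrite p1 in pp.
Qed.

(** The Smith normal form of the row of traces gives a basis in which all traces but the first
    vanish. The first one is a sign by [trace_generator], and multiplying the whole basis by it
    makes this trace 1. *)
Lemma normal_basis (b : 'I_r.+1 -> F) T e : gram_basis b T e -> coprimez r.+1%:Z (\det T) ->
  exists (b' : 'I_r.+1 -> F) (T' : 'M[int]_r.+1) (e' : 'I_r.+1 -> int), [/\ gram_basis b' T' e', \det T' = \det T, field_trace (b' ord0) = 1 &
    forall j, field_trace (b' (lift ord0 j)) = 0].
Proof.
move=> bT cop; have [bz _ _] := bT.
have /choice[f fE] : forall j, exists z : int, field_trace (b j) = z%:~R by move=> j; apply: (trace_int sE.1); exact: bz.1.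
pose t : 'rV[int]_r.+1 := \row_j f j.
have [Lm _ [Rm Ru [D _ tE]]] := int_Smith_normal_form t.
pose W := (invmx Rm)^T; have Wu : W \in unitmx by rewrite unitmx_tr unitmx_inv.
have trW (W' : 'M[int]_r.+1) i : field_trace (change b W' i) = ((t *m W'^T) 0 i)%:~R.
  rewrite /change (field_trace_sum sE.1) mxE rmorph_sum; apply: eq_bigr => j _.
  by rewrite !mxE fE -intrM mulrC.
have tW j : (t *m W^T) 0 (lift ord0 j) = 0.
  rewrite /W trmxK tE mulmxK // mxE big_ord1 !mxE /= mulr0 //.
have [T1 [e1 [c1 d1]]] := change_basis bT Wu.
pose g := (t *m W^T) 0 ord0.
have g2 : g ^+ 2 = 1.
  have cop1 : coprimez r.+1%:Z (\det T1) by rewrite d1.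
  by apply: (trace_generator c1 cop1 (trW W ord0)) => j; rewrite trW tW.
have gu : g *: W \in unitmx.
  rewrite unitmxE detZ unitrMr -?unitmxE // unitrX //.
  by apply/unitrP; exists g; rewrite -expr2.
have [T2 [e2 [c2 d2]]] := change_basis bT gu.
exists (change b (g *: W)), T2, e2; split=> // [|j].
  by rewrite trW linearZ /= -scalemxAr mxE -/g -expr2 g2.
by rewrite trW linearZ /= -scalemxAr mxE tW mulr0.
Qed.

Section Lattice.
Variables (b : 'I_r.+1 -> F) (T : 'M[int]_r.+1) (e : 'I_r.+1 -> int).
Hypothesis (bT : gram_basis b T e) (dT : \det T != 0).
Hypothesis (b0 : field_trace (b ord0) = 1) (bj : forall j, field_trace (b (lift ord0 j)) = 0).

Definition trace_zero_gram : 'M[int]_r := \matrix_(i, j) T (lift ord0 i) (lift ord0 j).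
Definition trace_zero_point (v : 'rV[int]_r) : F := \sum_j b (lift ord0 j) *~ v 0 j.

Definition prepend0 (v : 'rV[int]_r) (j : 'I_r.+1) : int := if unlift ord0 j is Some k then v 0 k else 0.
Lemma prepend00 v : prepend0 v ord0 = 0. Proof. by rewrite /prepend0 unlift_none. Qed.
Lemma prepend0S v j : prepend0 v (lift ord0 j) = v 0 j. Proof. by rewrite /prepend0 liftK. Qed.

Lemma trace_zero_pointE v : trace_zero_point v = \sum_j b j *~ prepend0 v j.
Proof. by rewrite big_ord_recl prepend00 mulr0z add0r; apply: eq_bigr => j _; rewrite prepend0S. Qed.

Lemma trace_zero_pointM v w : field_trace (trace_zero_point v * trace_zero_point w) = (bil trace_zero_gram v w)%:~R.
Proof.
have [_ bTr _] := bT.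
rewrite {1}/trace_zero_point mulr_suml; under eq_bigr do rewrite mulrzAl.
rewrite (field_trace_sum sE.1) /bil -mulmxA mxE rmorph_sum; apply: eq_bigr => i _ /=.
rewrite intrM; congr (_ * _); rewrite trace_zero_pointE (trace_comb sE.1 bTr) mxE; congr (_%:~R).
rewrite big_ord_recl prepend00 mulr0 add0r; apply: eq_bigr => j _.
by rewrite prepend0S [w^T _ _]mxE [trace_zero_gram _ _]mxE.
Qed.

Lemma trace_zero_pointO v : trace_zero_integers F (trace_zero_point v).
Proof.
have [bz _ _] := bT; split; first by rewrite trace_zero_pointE; exact: zcomb_integral.
by rewrite /trace_zero_point (field_trace_sum sE.1) big1 // => j _; rewrite bj mulr0.
Qed.

Lemma trace_zero_point_eq0 v : trace_zero_point v = 0 -> v = 0.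
Proof.
have [_ bTr _] := bT; rewrite trace_zero_pointE => w0.
have Tw : T *m (\col_j prepend0 v j) = 0.
  apply/matrixP => i j; rewrite ord1 [RHS]mxE; apply: (@intr_inj rat).
  rewrite mxE; under eq_bigr do rewrite [(\col_j _) _ _]mxE.
  by rewrite -(trace_comb sE.1 bTr) w0 mulr0 -(mulr0z (0 : F)) scaler_int_intr (field_traceZ sE.1) mul0r.
have : \det T *: (\col_j prepend0 v j) = 0 by rewrite -mul_scalar_mx -mul_adj_mx -mulmxA Tw mulmx0.
move=> /matrixP h; apply/rowP => j; have := h (lift ord0 j) 0; rewrite !mxE prepend0S.
by move=> /eqP; rewrite mulf_eq0 (negbTE dT) => /eqP.
Qed.

Lemma trace_zero_gram_positive : positive_form trace_zero_gram.
Proof.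
have [_ bTr _] := bT; split.
  by apply/matrixP => i j; rewrite !mxE; apply: (@intr_inj rat); rewrite -!bTr mulrC.
move=> v v0; rewrite -(ltr0z R) -(ratr_int R) /quad -trace_zero_pointM sE.1.
have x0 : trace_zero_point v != 0 by apply: contraNneq v0 => /trace_zero_point_eq0 ->.
rewrite big_ord_recl; apply: ltr_pwDl; last by apply: sumr_ge0 => i _; rewrite rmorphM -expr2 sqr_ge0.
by rewrite rmorphM -expr2 lt_neqAle sqr_ge0 eq_sym sqrf_eq0 fmorph_eq0 x0.
Qed.

Lemma trace_zero_parametrizes : parametrizes trace_zero_gram trace_zero_point.
Proof.
have [bz bTr _] := bT; split; last by move=> v; rewrite expr2 trace_zero_pointM.
split=> [v _|v w _ _ vw|x [xO x0]]; first exact: trace_zero_pointO.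
  apply/eqP; rewrite -subr_eq0; apply/eqP/trace_zero_point_eq0; rewrite /trace_zero_point.
  under eq_bigr do rewrite !mxE mulrzBr.
  by rewrite sumrB; apply/eqP; rewrite subr_eq0; apply/eqP.
have [v vE] := bz.2 _ xO; exists (\row_j v (lift ord0 j)) => //.
have v0 : v ord0 = 0.
  apply: (@intr_inj rat); have := x0; rewrite vE (field_trace_sum sE.1) big_ord_recl b0 mulr1 big1 ?addr0 // => j _.
  by rewrite bj mulr0.
rewrite vE big_ord_recl v0 mulr0z add0r /trace_zero_point; apply: eq_bigr => j _; by rewrite mxE.
Qed.
End Lattice.
End Basis.

(** Supplies the sign by which an isometry must be corrected to extend with 1 fixed. The smallest
    modulus at which this would fail is 8. *)
Lemma unit_residue (n : nat) (x m : int) : (0 < n <= 4)%N -> x ^+ 2 - 1 = n%:Z * m ->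
  exists2 y : int, (y = 1 \/ y = -1) & exists z : int, x = y + z * n%:Z.
Proof.
move=> n4 E.
have [k [c [xk c4]]] : exists k c : int, x = 4 * k + c /\ [\/ c = 0, c = 1, c = 2 | c = 3].
  have c4 : [\/ (x %% 4)%Z = 0, (x %% 4)%Z = 1, (x %% 4)%Z = 2 | (x %% 4)%Z = 3].
    have := modz_ge0 x (isT : 4%:Z != 0); have := ltz_pmod x (isT : (0 < 4%:Z)).
    by case: (x %% 4)%Z => [[|[|[|[|k]]]]|k] // _ _; [exact: Or41|exact: Or42|exact: Or43|exact: Or44].
  by exists (x %/ 4)%Z, (x %% 4)%Z; split=> //; rewrite mulrC -divz_eq.
case: n n4 E => [|[|[|[|[|]]]]] //= _ E.
- by exists 1; [left|exists (x - 1); ring].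
- case: c4 => cE; rewrite cE in xk.
  + by move: E; rewrite xk (_ : _ ^+ 2 = 2 * (8 * k ^+ 2)); [move: (k ^+ 2); lia|ring].
  + by exists 1; [left|exists (2 * k); rewrite xk; ring].
  + by move: E; rewrite xk (_ : _ ^+ 2 = 2 * (8 * k ^+ 2 + 8 * k + 2)); [move: (k ^+ 2); lia|ring].
  + by exists 1; [left|exists (2 * k + 1); rewrite xk; ring].
- have [q [a [xq a3]]] : exists q a : int, x = 3 * q + a /\ [\/ a = 0, a = 1 | a = 2].
    have a3 : [\/ (x %% 3)%Z = 0, (x %% 3)%Z = 1 | (x %% 3)%Z = 2].
      have := modz_ge0 x (isT : 3%:Z != 0); have := ltz_pmod x (isT : (0 < 3%:Z)).
      by case: (x %% 3)%Z => [[|[|[|k']]]|k'] // _ _; [exact: Or31|exact: Or32|exact: Or33].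
    by exists (x %/ 3)%Z, (x %% 3)%Z; split=> //; rewrite mulrC -divz_eq.
  case: a3 => aE; rewrite aE in xq.
  + by move: E; rewrite xq (_ : _ ^+ 2 = 3 * (3 * q ^+ 2)); [move: (q ^+ 2); lia|ring].
  + by exists 1; [left|exists q; rewrite xq; ring].
  + by exists (-1); [right|exists (q + 1); rewrite xq; ring].
- case: c4 => cE; rewrite cE in xk.
  + by move: E; rewrite xk (_ : _ ^+ 2 = 4 * (4 * k ^+ 2)); [move: (k ^+ 2); lia|ring].
  + by exists 1; [left|exists k; rewrite xk; ring].
  + by move: E; rewrite xk (_ : _ ^+ 2 = 4 * (4 * k ^+ 2 + 4 * k + 1)); [move: (k ^+ 2); lia|ring].
  + by exists (-1); [right|exists (k + 1); rewrite xk; ring].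
Qed.

Section Trace.
Variables (R : realType) (F : fieldExtType rat) (r : nat) (s : 'I_r.+1 -> {rmorphism F -> R}).
Hypothesis sE : all_embeddings s.

Lemma field_traceMz (x : F) (m : int) : field_trace (x *~ m) = m%:~R * field_trace x.
Proof. by rewrite scaler_int_intr (field_traceZ sE.1). Qed.

Lemma field_traceN (x : F) : field_trace (- x) = - field_trace x.
Proof. by rewrite -mulrN1z field_traceMz mulN1r. Qed.

Lemma field_traceB (x y : F) : field_trace (x - y) = field_trace x - field_trace y.
Proof. by rewrite (field_traceD sE.1) field_traceN. Qed.

Lemma ring_of_integersMz (x : F) (m : int) : ring_of_integers F x -> ring_of_integers F (x *~ m).
Proof.
move=> xO; rewrite -mulrzr; apply: ring_of_integersM => //.
exact: (@integral_id _ _ (intr : {rmorphism int -> F})).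
Qed.

Lemma ring_of_integersB (x y : F) : ring_of_integers F x -> ring_of_integers F y -> ring_of_integers F (x - y).
Proof. exact: (@integral_sub _ _ (intr : {rmorphism int -> F})). Qed.

Lemma ring_of_integers1 : ring_of_integers F 1.
Proof. exact: (@integral1 _ _ (intr : {rmorphism int -> F})). Qed.

(* [T^-1] is integral at the divisors of [r.+1], since the discriminant is prime to them. *)
Lemma congruent_to_integer (c : 'I_r.+1 -> F) T e z : gram_basis c T e -> coprimez r.+1%:Z (\det T) ->
  field_trace (c ord0) = 1 -> (forall j, field_trace (c (lift ord0 j)) = 0) -> ring_of_integers F z ->
  (forall j, exists k : int, field_trace (z * c (lift ord0 j)) = (r.+1%:Z * k)%:~R) ->
  exists2 y, ring_of_integers F y & exists l : int, z = l%:~R + y *~ r.+1.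
Proof.
move=> cT cop c0 cj zO zc; have [cz cTr c1] := cT.
have [l lE] : exists l : int, field_trace (z * c ord0) = l%:~R.
  by apply: (trace_int sE.1); apply: ring_of_integersM => //; exact: cz.1.
have [v vE] := cz.2 _ (ring_of_integersB zO (ring_of_integersMz l ring_of_integers1)).
have Tv i : (r.+1%:Z %| \sum_j T i j * v j)%Z.
  suff [k kE] : exists k : int, field_trace (c i * (z - 1 *~ l)) = (r.+1%:Z * k)%:~R.
    by apply/dvdzP; exists k; apply: (@intr_inj rat); rewrite -(trace_comb sE.1 cTr) -vE kE mulrC.
  rewrite mulrBr field_traceB mulrzAr mulr1 field_traceMz mulrC.
  case: (unliftP ord0 i) => [j ->|->]; last by exists 0; rewrite c0 lE mulr1 subrr mulr0.
  by rewrite cj mulr0 subr0; exact: zc.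
have dv j : (r.+1%:Z %| v j)%Z.
  rewrite -(Gauss_dvdzr _ cop).
  have <- : (\adj T *m (T *m \col_k v k)) j 0 = \det T * v j by rewrite mulmxA mul_adj_mx mul_scalar_mx !mxE.
  rewrite mxE; apply: dvdz_sumr => k; rewrite dvdz_mull // mxE.
  by under eq_bigr do rewrite [(\col_k _) _ _]mxE.
exists (\sum_j c j *~ (v j %/ r.+1)%Z); first exact: zcomb_integral.
exists l; apply/eqP; rewrite addrC -subr_eq vE mulrz_suml; apply/eqP/eq_bigr => j _.
by rewrite -mulrzA divzK.
Qed.
End Trace.

(** * Extension of an isometry to the integers *)

Definition normal (F : fieldExtType rat) r (b : 'I_r.+1 -> F) (T : 'M[int]_r.+1) (e : 'I_r.+1 -> int) : Prop :=
  [/\ gram_basis b T e, field_trace (b ord0) = 1 & forall j, field_trace (b (lift ord0 j)) = 0].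

Section Extension.
Variables (R : realType) (K L : fieldExtType rat) (r : nat).
Variables (s : 'I_r.+1 -> {rmorphism K -> R}) (t : 'I_r.+1 -> {rmorphism L -> R}).
Hypothesis (sE : all_embeddings s) (tE : all_embeddings t).
Variables (b : 'I_r.+1 -> K) (T : 'M[int]_r.+1) (e : 'I_r.+1 -> int).
Variables (c : 'I_r.+1 -> L) (T' : 'M[int]_r.+1) (e' : 'I_r.+1 -> int).
Hypothesis (bT : normal b T e) (cT : normal c T' e').
Hypothesis (cop : coprimez r.+1%:Z (\det T')) (n4 : (r.+1 <= 4)%N).
Notation P := (trace_zero_point b).
Variable phi : 'rV[int]_r -> L.
Hypothesis phiO : forall v, trace_zero_integers L (phi v).
Hypothesis phiT : forall v w, field_trace (phi v * phi w) = field_trace (P v * P w).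
Hypothesis phi_onto : forall x, trace_zero_integers L x -> exists v, phi v = x.
Hypothesis phi_comb : forall v, phi v = \sum_j phi (delta_mx 0 j) *~ v 0 j.

Lemma trace_zero_point_delta j : P (delta_mx 0 j) = b (lift ord0 j).
Proof.
rewrite /trace_zero_point (bigD1 j) //= big1 => [|i /negbTE ij]; first by rewrite !mxE !eqxx mulr1z addr0.
by rewrite mxE eqxx ij mulr0z.
Qed.

Lemma normal_coord0 : e ord0 = r.+1.
Proof.
have [[_ _ b1] b0 bj] := bT; apply: (@intr_inj rat); rewrite -[RHS](trace1 sE) b1 (field_trace_sum sE.1) big_ord_recl b0 mulr1.
by rewrite big1 ?addr0 // => j _; rewrite bj mulr0.
Qed.

(** What is missing is an image [c_0] of [b_0]. The element [1 - n b_0] has trace 0; its image [z]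
    has trace products with the trace-zero integers divisible by [n], so [z] is congruent to an
    integer [l] modulo [n]. Comparing [Tr(z^2)] in both fields gives [l^2 = 1] modulo [n], hence
    [l = eps] with [eps] a sign. So [c_0 = (1 - eps z) / n] is integral, and [eps phi] extends by
    it. *)
Lemma gram_basis_extension : exists c' : 'I_r.+1 -> L, gram_basis c' T e.
Proof.
have [bT' b0 bj] := bT; have [bz bTr b1] := bT'; have [cT'' c0 cj] := cT.
have eN := normal_coord0; pose n : int := r.+1.
have n0 : n%:~R != 0 :> rat by rewrite intr_eq0.
pose ez : 'rV[int]_r := \row_j e (lift ord0 j); pose z := phi ez.
have wE : P ez = 1 - b ord0 *~ n.
  rewrite b1 big_ord_recl eN addrC addKr /trace_zero_point; apply: eq_bigr => j _.
  by rewrite !mxE.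
have zf j : field_trace (z * phi (delta_mx 0 j)) = - (n * T ord0 (lift ord0 j))%:~R.
  rewrite phiT trace_zero_point_delta wE mulrBl mul1r (field_traceB sE) bj mulrzAl (field_traceMz sE) bTr intrM.
  by rewrite sub0r.
have zz : field_trace (z * z) = (n * (n * T ord0 ord0 - 1))%:~R.
  rewrite phiT wE mulrBl mul1r (field_traceB sE) mulrBr mulr1 !(field_traceB sE) (trace1 sE) mulrzAr mulrzAl !(field_traceMz sE) bTr b0.
  by rewrite pmulrn !(intrM, intrB); ring.
have [y yO [l zl]] : exists2 y, ring_of_integers L y & exists l : int, z = l%:~R + y *~ r.+1.
  apply: (congruent_to_integer tE cT'' cop c0 cj (phiO ez).1) => j.
  have cO : trace_zero_integers L (c (lift ord0 j)).
    by split; [case: cT'' => -[]|exact: cj].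
  have [v <-] := phi_onto cO; rewrite (phi_comb v) mulr_sumr.
  under eq_bigr do rewrite mulrzAr.
  rewrite (field_trace_sum tE.1); exists (- \sum_i v 0 i * T ord0 (lift ord0 i)).
  rewrite mulrN intrN mulr_sumr rmorph_sum -sumrN; apply: eq_bigr => i _ /=.
  by rewrite zf !intrM; ring.
have [k kE] := trace_int tE.1 (ring_of_integersM yO yO).
have z0 : field_trace z = 0 by exact: (phiO ez).2.
have yE : n%:~R * field_trace y = - (l%:~R * n%:~R).
  have := z0; rewrite zl (field_traceD tE.1) -[l%:~R]/(1 *~ l) !(field_traceMz tE) (trace1 tE) => h.
  by apply/eqP; rewrite -addr_eq0 addrC; apply/eqP.
(* Two computations of [Tr(z^2)]: it is [n (n T_00 - 1)] by the isometry and [n^2 k - n l^2] from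
   [z = l + n y]. *)
have lE : l ^+ 2 - 1 = n * (k - T ord0 ord0).
  apply: (@intr_inj rat); apply: (mulfI n0).
  have : field_trace (z * z) = - (n%:~R * l%:~R ^+ 2) + n%:~R ^+ 2 * k%:~R.
    rewrite zl -[l%:~R]/(1 *~ l) mulrDl !mulrDr !mulrzAl !mulrzAr !mul1r !mulr1 -!mulrzA !(field_traceD tE.1) !(field_traceMz tE) (trace1 tE) kE.
    move: yE; rewrite -(mulrzr (l%:~R ^+ 2) n) -(mulrzr (n%:~R ^+ 2) k) !intrM -[r.+1%:R]/(n%:~R : rat); move: (field_trace y) (n%:~R : rat) (l%:~R : rat) => ty n' l' yE.
    by transitivity (l' * l' * n' + 2 * l' * (n' * ty) + n' * n' * k%:~R); [ring|rewrite yE; ring].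
  rewrite zz !(intrM, intrB, rmorphXn) /= => h; move: h; move: (n%:~R : rat) (l%:~R : rat) (k%:~R : rat) ((T _ _)%:~R : rat) => n' l' k' T0 h.
  by lra.
have [eps epsE [m lm]] := unit_residue (n := r.+1) n4 lE.
have e2 : eps * eps = 1 by case: epsE => ->.
(* This is [(1 - eps z) / n], because [z = eps + n (m + y)]. *)
pose c1 := - ((m%:~R + y) *~ eps).
have c1O : ring_of_integers L c1.
  rewrite /c1 -mulrNz; apply: ring_of_integersMz.
  by apply: (@integral_add _ _ (intr : {rmorphism int -> L})) => //; exact: (@integral_id _ _ (intr : {rmorphism int -> L})).
have c1E : c1 *~ n = 1 - z *~ eps.
  have e2L : eps%:~R * eps%:~R = 1 :> L by rewrite -intrM e2.
  rewrite -(mulrzr c1) -(mulrzr z) zl -(mulrzr y) lm /c1 -(mulrzr (m%:~R + y)) intrD intrM -[Posz r.+1]/n.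
  move: (n%:~R : L) (m%:~R : L) (eps%:~R : L) e2L => n' m' eps' e2L.
  by rewrite -[X in X - _]e2L; ring.
pose c' i := if unlift ord0 i is Some j then phi (delta_mx 0 j) *~ eps else c1.
have c'0 : c' ord0 = c1 by rewrite /c' unlift_none.
have c'S j : c' (lift ord0 j) = phi (delta_mx 0 j) *~ eps by rewrite /c' liftK.
have eps2 : eps%:~R * eps%:~R = 1 :> rat by rewrite -intrM e2.
have tr1 : field_trace c1 = 1.
  apply: (mulfI n0); rewrite -(field_traceMz tE) c1E (field_traceB tE) (field_traceMz tE) z0 mulr0 subr0 mulr1.
  by rewrite (trace1 tE).
have cc0 j : field_trace (c1 * (phi (delta_mx 0 j) *~ eps)) = (T ord0 (lift ord0 j))%:~R.
  apply: (mulfI n0); rewrite -(field_traceMz tE) -mulrzAl c1E mulrzAr mulrBl mul1r mulrzAl (field_traceMz tE) (field_traceB tE) (field_traceMz tE) zf.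
  rewrite (phiO _).2 intrM; move: (n%:~R : rat) ((T _ _)%:~R : rat) => n' T0.
  by transitivity (eps%:~R * eps%:~R * (n' * T0)); [ring|rewrite eps2 mul1r].
have cc1 : field_trace (c1 * c1) = (T ord0 ord0)%:~R.
  apply: (mulfI n0); apply: (mulfI n0); rewrite -!(field_traceMz tE) -mulrzAr -mulrzAl c1E.
  rewrite mulrBl mul1r mulrBr mulr1 !(field_traceB tE) mulrzAl mulrzAr !(field_traceMz tE) z0 zz (trace1 tE) mulr0 subr0 sub0r opprK.
  by rewrite mulrA eps2 mul1r -[r.+1%:R]/(n%:~R : rat) !(intrM, intrB); ring.
exists c'; split.
- split=> [i|x xO].
    case: (unliftP ord0 i) => [j ->|->]; rewrite ?c'0 ?c'S //; apply: ring_of_integersMz; exact: (phiO _).1.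
  have [kx kxE] := trace_int tE.1 xO.
  have [v vE] : exists v, phi v = x - c1 *~ kx.
    apply: phi_onto; split; first by apply: ring_of_integersB => //; exact: ring_of_integersMz.
    by rewrite (field_traceB tE) (field_traceMz tE) tr1 mulr1 kxE subrr.
  exists (fun i => if unlift ord0 i is Some j then eps * v 0 j else kx).
  rewrite big_ord_recl unlift_none c'0; apply/eqP; rewrite addrC -subr_eq -vE phi_comb; apply/eqP/eq_bigr => j _.
  by rewrite liftK c'S -mulrzA mulrA e2 mul1r.
- move=> i j; case: (unliftP ord0 i) => [i' ->|->]; case: (unliftP ord0 j) => [j' ->|->]; rewrite ?c'0 ?c'S //.
    rewrite mulrzAl mulrzAr !(field_traceMz tE) phiT !trace_zero_point_delta bTr mulrA eps2 mul1r //.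
  rewrite mulrC cc0; congr (_%:~R); apply: (@intr_inj rat); rewrite -!bTr mulrC //.
- rewrite big_ord_recl c'0 eN -/n c1E; under eq_bigr do rewrite c'S -mulrzA mulrC mulrzA.
  have -> : \sum_(i < r) phi (delta_mx 0 i) *~ e (lift ord0 i) *~ eps = z *~ eps.
    rewrite /z phi_comb mulrz_suml; apply: eq_bigr => j _; by rewrite mxE.
  by rewrite subrK.
Qed.
End Extension.

(** * The theorem *)

Lemma embeddings_exist (R : realType) (F : fieldExtType rat) n : \dim {:F} = n -> totally_real R F ->
  exists (s : 'I_n -> {rmorphism F -> R}) (x : F), all_embeddings s /\ injective (s^~ x).
Proof.
move=> <- /real_embeddings[s [x [inj gen]]]; exists s, x; split=> //; split; first exact: trace_embeddings inj.
move=> b A y span yb; apply: (fmorph_inj (ratr : {rmorphism rat -> R})) => /=.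
by rewrite (trace_embeddings inj) (trace_mx inj span yb).
Qed.

(** An isomorphism preserves integrality and traces, so it reindexes the series term by term. *)
Lemma isomorphism_theta (R : realType) (K L : fieldExtType rat) (f : {rmorphism K -> L}) :
  totally_real R L -> \dim {:K} = \dim {:L} -> bijective f -> theta K = theta L :> (upper_half_plane R -> R[i]).
Proof.
move=> rL dimKL [g fK gK]; have [t [x [tE _]]] := embeddings_exist (esym dimKL) rL.
have fZ (q : rat) (y : K) : f (q *: y) = q *: f y by rewrite rmorphZ_num; have /= -> := rmorphZ_num (idfun : {rmorphism L -> L}) q (f y).
have fT y : field_trace (f y) = field_trace y.
  have bb := vbasisP {:K}.
  symmetry; apply: (tE.2 (fun i => f (vbasis {:K})`_i)) => [z|j].
    exists (fun i => coord (vbasis {:K}) i (g z)); rewrite -{1}[z]gK {1}(coord_vbasis (memvf (g z))) rmorph_sum.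
    by apply: eq_bigr => i _; rewrite fZ.
  have := passmx.mul_mxof (vbasis {:K}) (vbasis {:K}) (amull y) (delta_mx 0 j).
  rewrite passmx.vecof_delta -rowE => /(congr1 (passmx.vecof (vbasis {:K}))); rewrite passmx.rVofK // lfunE /= => yb.
  by rewrite -rmorphM -yb /passmx.vecof rmorph_sum; apply: eq_bigr => k _; rewrite fZ !mxE.
have fO y : ring_of_integers K y <-> ring_of_integers L (f y).
  split=> -[p pm pr]; exists p => //.
    have := rmorph_root f pr; rewrite -map_poly_comp; congr (root _ _); apply: eq_map_poly => z /=; exact: rmorph_int.
  have := pr; rewrite -(fmorph_root f) -map_poly_comp; congr (root _ _); apply: eq_map_poly => z /=.
  by rewrite rmorph_int.
have fO0 (a : trace_zero_integers K) : f (\val a) \in trace_zero_integers L.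
  have [aO a0] := set_mem (valP a); by apply/mem_set; split; [apply/fO|rewrite fT].
have gO0 (a : trace_zero_integers L) : g (\val a) \in trace_zero_integers K.
  have [aO a0] := set_mem (valP a); by apply/mem_set; split; [apply/fO; rewrite gK|rewrite -fT gK].
apply/funext => z; rewrite /theta.
pose h (a : trace_zero_integers K) : trace_zero_integers L := exist _ (f (\val a)) (fO0 a).
pose h' (a : trace_zero_integers L) : trace_zero_integers K := exist _ (g (\val a)) (gO0 a).
have hK : cancel h h' by move=> a; apply/val_inj; rewrite /= fK.
have h'K : cancel h' h by move=> a; apply/val_inj; rewrite /= gK.
rewrite -(sum_reindex _ hK h'K); apply: eq_sum => a.
by rewrite /comp (_ : \val (h a) = f (\val a)) // -rmorphXn fT.
Qed.

Section Point.
Variables (F : fieldExtType rat) (r : nat) (b : 'I_r.+1 -> F).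
Lemma trace_zero_pointZ (x : int) v : trace_zero_point b (x *: v) = trace_zero_point b v *~ x.
Proof.
rewrite /trace_zero_point mulrz_suml; apply: eq_bigr => j _.
by rewrite mxE mulrC mulrzA.
Qed.
Lemma trace_zero_point_sum (I : finType) (v : I -> 'rV[int]_r) :
  trace_zero_point b (\sum_i v i) = \sum_i trace_zero_point b (v i).
Proof.
apply: (big_morph (trace_zero_point b)) => [v' w|]; rewrite /trace_zero_point.
  by rewrite -big_split; apply: eq_bigr => j _; rewrite mxE mulrzDr.
by rewrite big1 // => j _; rewrite mxE mulr0z.
Qed.
End Point.

Lemma bil_of_quad r (G H : 'M[int]_r) (U : 'M[int]_r) : positive_form G -> positive_form H ->
  (forall v, quad H (v *m U) = quad G v) -> forall v w, bil H (v *m U) (w *m U) = bil G v w.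
Proof.
move=> GP HP E v w; have := E (1 *: v + 1 *: w).
by rewrite mulmxDl -!scalemxAl !(quadD GP, quadD HP) !E; lia.
Qed.

(** On trace-zero elements [vform] is, up to sign, the product of the differences of the conjugates.
    An integral multiple of the primitive element, tripled and shifted by an integer to have trace
    0, keeps its conjugates distinct. *)
Lemma generic_trace_zero (R : realType) (F : fieldExtType rat) (s : 'I_3 -> {rmorphism F -> R}) (x : F) (b : 'I_3 -> F) T e :
  all_embeddings s -> injective (s^~ x) -> normal b T e -> \det T != 0 ->
  exists m n : int, let u := comb2 (b (lift ord0 ord0)) (b (lift ord0 (lift ord0 ord0))) m n in
    vform (s i0 u) (s i1 u) != 0.
Proof.
move=> sE inj [bT b0 bj] dT; have [bz bTr _] := bT.
have [q qE] := zspan_span sE.1 bTr dT ord0 x.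
pose D := \prod_j denq (q j); have D0 : D != 0 by apply/prodf_neq0 => j _; rewrite denq_eq0.
have DxO : ring_of_integers F (x *~ D).
  have /choice[z zE] : forall j, exists z : int, D%:~R * q j = z%:~R.
    move=> j; rewrite /D (bigD1 j) //= intrM mulrAC (mulrC _ (q j)) -numqE -intrM.
    by exists (numq (q j) * \prod_(i < 3 | i != j) denq (q i)).
  have -> : x *~ D = \sum_j b j *~ z j.
    by rewrite qE mulrz_suml; apply: eq_bigr => j _; rewrite !scaler_int_intr scalerA zE.
  exact: zcomb_integral.
have [k kE] := trace_int sE.1 DxO.
pose X := x *~ D *~ 3 - 1 *~ k.
have XO : trace_zero_integers F X.
  split; first by apply: ring_of_integersB; apply: ring_of_integersMz => //; exact: ring_of_integers1.
  by rewrite (field_traceB sE) (field_traceMz sE) kE (field_traceMz sE) (trace1 sE) mulrC subrr.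
have [[_ _ hS] _] := trace_zero_parametrizes sE bT dT b0 bj.
have [v _ vX] := hS _ XO; exists (v 0 ord0), (v 0 (lift ord0 ord0)).
have -> : comb2 (b (lift ord0 ord0)) (b (lift ord0 (lift ord0 ord0))) (v 0 ord0) (v 0 (lift ord0 ord0)) = X.
  by rewrite -vX /trace_zero_point !big_ord_recl big_ord0 addr0.
have X3 := third_conjugate sE XO.2.
have sX i j : i != j -> s i X - s j X != 0.
  move=> ij; rewrite subr_eq0; apply: contra_neq ij => sij; apply: inj.
  have d3 : (D * 3)%:~R != 0 :> R by rewrite intr_eq0 mulf_neq0.
  apply: (mulfI d3); move: sij; rewrite /X !rmorphB -mulrzA !(rmorphMz (s _)) /= !rmorph1 => /addIr.
  by rewrite -(mulrzl (s i x)) -(mulrzl (s j x)).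
rewrite /vform (_ : 2 * s i0 X + s i1 X = s i0 X - s i2 X); last by rewrite X3; ring.
rewrite (_ : s i0 X + 2 * s i1 X = s i1 X - s i2 X); last by rewrite X3; ring.
by rewrite !mulf_neq0 ?sX.
Qed.

Lemma det2 (S : comNzRingType) (A : 'M[S]_2) :
  \det A = A ord0 ord0 * A (lift ord0 ord0) (lift ord0 ord0) - A ord0 (lift ord0 ord0) * A (lift ord0 ord0) ord0.
Proof.
rewrite (expand_det_row _ ord0) !big_ord_recl big_ord0 /cofactor !det_mx11 !mxE /=.
have -> : lift (lift ord0 ord0) ord0 = ord0 :> 'I_2 by exact/val_inj.
rewrite addr0 expr0 expr1 mul1r mulN1r mulrN.
by congr (_ - _).
Qed.

Lemma adj3_coord0 (T : 'M[int]_3) : \adj T ord0 ord0 = T i1 i1 * T i2 i2 - T i1 i2 * T i2 i1.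
Proof.
rewrite mxE /cofactor /= addn0 expr0 mul1r det2 !mxE.
by congr (T _ _ * T _ _ - T _ _ * T _ _); exact/val_inj.
Qed.

Lemma fundamental_neq0 d : fundamental_discriminant d -> d != 0.
Proof.
move=> fd; apply/eqP => dz; case: fd => [[]|[m [dm m4 _]]]; first by rewrite dz mod0z.
by have mz : m = 0 by [lia]; move: m4; rewrite mz mod0z; case.
Qed.

Lemma theta_isomorphic (R : realType) (K L : fieldExtType rat) (r : nat) (d : int) :
  totally_real R K -> totally_real R L -> \dim {:K} = r.+1 -> \dim {:L} = r.+1 -> (r.+1 <= 4)%N ->
  discriminant K = d -> discriminant L = d -> fundamental_discriminant d -> coprimez r.+1%:Z d ->
  theta K = theta L :> (upper_half_plane R -> R[i]) -> exists f : {rmorphism K -> L}, bijective f.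
Proof.
move=> rK rL dimK dimL r4 dK dL fd cop KL; have d0 := fundamental_neq0 fd.
have [s [x [sE inj]]] := embeddings_exist dimK rK; have [t [y [tE _]]] := embeddings_exist dimL rL.
have [b1 [T1 [e1 [b1T T1d]]]] := gram_basis_of_discriminant sE dimK dK d0.
have [c1 [U1 [e2 [c1U U1d]]]] := gram_basis_of_discriminant tE dimL dL d0.
have [|b [T [e [bT Td b0 bj]]]] := normal_basis sE b1T; first by rewrite T1d.
have [|c [T' [e' [cT T'd c0 cj]]]] := normal_basis tE c1U; first by rewrite U1d.
rewrite T1d in Td; rewrite U1d in T'd.
have dT : \det T != 0 by rewrite Td.
have dT' : \det T' != 0 by rewrite T'd.
have nb : normal b T e by []. have nc : normal c T' e' by [].
have GP := trace_zero_gram_positive sE bT dT; have HP := trace_zero_gram_positive tE cT dT'.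
have Kp := trace_zero_parametrizes sE bT dT b0 bj; have Lp := trace_zero_parametrizes tE cT dT' c0 cj.
have [|U Uu UE] := @theta_determines_le3 r _ _ _ GP HP (theta_same_values GP HP Kp Lp KL); first by rewrite -ltnS.
have BE := bil_of_quad GP HP UE.
pose phi v := trace_zero_point c (v *m U).
have phiO v : trace_zero_integers L (phi v) by rewrite /phi; apply: (trace_zero_pointO tE cT cj).
have phiT v w : field_trace (phi v * phi w) = field_trace (trace_zero_point b v * trace_zero_point b w).
  by rewrite (trace_zero_pointM tE cT) (trace_zero_pointM sE bT) BE.
have phi_onto z : trace_zero_integers L z -> exists v, phi v = z.
  by case: Lp => [[_ _ onto] _] /onto[w _ <-]; exists (w *m invmx U); rewrite /phi mulmxKV.
have phi_comb v : phi v = \sum_j phi (delta_mx 0 j) *~ v 0 j.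
  rewrite /phi {1}[v]row_sum_delta mulmx_suml trace_zero_point_sum; apply: eq_bigr => j _.
  by rewrite -scalemxAl trace_zero_pointZ.
have [r2|r2] := eqVneq r 2%N.
  subst r; have [m [n vn]] := generic_trace_zero sE inj nb dT.
  have bp j := trace_zero_point_delta b j.
  pose w1 := phi (delta_mx 0 ord0); pose w2 := phi (delta_mx 0 (lift ord0 ord0)).
  have [bz bTr _] := bT.
  apply: (@cubic_isomorphic R K L s t sE tE b T e c T' e' d bT cT Td T'd fd _ (b (lift ord0 ord0)) (b (lift ord0 (lift ord0 ord0))) w1 w2
    (bz.1 _) (bz.1 _) (phiO _).1 (phiO _).1 (bj _) (bj _) (phiO _).2 (phiO _).2 _ _ _ _ _ _ vn).
  - move=> d3; move: cop; rewrite coprimezE /coprime => /eqP c3.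
    by move: d3; rewrite dvdzE => d3; have := dvdn_gcd 3 3 `|d|; rewrite d3 c3.
  - by rewrite phiT !bp.
  - by rewrite phiT !bp.
  - by rewrite phiT !bp.
  (* The traces of the basis make [T e] the first unit vector. Hence the cofactor at 0, which is the
     Gram determinant of the trace-zero lattice, equals [d e_0 = 3 d]. *)
  have : \sum_j \adj T ord0 j * (\sum_k T j k * e k) = d * e ord0.
    transitivity ((\adj T *m (T *m \col_k e k)) ord0 0); last by rewrite mulmxA mul_adj_mx mul_scalar_mx Td !mxE.
    rewrite mxE; apply: eq_bigr => j _; congr (_ * _); rewrite mxE; apply: eq_bigr => k _; by rewrite mxE.
  have te j : (\sum_k T j k * e k) = (j == ord0)%:R.
    apply: (@intr_inj rat); rewrite (gram_mul_coord sE _ bT).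
    by case: (unliftP ord0 j) => [k ->|->]; [rewrite bj eq_sym (negbTE (neq_lift _ _))|rewrite b0 eqxx].
  under eq_bigr do rewrite te; rewrite (bigD1 ord0) //= big1 => [|j /negbTE -> ]; last by rewrite mulr0.
  rewrite (normal_coord0 sE nb) mulr1 addr0 mulrC => <-.
  rewrite !bTr -rmorphXn -intrM -rmorphB /=; congr (_%:~R).
  have sym i j : T i j = T j i by apply: (@intr_inj rat); rewrite -!bTr mulrC.
  by rewrite adj3_coord0 expr2 -[T i2 i1]sym.
have cop' : coprimez r.+1%:Z (\det T') by rewrite T'd.
have [c' c'T] := gram_basis_extension sE tE nb nc cop' r4 phiO phiT phi_onto phi_comb.
apply: (same_gram_isomorphic sE tE ord0 bT c'T dT); rewrite Td.
(* If 4 divides [d], the degree is odd and so equal to 1, since 3 has been dealt with; but in degree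
   1 the discriminant is 1. *)
case: fd => [[_ //]|[m [dm _ _]]].
have r0 : r = 0%N.
  move: cop; rewrite dm coprimezMr => /andP[c4 _]; move: c4 r4 r2 {bT cT bj cj b0 c0 Kp Lp GP HP U Uu UE BE phi phiO phiT phi_onto phi_comb}.
  by case: (r) => [|[|[|[|]]]].
subst r; have := gram_mul_coord sE ord0 bT; rewrite big_ord1 b0 (normal_coord0 sE nb) mulr1 => /eqP.
rewrite -[1%R]/(1%:~R) eqr_int => /eqP T00.
by move: Td; rewrite (mx11_scalar T) det_scalar1 T00 dm => h; exfalso; lia.
Qed.

Theorem theorem1p2 (R : realType) (K L : fieldExtType rat) (n : nat) (d : int) :
  totally_real R K -> totally_real R L ->
  \dim {:K} = n -> \dim {:L} = n -> (n <= 4)%N ->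
  discriminant K = d -> discriminant L = d ->
  fundamental_discriminant d ->
  coprimez n%:Z d ->
  (exists f : {rmorphism K -> L}, bijective f) <->
  theta K = theta L :> (upper_half_plane R -> R[i]).
Proof.
move=> rK rL dimK dimL n4 dK dL fd cop; split=> [[f fb]|].
  by apply: (isomorphism_theta rL _ fb); rewrite dimK dimL.
case: n dimK dimL n4 cop => [dimK|r dimK dimL n4 cop]; first by have := adim_gt0 {:K}%AS; rewrite dimK.
exact: theta_isomorphic rK rL dimK dimL n4 dK dL fd cop.
Qed.
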